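(* Let $M$ be an $n$-dimensional Lie group equipped with a left-invariant sub-Riemannian structure, and with a left-invariant measure $\mu$. Let $Y_1,\dots,Y_n$ be a global left-invariant frame for $TM$. Then, for all $k,m\in\mathbb{N}$ with $m\geq1$, there exists a polynomial function $P^k_m$ in $n+n^2+1$ variables and with real coefficients, homogeneous of degree $k$, such that for any $C^2$ non-characteristic embedded submanifold $S\subset M$ (without boundary) of codimension $m\geq1$ it holds $$\mathrm{div}^k_{\mu/\delta^{m-1}}(\nabla\delta)=P^k_m\left(\dots,Y_\alpha\delta,\dots,Y_\alpha Y_\beta\delta,\dots,\tfrac{m-1}{\delta}\right)\qquad\text{on }U\setminus S,$$ where in the variables $Y_\alpha\delta$, $Y_\alpha Y_\beta\delta$ the indices $\alpha,\beta$ run over $\{1,\dots,n\}$, $\delta$ is the distance from $S$, and $U$ is the tubular neighbourhood of $S$. For the case of hypersurfaces ($m=1$) the polynomials $P^k_1$ do not depend on the last variable. Furthermore, if $S$ is a hypersurface ($m=1$) that is also two-sided, then $$\mathrm{div}^k_{\mu}(\nabla\delta_{\mathrm{sign}})=P^k_1\left(\dots,Y_\alpha\delta_{\mathrm{sign}},\dots,Y_\alpha Y_\beta\delta_{\mathrm{sign}},\dots,0\right)\qquad\text{on the whole }U.$$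
   Context: Sub-Riemannian structure. $M$ is a smooth connected manifold with a generating family of global smooth vector fields $X_1,\dots,X_N$ that is bracket-generating; it is left-invariant on a Lie group if the $X_i$ are left-invariant. The distribution is $\mathcal{D}_p=\mathrm{span}\{X_1(p),\dots,X_N(p)\}$, with norm $\|v\|_p^2=\inf\{\sum_i u_i^2 \mid \sum_i u_iX_i(p)=v\}$. Horizontal curves $\gamma:[0,1]\to M$ are absolutely continuous curves with $\dot\gamma_t=\sum_i u_i(t)X_i(\gamma_t)$ a.e., $u\in L^\infty([0,1],\mathbb{R}^N)$, with length $\ell(\gamma)=\int_0^1\|\dot\gamma_t\|\,dt$; $\mathsf{d}(p,q)$ is the infimum of lengths of horizontal curves joining $p$ and $q$. For a $C^1$ function $a$, $\nabla a=\sum_{i=1}^N (X_ia)X_i$ is the horizontal gradient, with $\|\nabla a\|=\sqrt{\sum_i(X_ia)^2}$. The Hamiltonian is $H(\lambda)=\frac12\sum_i\langle\lambda,X_i\rangle^2$ on $T^*M$, $e^{t\vec H}$ is its Hamiltonian flow, $\pi:T^*M\to M$ the projection. For an embedded submanifold $S$: $AS=\{\lambda\in T^*M\mid \pi(\lambda)\in S,\ \langle\lambda,T_{\pi(\lambda)}S\rangle=0\}$; $E:AS\to M$, $E(\lambda)=\pi\circ e^{\vec H}(\lambda)$; $\delta(p)=\inf\{\mathsf{d}(p,q)\mid q\in S\}$. $S$ is non-characteristic if $\mathcal{D}_q+T_qS=T_qM$ for all $q\in S$. A minimizing geodesic from $S$ is a constant-speed horizontal curve $\gamma:[0,1]\to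 M$ with $\gamma_0\in S$, $\gamma_1\notin S$, $\ell(\gamma)=\delta(\gamma_1)$. Tubular neighbourhood $U$ of a $C^2$ non-characteristic $S$: $U=E(V)$ with $V=\{\lambda\in AS\mid\sqrt{2H(\lambda)}<\varepsilon(\pi(\lambda))\}$, where $\varepsilon:S\to\mathbb{R}_{>0}$ is a continuous function such that (such $\varepsilon$ exists): $E:V\to U$ is a $C^1$ diffeomorphism; for every $\lambda\in V$ with $E(\lambda)\notin S$, $t\mapsto E(t\lambda)$ is the unique minimizing geodesic from $S$ to $E(\lambda)$, so $\delta\circ E=\sqrt{2H}$ on $V$; $\delta\in C^2(U\setminus S)$ with $\|\nabla\delta\|=1$ there; $\delta^2\in C^2(U)$; and for all smooth vector fields $X,Y$ the functions $\delta,X\delta,YX\delta$ are smooth in $t\in(0,1]$ along minimizing geodesics $\gamma$ from $S$ with $\gamma((0,1])\subset U\setminus S$. Two-sided hypersurface: $S$ has codimension one and admits a continuous, never-vanishing vector field $N$ along $S$, transverse to $S$. With $A^{\pm}S=\{\lambda\in AS\mid\pm\langle\lambda,N\rangle>0\}$, the signed distance $\delta_{\mathrm{sign}}:U\to\mathbb{R}$ equals $\delta$ on $E(A^+S\cap V)$, $-\delta$ on $E(A^-S\cap V)$ and $0$ on $S$; it is of class $C^2$ on $U$. Iterated divergences: for a positive density $\omega$ and a vector field $X$, $\mathrm{div}^j_\omega(X)$ is the function such that $\mathscr{L}^j_X\omega=\mathrm{div}^j_\omega(X)\,\omega$, provided the Lie derivatives exist. Thus $\mathrm{div}^0_\omega(X)=1$,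 $\mathrm{div}^1_\omega(X)$ is the usual divergence, and $\mathrm{div}^{j+1}_\omega(X)=\mathrm{div}_\omega(X)\,\mathrm{div}^j_\omega(X)+X(\mathrm{div}^j_\omega(X))$ (derivative along integral curves of $X$). $\mathbb{N}$ includes $0$. *)

(* Defs.v *)
From HB Require Import structures.
From mathcomp Require Import all_boot all_order all_algebra.
From mathcomp Require Import all_classical all_reals all_analysis.

Set Implicit Arguments.
Unset Strict Implicit.
Unset Printing Implicit Defensive.

Import Order.TTheory GRing.Theory Num.Theory.
Import numFieldNormedType.Exports.

Local Open Scope classical_set_scope.
Local Open Scope ring_scope.

(** * C^k maps between normed modules *)

(* Meant for open sets A. *)
Fixpoint C_on {R : realType} {U V : normedModType R} (k : nat) (f : U -> V)
    (A : set U) : Prop :=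
  match k with
  | 0%N => forall x, A x -> {for x, continuous f}
  | k'.+1 => (forall x, A x -> differentiable f x) /\
             (forall v, C_on k' (fun x => 'D_v f x) A)
  end.

Definition C_near {R : realType} {U V : normedModType R} (k : nat)
    (f : U -> V) (x : U) : Prop :=
  exists A : set U, [/\ open A, A x & C_on k f A].

(** * Smooth manifolds, with a preferred chart at each point *)

Record chart (R : realType) (n : nat) (M : topologicalType) := Chart {
  cdom : set M;
  cmap :> M -> 'rV[R]_n;
  cinv : 'rV[R]_n -> M;
  cdom_open : open cdom;
  cimg_open : open (cmap @` cdom);
  cmapK : forall p, cdom p -> cinv (cmap p) = p;
  cmap_continuous : forall p, cdom p -> {for p, continuous cmap};
  cinv_continuous : forall p, cdom p -> {for cmap p, continuous cinv} }.

(* The smooth structure is the one generated by the charts [chart_at p]. *)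
Record smooth_manifold (R : realType) (n : nat) := SmoothManifold {
  mcarrier :> topologicalType;
  chart_at : mcarrier -> chart R n mcarrier;
  mem_chart_at : forall p, cdom (chart_at p) p;
  chart_smooth : forall p q r, cdom (chart_at p) r -> cdom (chart_at q) r ->
    forall k, C_near k (chart_at q \o cinv (chart_at p)) (chart_at p r);
  manifold_hausdorff : hausdorff_space mcarrier;
  manifold_second_countable : @second_countable mcarrier }.

Arguments chart_at {R n s} _.

(* A tangent vector at p is given by its coordinates, a row vector, in the
   chart [chart_at p]; a covector at p is a column vector in the dual basis.
   So T_pM and T*_pM are 'rV_n and 'cV_n, and T*M is M * 'cV_n as a set; its
   topology and smooth structure are those of the coordinates [tcoord] below,
   not the product ones. *)
Definition vfield {R : realType} {n : nat} (M : smooth_manifold R n) : Type :=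
  M -> 'rV[R]_n.

Definition cotangent {R : realType} {n : nat} (M : smooth_manifold R n) : Type :=
  (M * 'cV[R]_n)%type.

Section manifold_calculus.
Context {R : realType} {n : nat} {M : smooth_manifold R n}.
Implicit Types (p q : M) (X Y : vfield M) (v : 'rV[R]_n).

Definition ccoord p : 'rV[R]_n := chart_at p p.

Definition point_at p : 'rV[R]_n -> M := cinv (chart_at p).

Definition chart_trans p q : 'rV[R]_n -> 'rV[R]_n := chart_at q \o point_at p.

Definition Cfun {W : normedModType R} (k : nat) (f : M -> W) p : Prop :=
  C_near k (f \o point_at p) (ccoord p).

Definition Cmap (k : nat) (f : M -> M) p : Prop :=
  {for p, continuous f} /\
  C_near k (chart_at (f p) \o f \o point_at p) (ccoord p).

(* matrix of d_p f (acting on row vectors) in the charts at p and at f p *)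
Definition tangent_mx (f : M -> M) p : 'M[R]_n :=
  jacobian (chart_at (f p) \o f \o point_at p) (ccoord p).

(* derivative of a function at p in the direction v : T_pM *)
Definition vder (a : M -> R) p v : R := 'D_v (a \o point_at p) (ccoord p).

(* the function X a *)
Definition vapp X (a : M -> R) : M -> R := fun p => vder a p (X p).

Definition has_velocity (g : R -> M) (t : R) v : Prop :=
  {for t, continuous g} /\ is_derive t 1 (chart_at (g t) \o g) v.

Definition velocity (g : R -> M) (t : R) : 'rV[R]_n :=
  'D_1 (chart_at (g t) \o g) t.

(* the components, in the chart at q, of a vector field *)
Definition vcoord q X : M -> 'rV[R]_n :=
  fun p => X p *m jacobian (chart_trans p q) (ccoord p).

Definition smooth_vfield X : Prop := forall p k, Cfun k (vcoord p X) p.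

Definition bracket X Y : vfield M := fun p =>
  'D_(X p) (vcoord p Y \o point_at p) (ccoord p)
  - 'D_(Y p) (vcoord p X \o point_at p) (ccoord p).

Inductive iter_bracket {N : nat} (X : 'I_N -> vfield M) : vfield M -> Prop :=
| iter_bracket_gen i : iter_bracket X (X i)
| iter_bracket_br Y Z : iter_bracket X Y -> iter_bracket X Z ->
    iter_bracket X (bracket Y Z).

Definition bracket_generating {N : nat} (X : 'I_N -> vfield M) : Prop :=
  forall p, exists Z : 'I_n -> vfield M,
    (forall i, iter_bracket X (Z i)) /\ \matrix_(i < n) Z i p \in unitmx.

Definition global_frame (Y : 'I_n -> vfield M) : Prop :=
  forall p, \matrix_(i < n) Y i p \in unitmx.

(* A density is given by its value, at each p, on the coordinate frame of
   [chart_at p]; accordingly the pullback by f of the density eta is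
   p |-> eta (f p) * |det (tangent_mx f p)|. *)
Definition density_pullback (f : M -> M) (eta : M -> R) : M -> R :=
  fun p => eta (f p) * `|\det (tangent_mx f p)|.

(* phi is a local flow, around p, of the vector field X defined on O *)
Definition local_flow (O : set M) X p (phi : R -> M -> M) : Prop :=
  exists W : set M, exists e : R,
    [/\ open W, W p, W `<=` O, 0 < e &
     (forall q, W q -> phi 0 q = q) /\
     (forall q t, W q -> `|t| < e ->
        [/\ O (phi t q), has_velocity (phi ^~ q) t (X (phi t q)) &
            Cmap 1 (phi t) q])].

(* The Lie derivative along X of the density eta exists at p, with value l.
   Only differentiability of eta along the integral curves of X is needed. *)
Definition is_Lie_density (O : set M) X (eta : M -> R) p (l : R) : Prop :=
  exists phi, local_flow O X p phi /\
    is_derive (0 : R) (1 : R) (fun t => density_pullback (phi t) eta p) l.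

(* On O the iterated Lie derivatives of omega along X exist up to order k, and
   that of order k is D omega. *)
Definition is_iter_div (O : set M) X (omega : M -> R) (k : nat) (D : M -> R)
    : Prop :=
  exists F : nat -> M -> R,
    [/\ forall p, O p -> F 0%N p = 1,
        forall j p, (j < k)%N -> O p ->
          is_Lie_density O X (fun q => F j q * omega q) p (F j.+1 p * omega p) &
        forall p, O p -> F k p = D p].

(** ** The cotangent bundle *)

Definition pairing v (xi : 'cV[R]_n) : R := (v *m xi) 0 0.

(* canonical coordinates on T*M induced by the chart at q, and their inverse *)
Definition tcoord q (l : cotangent M) : ('rV[R]_n * 'cV[R]_n)%type :=
  (chart_at q l.1, jacobian (chart_trans q l.1) (chart_at q l.1) *m l.2).

Definition tpoint q (z : ('rV[R]_n * 'cV[R]_n)%type) : cotangent M :=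
  (point_at q z.1,
   jacobian (chart_trans (point_at q z.1) q) (ccoord (point_at q z.1)) *m z.2).

(* the Hamiltonian vector field of H at l, in the canonical coordinates of the
   chart at the base point of l *)
Definition hamiltonian_vf (H : cotangent M -> R) (l : cotangent M)
    : ('rV[R]_n * 'cV[R]_n)%type :=
  let h := H \o tpoint l.1 in
  let z := tcoord l.1 l in
  (\row_(i < n) 'D_((0, delta_mx i 0) : 'rV[R]_n * 'cV[R]_n) h z,
   \col_(i < n) - 'D_((delta_mx 0 i, 0) : 'rV[R]_n * 'cV[R]_n) h z).

Definition hamiltonian_curve (H : cotangent M -> R) (l : R -> cotangent M)
    : Prop :=
  forall t, {for t, continuous (fun s => (l s).1)} /\
    is_derive t 1 (fun s => tcoord (l t).1 (l s)) (hamiltonian_vf H (l t)).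

(* The default value [l] is only used if there is no integral curve from [l]
   defined on the whole line, which does not happen for the complete
   Hamiltonian flow of a left-invariant structure. *)
Definition hamiltonian_flow (H : cotangent M -> R) (t : R) (l : cotangent M)
    : cotangent M :=
  xget (fun=> l) [set c | hamiltonian_curve H c /\ c 0 = l] t.

(** ** Submanifolds *)

(* S is a C^r embedded submanifold of codimension m: around each of its points
   there is a C^r chart (Psi, inverse Phi) in which S is the vanishing locus of
   the first m coordinates. *)
Definition embedded_submanifold (r m : nat) (S : set M) : Prop :=
  (m <= n)%N /\
  forall q, S q -> exists (W : set M) (Psi : M -> 'rV[R]_n) (Phi : 'rV[R]_n -> M),
    [/\ open W /\ W q, open (Psi @` W),
        forall p, W p -> Phi (Psi p) = p /\ Cfun r Psi p,
        forall x, (Psi @` W) x ->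
          {for x, continuous Phi} /\ C_near r (chart_at (Phi x) \o Phi) x &
        forall p, W p -> (S p <-> forall i : 'I_n, (i < m)%N -> Psi p 0 i = 0)].

Definition tangent_to (S : set M) q v : Prop :=
  exists g : R -> M,
    [/\ g 0 = q, \forall t \near (0 : R), S (g t) & has_velocity g 0 v].

Definition conormal (S : set M) : set (cotangent M) :=
  [set l | S l.1 /\ forall v, tangent_to S l.1 v -> pairing v l.2 = 0].

End manifold_calculus.

(** * Sub-Riemannian structures *)

Definition abs_continuous {R : realType} {V : normedModType R} (a b : R)
    (f : R -> V) : Prop :=
  forall e : R, 0 < e -> exists2 d : R, 0 < d &
    forall (k : nat) (x y : 'I_k -> R),
      (forall i, a <= x i /\ x i <= y i /\ y i <= b) ->
      (forall i j, i != j -> y i <= x j \/ y j <= x i) ->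
      \sum_(i < k) (y i - x i) < d ->
      \sum_(i < k) `|f (y i) - f (x i)| < e.

(* smoothness up to the endpoint 1 means that f extends smoothly past it *)
Definition smooth_on_01 {R : realType} (f : R -> R) : Prop :=
  exists b : R, exists g : R -> R,
    [/\ 1 < b, forall k, C_on k g `]0, b[ & forall t, 0 < t <= 1 -> f t = g t].

Section sub_riemannian.
Context {R : realType} {n N : nat} {M : smooth_manifold R n}
  (X : 'I_N -> vfield M).
Implicit Types (p q : M) (S : set M) (g : R -> M).

Definition sR_norm p (v : 'rV[R]_n) : R :=
  Num.sqrt (inf [set s | exists2 u : 'I_N -> R,
    \sum_(i < N) u i *: X i p = v & s = \sum_(i < N) u i ^+ 2]).

Definition abs_continuous_curve g : Prop :=
  {within `[(0 : R), 1], continuous g} /\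
  forall (a b : R) q, 0 <= a -> a <= b -> b <= 1 ->
    (forall t, a <= t <= b -> cdom (chart_at q) (g t)) ->
    abs_continuous a b (chart_at q \o g).

Definition horizontal_curve g : Prop :=
  abs_continuous_curve g /\
  exists u : 'I_N -> R -> R,
    (forall i, measurable_fun (`[0, 1] : set R) (u i) /\
       exists C : R, {ae (@lebesgue_measure R), forall t, 0 <= t <= 1 -> `|u i t| <= C}) /\
    {ae (@lebesgue_measure R), forall t, 0 <= t <= 1 ->
       has_velocity g t (\sum_(i < N) u i t *: X i (g t))}.

Definition sR_length g : \bar R :=
  (\int[@lebesgue_measure R]_(t in `[0%R, 1%R])
     (sR_norm (g t) (velocity g t))%:E)%E.

Definition sR_dist p q : R :=
  fine (ereal_inf [set sR_length g | g in
    [set g | [/\ horizontal_curve g, g 0 = p & g 1 = q]]]).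

Definition dist_from S p : R := inf [set sR_dist p q | q in S].

Definition minimizing_geodesic S g : Prop :=
  [/\ horizontal_curve g,
      exists c : R, {ae (@lebesgue_measure R), forall t, 0 <= t <= 1 ->
        sR_norm (g t) (velocity g t) = c},
      S (g 0), ~ S (g 1) & sR_length g = (dist_from S (g 1))%:E].

Definition hgrad (a : M -> R) : vfield M :=
  fun p => \sum_(i < N) vapp (X i) a p *: X i p.

Definition hgrad_norm (a : M -> R) (p : M) : R :=
  Num.sqrt (\sum_(i < N) vapp (X i) a p ^+ 2).

Definition sR_hamiltonian (l : cotangent M) : R :=
  2^-1 * \sum_(i < N) pairing (X i l.1) l.2 ^+ 2.

Definition sR_exp (l : cotangent M) : M :=
  (hamiltonian_flow sR_hamiltonian 1 l).1.

Definition noncharacteristic S : Prop :=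
  forall q, S q -> forall v : 'rV[R]_n, exists (u : 'I_N -> R) (w : 'rV[R]_n),
    tangent_to S q w /\ v = \sum_(i < N) u i *: X i q + w.

Definition tube_covectors S (eps : M -> R) : set (cotangent M) :=
  [set l | conormal S l /\ Num.sqrt (2 * sR_hamiltonian l) < eps l.1].

(* E restricts to a C^1 diffeomorphism from V onto the open set U.  As V lies
   in a submanifold of T*M, E being C^1 on V means that in coordinates it
   locally extends to a C^1 map, and the inverse being C^1 means that it is C^1
   as a map into T*M. *)
Definition C1_diffeo_onto (V : set (cotangent M)) (U : set M)
    (E : cotangent M -> M) : Prop :=
  [/\ open U, E @` V = U,
      forall l, V l -> exists F : ('rV[R]_n * 'cV[R]_n)%type -> 'rV[R]_n,
        C_near 1 F (tcoord l.1 l) /\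
        \forall z \near tcoord l.1 l, forall l', V l' ->
          cdom (chart_at l.1) l'.1 -> tcoord l.1 l' = z ->
          cdom (chart_at (E l)) (E l') /\ chart_at (E l) (E l') = F z &
      exists sigma : M -> cotangent M,
        (forall l, V l -> sigma (E l) = l) /\
        forall p, U p -> {for p, continuous (fun q => (sigma q).1)} /\
          Cfun 1 (fun q => tcoord (sigma p).1 (sigma q)) p].

Record tubular_neighbourhood S (eps : M -> R) (U : set M) : Prop := {
  tube_eps_continuous : {within S, continuous eps};
  tube_eps_gt0 : forall q, S q -> 0 < eps q;
  tube_diffeo : C1_diffeo_onto (tube_covectors S eps) U sR_exp;
  tube_geodesic : forall l, tube_covectors S eps l -> ~ S (sR_exp l) ->
    minimizing_geodesic S (fun t => sR_exp (l.1, t *: l.2)) /\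
    forall g, minimizing_geodesic S g -> g 1 = sR_exp l ->
      forall t, 0 <= t <= 1 -> g t = sR_exp (l.1, t *: l.2);
  tube_dist : forall l, tube_covectors S eps l ->
    dist_from S (sR_exp l) = Num.sqrt (2 * sR_hamiltonian l);
  tube_dist_C2 : forall p, (U `\` S) p -> Cfun 2 (dist_from S) p;
  tube_eikonal : forall p, (U `\` S) p -> hgrad_norm (dist_from S) p = 1;
  tube_sqdist_C2 : forall p, U p -> Cfun 2 (fun q => dist_from S q ^+ 2) p;
  tube_smooth_along : forall (Y Z : vfield M) g,
    smooth_vfield Y -> smooth_vfield Z -> minimizing_geodesic S g ->
    (forall t, 0 < t <= 1 -> (U `\` S) (g t)) ->
    [/\ smooth_on_01 (dist_from S \o g),
        smooth_on_01 (vapp Y (dist_from S) \o g) &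
        smooth_on_01 (vapp Z (vapp Y (dist_from S)) \o g)] }.

(* a continuous transverse vector field Nu along the hypersurface S *)
Definition transverse_field S (Nu : vfield M) : Prop :=
  forall q, S q ->
    [/\ vcoord q Nu p @[p --> within S (nbhs q)] --> Nu q,
        Nu q != 0 & ~ tangent_to S q (Nu q)].

Record signed_distance S (eps : M -> R) (U : set M) (Nu : vfield M)
    (ds : M -> R) : Prop := {
  signed_dist_pos : forall l, tube_covectors S eps l ->
    0 < pairing (Nu l.1) l.2 -> ds (sR_exp l) = dist_from S (sR_exp l);
  signed_dist_neg : forall l, tube_covectors S eps l ->
    pairing (Nu l.1) l.2 < 0 -> ds (sR_exp l) = - dist_from S (sR_exp l);
  signed_dist0 : forall p, S p -> ds p = 0;
  signed_dist_C2 : forall p, U p -> Cfun 2 ds p }.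

End sub_riemannian.

(** * Lie groups *)

Record lie_group (R : realType) (n : nat) := LieGroup {
  lgmanifold :> smooth_manifold R n;
  lgmul : lgmanifold -> lgmanifold -> lgmanifold;
  lgone : lgmanifold;
  lginv : lgmanifold -> lgmanifold;
  lgmulA : forall a b c, lgmul a (lgmul b c) = lgmul (lgmul a b) c;
  lgmul1 : forall a, lgmul lgone a = a;
  lgmulV : forall a, lgmul (lginv a) a = lgone;
  lgmul_continuous : continuous (fun ab : lgmanifold * lgmanifold =>
    lgmul ab.1 ab.2);
  lgmul_smooth : forall a b k,
    C_near k (fun xy : 'rV[R]_n * 'rV[R]_n =>
      chart_at (lgmul a b) (lgmul (point_at a xy.1) (point_at b xy.2)))
      (ccoord a, ccoord b);
  lginv_smooth : forall a k, Cmap k lginv a }.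

Definition left_invariant_vfield {R : realType} {n : nat} (G : lie_group R n)
    (X : vfield G) : Prop :=
  forall a p, X (lgmul a p) = X p *m tangent_mx (@lgmul R n G a) p.

Definition left_invariant_density {R : realType} {n : nat} (G : lie_group R n)
    (mu : G -> R) : Prop :=
  forall a p, density_pullback (@lgmul R n G a) mu p = mu p.

(* the values (Y_a f, Y_a Y_b f, last) at p of the n + n^2 + 1 variables *)
Definition jet_vars {R : realType} {n : nat} {M : smooth_manifold R n}
    (Y : 'I_n -> vfield M) (f : M -> R) (last : R) (p : M)
    : 'I_(n + n * n + 1) -> R :=
  (row_mx (row_mx (\row_(a < n) vapp (Y a) f p)
             (mxvec (\matrix_(a < n, b < n) vapp (Y a) (vapp (Y b) f) p)))
     (last%:M : 'rV[R]_1)) 0.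

(* Main.v *)
(** Let [f] be the (signed) distance; it satisfies the eikonal equation
    [sum_i (X_i f)^2 = 1].  The [X_i] have constant coefficients in the frame [Y],
    so [Z = grad f = sum_{a,b} g_ab (Y_a f) Y_b] with [g] constant, and
    [[Y_a, Y_b] = sum_l c_abl Y_l] with [c] constant.  Differentiating the eikonal
    equation shows that, along the integral curves of [Z], the functions [Y_a f],
    [Y_a Y_b f] and [(m-1)/f] solve a closed system of ODEs with homogeneous
    quadratic right-hand side (of Riccati type), while the divergence of [Z] for
    [mu / f^(m-1)] is a linear form in these functions.  So [P^(k+1) = P^1 P^k + D P^k] where [D] is
    the derivation given by the quadratic right-hand sides, and each step raises
    the degree by one.

    As [f] is only of class [C^2], one cannot differentiate [Y_a Y_b f] along [Z].
    Instead [Y_b f] has along [Z] a derivative [q_b] of class [C^1], and the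
    evolution of [Y_a Y_b f] comes from differentiating [Y_b f o phi_t], with
    [phi] the [C^1] flow of [Z], in space: its space derivative has in [t] the
    derivative [d(q_b)].

    For the signed distance the eikonal equation extends from [U \ S] to [U] by
    continuity, as the complement of a hypersurface is dense. *)

Require Import Defs.
From HB Require Import structures.
From mathcomp Require Import all_boot all_order all_algebra.
From mathcomp Require Import fingroup perm.
From mathcomp Require Import all_classical all_reals all_analysis.
From mathcomp Require mpoly.
Import -(notations) mpoly.
From mathcomp Require Import ring lra.

Set Implicit Arguments.
Unset Strict Implicit.
Unset Printing Implicit Defensive.

Import Order.TTheory GRing.Theory Num.Theory.
Import numFieldNormedType.Exports.

Local Open Scope classical_set_scope.
Local Open Scope ring_scope.

(** * Curves of matrices *)

(** A Lie derivative at a point is tested on one local flow whose time maps are of class $C^1$, and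
    only the derivative at time 0 counts. So the flow of $Z$ is built together with its space
    derivative, the solution of the variational equation, on a short time interval and inside one
    chart; every point gets its own chart and flow, and every evolution law is needed at $t = 0$
    only.

    The constants $c$, $g$ and the value of $\mu$ on the frame are read off at the identity and
    carried everywhere by left translations. Left-invariant fields come with no regularity, which
    has to be extracted from the smoothness of the group law.

    The system closes for this reason. Differentiating the eikonal equation along $Y_l$ gives
    $\sum_j w_j Y_l Y_j f = 0$, where the $w_j$ are the components of $Z$ in the frame, whereas $Z
    Y_l f = \sum_j w_j Y_j Y_l f$. The two sums differ by commutators, hence $Z Y_l f$ is quadratic
    in first derivatives.

    That the formula makes sense off $S$ requires $\delta > 0$ there and $U \setminus S$ open; both
    come from the non-characteristic condition through the conormal covectors. *)

Section matrix_norm.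
Context {R : realType}.

Lemma mx_norm_leP m n (A : 'M[R]_(m, n)) (c : R) : 0 <= c ->
  (`|A| <= c) <-> (forall i j, `|A i j| <= c).
Proof.
move=> c0; rewrite [`|A|]mx_normrE; split => [/bigmax_leP[_ Ac] i j|Ac].
  exact: (Ac (i, j)).
by apply/bigmax_leP; split => // -[i j] _; exact: Ac.
Qed.

Lemma le_coef_mx_norm m n (A : 'M[R]_(m, n)) i j : `|A i j| <= `|A|.
Proof. by have [+ _] := mx_norm_leP A (normr_ge0 A); apply. Qed.

Lemma mulmx_norm_le m n p (A : 'M[R]_(m, n)) (B : 'M[R]_(n, p)) :
  `|A *m B| <= n%:R * `|A| * `|B|.
Proof.
apply/mx_norm_leP => [|i j]; first by rewrite !mulr_ge0.
rewrite mxE (le_trans (ler_norm_sum _ _ _))//.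
apply: (@le_trans _ _ (\sum_(k < n) `|A| * `|B|)).
  apply: ler_sum => k _; rewrite normrM ler_pM// ; exact: le_coef_mx_norm.
by rewrite sumr_const card_ord -mulrA mulr_natl.
Qed.

Lemma is_derive_mxP (V : normedModType R) m n (M : V -> 'M[R]_(m, n)) t v D :
  is_derive t v M D <-> (forall i j, is_derive t v (fun x => M x i j) (D i j)).
Proof.
split=> [[dM <-] i j|dM].
  by apply: DeriveDef; [exact: (derivable_mxP _ _ _).1|rewrite derive_mx// mxE].
have dM' : derivable M t v.
  by apply/derivable_mxP => i j; have [] := dM i j.
apply: DeriveDef => //; rewrite derive_mx//; apply/matrixP => i j.
by rewrite mxE; have [] := dM i j.
Qed.

Lemma is_derive1_continuous (V : normedModType R) (f : R -> V) (t : R) d :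
  is_derive t 1 f d -> {for t, continuous f}.
Proof. by move=> [df _]; exact/differentiable_continuous/derivable1_diffP. Qed.

Lemma continuous_mxP (T : topologicalType) m n (M : T -> 'M[R]_(m, n)) (t : T) :
  {for t, continuous M} <->
  forall i j, {for t, continuous (fun x => M x i j)}.
Proof.
split=> [cM i j|cM].
  by apply: (@continuous_comp _ _ _ M (fun A : 'M[R]_(m, n) => A i j)) => //;
     exact: coord_continuous.
apply/cvgrPdist_le => /= e e0; near=> x; apply/mx_norm_leP; first exact: ltW.
move=> i j; rewrite !mxE /=.
move: i j; near: x.
apply: filter_forall => i; apply: filter_forall => j.
by have /cvgrPdist_le := cM i j; apply.
Unshelve. all: by end_near. Qed.

Lemma continuous_bigsum (T : topologicalType) (V : normedModType R) (I : Type)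
    (r : seq I) (P : pred I) (f : I -> T -> V) (t : T) :
  (forall i, P i -> {for t, continuous (f i)}) ->
  {for t, continuous (fun x => \sum_(i <- r | P i) f i x)}.
Proof.
move=> cf; elim: r => [|i r IH].
  rewrite (_ : (fun _ => _) = cst 0); first exact: cvg_cst.
  by apply/funext => x; rewrite big_nil.
rewrite (_ : (fun _ => _) = fun x =>
    if P i then f i x + \sum_(j <- r | P j) f j x else \sum_(j <- r | P j) f j x).
  have [Pi|//] := boolP (P i); apply: continuousD => //; exact: cf.
by apply/funext => x; rewrite big_cons.
Qed.

Lemma continuous_mulmx (T : topologicalType) m n p (A : T -> 'M[R]_(m, n))
    (B : T -> 'M[R]_(n, p)) (t : T) :
  {for t, continuous A} -> {for t, continuous B} ->
  {for t, continuous (fun x => A x *m B x)}.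
Proof.
move=> /continuous_mxP cA /continuous_mxP cB; apply/continuous_mxP => i j.
have -> : (fun x => (A x *m B x) i j) = (fun x => \sum_k A x i k * B x k j).
  by apply/funext => x; rewrite mxE.
apply: continuous_bigsum => k _.
by apply: cvgM; [exact: cA | exact: cB].
Qed.

End matrix_norm.

(** * Mean value inequality, short-time Gronwall and antiderivatives *)

Section one_variable.
Context {R : realType}.

(** The norm is the sup norm, so the scalar mean value theorem applied to each entry loses no
    dimensional factor. *)
Lemma mean_value_mx m n (M dM : R -> 'M[R]_(m, n)) (a b C : R) : a <= b ->
  (forall t, a <= t <= b -> is_derive t 1 M (dM t)) ->
  (forall t, a <= t <= b -> `|dM t| <= C) ->
  `|M b - M a| <= C * (b - a).
Proof.
move=> ab hM hC.
have C0 : 0 <= C by apply: le_trans (hC a _); rewrite ?lexx ?ab.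
apply/mx_norm_leP => [|i j]; first by rewrite mulr_ge0 // subr_ge0.
have dij t : a <= t <= b -> is_derive t 1 (fun x => M x i j) (dM t i j).
  by move=> /hM /is_derive_mxP.
have [||c cab] := @MVT_segment R (fun t => M t i j) (fun t => dM t i j) a b ab.
- move=> t; rewrite in_itv/= => /andP[/ltW at_ /ltW tb]; apply: dij.
  by rewrite at_.
- apply: derivable_within_continuous => t; rewrite in_itv/= => tab.
  by have [] := dij _ tab.
- rewrite !mxE => ->; rewrite normrM (@ger0_norm _ (b - a)) ?subr_ge0//.
  rewrite ler_wpM2r ?subr_ge0//.
  apply: le_trans (le_coef_mx_norm _ _ _) _; apply: hC.
  by move: cab; rewrite in_itv.
Qed.

Lemma mean_value_mx_sym m n (M dM : R -> 'M[R]_(m, n)) (T C : R) :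
  (forall t : R, `|t| <= T -> is_derive t 1 M (dM t)) ->
  (forall t, `|t| <= T -> `|dM t| <= C) ->
  forall t, `|t| <= T -> `|M t - M 0| <= C * `|t|.
Proof.
move=> hM hC t tT; have [t0|/ltW t0] := leP 0 t.
  have := @mean_value_mx _ _ M dM 0 t C t0; rewrite subr0 (@ger0_norm _ t)//; apply.
  - move=> s /andP[s0 st]; apply: hM; rewrite ger0_norm // (le_trans st)//.
    exact: le_trans (ler_norm _) tT.
  - move=> s /andP[s0 st]; apply: hC; rewrite ger0_norm // (le_trans st)//.
    exact: le_trans (ler_norm _) tT.
have := @mean_value_mx _ _ M dM t 0 C t0; rewrite sub0r distrC (@ler0_norm _ t)//; apply.
- move=> s /andP[s0 st]; apply: hM; rewrite ler0_norm //.
  by rewrite (le_trans _ tT)// ler0_norm// lerN2.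
- move=> s /andP[s0 st]; apply: hC; rewrite ler0_norm //.
  by rewrite (le_trans _ tT)// ler0_norm// lerN2.
Qed.

Lemma bounded_sym_itv (V : normedModType R) (u : R -> V) (T : R) : 0 <= T ->
  (forall t, `|t| <= T -> {for t, continuous u}) ->
  exists2 s, `|s| <= T & forall t, `|t| <= T -> `|u t| <= `|u s|.
Proof.
move=> T0 cu.
have TT : - T <= T by rewrite (le_trans _ T0)// oppr_le0.
have [|c cT cmax] := @EVT_max R (fun t => `|u t|) (- T) T TT.
  apply: continuous_in_subspaceT => t /=; rewrite inE/= in_itv/= -ler_norml => tT.
  by apply: cvg_norm; exact: cu.
exists c; first by rewrite ler_norml; move: cT; rewrite in_itv.
by move=> t tT; apply: cmax; rewrite in_itv/= -ler_norml.
Qed.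

(* On the time scale [L * T <= 1/2] the mean value inequality absorbs the
   linear term, so no exponential is needed. *)
Lemma short_time_gronwall m n (u du : R -> 'M[R]_(m, n)) (L T e : R) :
  0 <= L -> 0 <= T -> L * T <= 1 / 2 -> 0 <= e ->
  (forall t : R, `|t| <= T -> is_derive t 1 u (du t)) ->
  (forall t, `|t| <= T -> `|du t| <= L * `|u t| + e) ->
  forall t, `|t| <= T -> `|u t| <= 2 * (`|u 0| + T * e).
Proof.
move=> L0 T0 LT e0 hu hdu.
have [|s sT smax] := @bounded_sym_itv _ u T T0.
  by move=> t /hu; exact: is_derive1_continuous.
have key t : `|t| <= T -> `|u t - u 0| <= (L * `|u s| + e) * `|t|.
  move=> tT; apply: (@mean_value_mx_sym _ _ u du T) => // r rT.
  by rewrite (le_trans (hdu _ rT))// lerD2r ler_wpM2l// smax.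
move=> t tT; apply: le_trans (smax _ tT) _.
have h1 : `|u s| <= `|u 0| + (L * `|u s| + e) * T.
  rewrite -[X in `|X| <= _](subrK (u 0)) (le_trans (ler_normD _ _))// addrC lerD2l.
  apply: le_trans (key _ sT) _; rewrite ler_wpM2l// addr_ge0// mulr_ge0//.
have h2 : L * T * `|u s| <= 1 / 2 * `|u s| by rewrite ler_wpM2r.
have := normr_ge0 (u s). nra.
Qed.

(** Integrating from [- K] keeps every [t] with [|t| < K] interior, so the derivative is two-sided
    at 0 and at negative times too. *)
Lemma antiderivative (K : R) (g : R -> R) : 0 < K -> continuous g ->
  exists G : R -> R, forall t : R, `|t| < K -> is_derive t 1 G (g t).
Proof.
move=> K0 cg.
exists (fun x => (\int[@lebesgue_measure R]_(t in `[(- K), x]) g t)%R) => t tK.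
have tK' : - K < t < K by rewrite -ltr_norml.
have [||||d1 d2] := @continuous_FTC1_closed R g (- K) t K.
- by case/andP: tK'.
- apply: continuous_compact_integrable; first exact: segment_compact.
  exact: continuous_subspaceT.
- by case/andP: tK'.
- exact: cg.
- by apply: (DeriveDef d1); rewrite -derive1E; exact: d2.
Qed.

Lemma antiderivative_mx m n (K : R) (g : R -> 'M[R]_(m, n)) : 0 < K ->
  continuous g ->
  exists G : R -> 'M[R]_(m, n), G 0 = 0 /\
    forall t : R, `|t| < K -> is_derive t 1 G (g t).
Proof.
move=> K0 cg.
have /choice[G hG] : forall ij : 'I_m * 'I_n, exists G : R -> R,
    forall t : R, `|t| < K -> is_derive t 1 G (g t ij.1 ij.2).
  move=> [i j]; apply: antiderivative => // t.
  by have /continuous_mxP/(_ i j) := cg t.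
exists (fun t => \matrix_(i, j) (G (i, j) t - G (i, j) 0)); split.
  by apply/matrixP => i j; rewrite !mxE subrr.
move=> t tK; apply/is_derive_mxP => i j.
have -> : (fun x => (\matrix_(i0, j0) (G (i0, j0) x - G (i0, j0) 0)) i j)
  = G (i, j) - cst (G (i, j) 0) by apply/funext => x; rewrite mxE.
have := hG (i, j) t tK => /= H.
by apply: is_derive_eq; rewrite subr0.
Qed.

End one_variable.

(** * Picard's theorem and C^1 flows *)

Section clamp.
Context {R : realType}.

(** Retraction of the line onto [[a - r, a + r]]. It extends data known on an interval or a ball to
    the whole space without changing solutions that stay inside. *)
Definition clamp (a r : R) (t : R) : R := Num.max (a - r) (Num.min (a + r) t).

Lemma clamp_id a r t : `|t - a| <= r -> clamp a r t = t.
Proof.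
rewrite ler_distl => /andP[h1 h2]; rewrite /clamp (min_idPr _)//.
exact/max_idPr.
Qed.

Lemma clamp_dist a r t : 0 <= r -> `|clamp a r t - a| <= r.
Proof.
move=> r0; rewrite ler_distl /clamp le_max lexx /=.
rewrite ge_max ge_min lexx /= andbT; lra.
Qed.

Lemma clamp_lipschitz a r s t : `|clamp a r s - clamp a r t| <= `|s - t|.
Proof.
have hmax (c x y : R) : `|Num.max c x - Num.max c y| <= `|x - y|.
  by rewrite ler_norml; case: (leP c x) => ?; case: (leP c y) => ?;
    case: (ger0P (x - y)) => ?; lra.
have hmin (c x y : R) : `|Num.min c x - Num.min c y| <= `|x - y|.
  by rewrite ler_norml; case: (leP c x) => ?; case: (leP c y) => ?;
    case: (ger0P (x - y)) => ?; lra.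
exact: le_trans (hmax _ _ _) (hmin _ _ _).
Qed.

Lemma clamp_continuous a r : continuous (clamp a r).
Proof.
move=> t; apply/cvgrPdist_le => /= e e0; near=> s.
apply: le_trans (clamp_lipschitz _ _ _ _) _.
near: s; have /cvgrPdist_le : x @[x --> t] --> t by []
; exact.
Unshelve. all: by end_near. Qed.

(** A ball of the sup norm is a product of intervals, so clamping the entries is a 1-Lipschitz
    retraction onto it. *)
Definition clamp_mx m n (A : 'M[R]_(m, n)) (r : R) (B : 'M[R]_(m, n)) :=
  \matrix_(i, j) clamp (A i j) r (B i j).

Lemma clamp_mx_id m n (A B : 'M[R]_(m, n)) r : 0 <= r ->
  `|B - A| <= r -> clamp_mx A r B = B.
Proof.
move=> r0 /(mx_norm_leP _ r0) BA; apply/matrixP => i j; rewrite mxE clamp_id//.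
by have := BA i j; rewrite !mxE.
Qed.

Lemma clamp_mx_dist m n (A B : 'M[R]_(m, n)) r : 0 <= r ->
  `|clamp_mx A r B - A| <= r.
Proof.
by move=> r0; apply/mx_norm_leP => // i j; rewrite !mxE; exact: clamp_dist.
Qed.

Lemma clamp_mx_lipschitz m n (A B C : 'M[R]_(m, n)) r :
  `|clamp_mx A r B - clamp_mx A r C| <= `|B - C|.
Proof.
apply/mx_norm_leP => // i j; rewrite !mxE (le_trans (clamp_lipschitz _ _ _ _))//.
by have := le_coef_mx_norm (B - C) i j; rewrite !mxE.
Qed.

End clamp.

Section picard.
Context {R : realType} {m n : nat}.
Variables (F : R -> 'M[R]_(m, n) -> 'M[R]_(m, n)) (L T : R).
Hypotheses (L0 : 0 <= L) (T0 : 0 < T) (LT : L * T <= 1 / 2).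
Hypothesis F_continuous : forall y : R -> 'M[R]_(m, n),
  continuous y -> continuous (fun t => F t (y t)).
Hypothesis F_lipschitz : forall t y z, `|F t y - F t z| <= L * `|y - z|.

(** [L * T <= 1 / 2] makes one Picard step a contraction of ratio 1/2. Continuity of [F] is asked
    along continuous curves, which is what makes the integrand continuous. *)
Lemma picard (x : 'M[R]_(m, n)) : exists y : R -> 'M[R]_(m, n),
  y 0 = x /\ forall t : R, `|t| <= T -> is_derive t 1 y (F t (y t)).
Proof.
have T0' := ltW T0.
have cl0 t : `|t| <= T -> clamp 0 T t = t by move=> tT; rewrite clamp_id ?subr0.
have clT t : `|clamp 0 T t| <= T by rewrite -[X in `|X|]subr0 clamp_dist.
have TK : T < T + 1 by rewrite ltrDl.
(* [I] integrates from 0. Choice demands a value for every curve, and 0 is taken for the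
   discontinuous ones. The window [T + 1] makes the endpoints [T] and [- T] interior. *)
have [I hI] : exists I : (R -> 'M[R]_(m, n)) -> R -> 'M[R]_(m, n),
    forall g, continuous g -> I g 0 = 0 /\
      forall t : R, `|t| < T + 1 -> is_derive t 1 (I g) (g t).
  have /choice[I hI] : forall g : R -> 'M[R]_(m, n), exists G : R -> 'M[R]_(m, n),
      continuous g -> G 0 = 0 /\
      forall t : R, `|t| < T + 1 -> is_derive t 1 G (g t).
    move=> g; have [cg|ncg] := pselect (continuous g); last by exists 0.
    by have [|G hG] := @antiderivative_mx R m n (T + 1) g _ cg;
      [exact: addr_gt0|exists G].
  by exists I.
(* Time is clamped inside [y] so that the integrand is continuous on the whole line although [y] is
   only continuous for [|t| <= T]. *)
pose S (y : R -> 'M[R]_(m, n)) (t : R) := F t (y (clamp 0 T t)).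
pose step y t := x + I (S y) t.
have S_cont y : (forall t : R, `|t| <= T -> {for t, continuous y}) ->
    continuous (S y).
  move=> cy; apply: F_continuous => t.
  by apply: (@continuous_comp _ _ _ (clamp 0 T) y);
    [exact: clamp_continuous|exact: cy].
have step_derive y : (forall t : R, `|t| <= T -> {for t, continuous y}) ->
    forall t : R, `|t| <= T -> is_derive t 1 (step y) (F t (y t)).
  move=> cy t tT; have [_ /(_ t (le_lt_trans tT TK)) d] := hI _ (S_cont _ cy).
  rewrite /step; have -> : F t (y t) = 0 + S y t by rewrite add0r /S cl0.
  exact: is_deriveD.
have step_cont y : (forall t : R, `|t| <= T -> {for t, continuous y}) ->
    forall t : R, `|t| <= T -> {for t, continuous (step y)}.
  by move=> cy t /(step_derive _ cy); exact: is_derive1_continuous.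
have step0 y : (forall t : R, `|t| <= T -> {for t, continuous y}) -> step y 0 = x.
  by move=> cy; have [h _] := hI _ (S_cont _ cy); rewrite /step h addr0.
have contraction y z C : 0 <= C -> (forall t : R, `|t| <= T -> {for t, continuous y}) ->
    (forall t : R, `|t| <= T -> {for t, continuous z}) ->
    (forall t : R, `|t| <= T -> `|y t - z t| <= C) ->
    forall t : R, `|t| <= T -> `|step y t - step z t| <= C / 2.
  move=> C0 cy cz yz t tT.
  have d s : `|s| <= T -> is_derive (s : R) 1 (fun u => step y u - step z u)
      (F s (y s) - F s (z s)).
    move=> sT; have h1 := step_derive _ cy s sT; have h2 := step_derive _ cz s sT.
    exact: is_deriveB.
  have b s : `|s| <= T -> `|F s (y s) - F s (z s)| <= L * C.
    by move=> sT; rewrite (le_trans (F_lipschitz _ _ _))// ler_wpM2l// yz.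
  have := mean_value_mx_sym d b tT; rewrite !step0// subrr subr0.
  move=> h; apply: le_trans h _.
  have : L * C * `|t| <= L * C * T by rewrite ler_wpM2l// mulr_ge0.
  have : L * T * C <= 1 / 2 * C by rewrite ler_wpM2r.
  lra.
pose y_ k := iter k step (cst x).
have y_cont k : forall t : R, `|t| <= T -> {for t, continuous (y_ k)}.
  elim: k => [|k IH] t tT; first exact: cvg_cst.
  exact: step_cont.
have [D D0 hD] : exists2 D, 0 <= D & forall t : R, `|t| <= T -> `|y_ 1%N t - y_ 0%N t| <= D.
  have [|s sT hs] := @bounded_sym_itv R _ (y_ 1%N - y_ 0%N) T T0'.
    by move=> t tT; apply: continuousB; exact: y_cont.
  by exists `|(y_ 1%N - y_ 0%N) s|.
have y_succ k t : `|t| <= T -> `|y_ k.+1 t - y_ k t| <= D / 2 ^+ k.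
  elim: k t => [|k IH] t tT; first by rewrite expr0 divr1 hD.
  rewrite exprSr invfM mulrA; apply: (contraction (y_ k.+1) (y_ k) _ _ (y_cont _) (y_cont _)) => //.
  by rewrite divr_ge0// exprn_ge0.
(* The bound is the exact sum of [D / 2 ^+ i] over [k <= i < k + l]. *)
have y_dist : forall k l (t : R), `|t| <= T -> `|y_ (k + l)%N t - y_ k t| <= 2 * D / 2 ^+ k - 2 * D / 2 ^+ (k + l).
  move=> k l t tT; elim: l => [|l IH].
    by rewrite addn0 !subrr normr0.
  rewrite addnS -(subrKA (y_ (k + l)%N t)) (le_trans (ler_normD _ _))//.
  have := y_succ (k + l)%N t tT; rewrite exprS invfM.
  move: IH; set a := `|_|; set b := `|_|; set p := (2 ^+ (k + l))^-1.
  lra.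
have pow0 e : 0 < e -> \forall k \near \oo, 2 * D / 2 ^+ k <= e.
  move=> e0.
  have : (fun k => (2 * D) * ((1 / 2 : R) ^+ k)) @ \oo --> 2 * D * 0.
    apply: cvgMr; apply: cvg_expr; rewrite ger0_norm; lra.
  rewrite mulr0 => /cvgrPdist_le /(_ e e0); apply: filterS => k.
  rewrite sub0r normrN ger0_norm; last by rewrite !mulr_ge0// exprn_ge0//; lra.
  by rewrite expr_div_n expr1n mul1r.
have y_cvg t : `|t| <= T -> cvgn (fun k => y_ k t).
  move=> tT; apply/cauchy_cvgP/cauchy_exP => e e0; have e20 : 0 < e / 2 by rewrite divr_gt0.
  have [k _ hk] := pow0 _ e20.
  exists (y_ k t); exists k => // j /= kj; rewrite -ball_normE /= -normrN opprB.
  rewrite -(subnKC kj); apply: le_lt_trans (y_dist _ _ _ tT) _.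
  have := hk k (leqnn k) => /= hk'.
  have : 0 <= 2 * D / 2 ^+ (k + (j - k)).
    by rewrite divr_ge0 ?mulr_ge0// exprn_ge0.
  lra.
pose z t := limn (fun k => y_ k t).
have z_dist k t : `|t| <= T -> `|z t - y_ k t| <= 2 * D / 2 ^+ k.
  move=> tT.
  have hz : (fun j => `|y_ j t - y_ k t|) @ \oo --> `|z t - y_ k t|.
    by apply: cvg_norm; apply: cvgB; [exact: y_cvg|exact: cvg_cst].
  apply: (cvgr_to_le hz); exists k => // j /= kj; rewrite -(subnKC kj).
  apply: le_trans (y_dist _ _ _ tT) _.
  have : 0 <= 2 * D / 2 ^+ (k + (j - k)).
    by rewrite divr_ge0 ?mulr_ge0// exprn_ge0.
  lra.
have zc_cont : continuous (fun t => z (clamp 0 T t)).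
  move=> t; apply/cvgrPdist_le => /= e e0.
  have e30 : 0 < e / 3 by rewrite divr_gt0.
  have [k _ /(_ k (leqnn k)) /= hk] := pow0 _ e30.
  have /cvgrPdist_le /(_ _ e30) cy : {for t, continuous (fun s => y_ k (clamp 0 T s))}.
    by apply: (@continuous_comp _ _ _ (clamp 0 T) (y_ k));
      [exact: clamp_continuous|exact: y_cont].
  near=> s.
  have h1 := z_dist k _ (clT t); have h2 := z_dist k _ (clT s).
  have h3 : `|y_ k (clamp 0 T t) - y_ k (clamp 0 T s)| <= e / 3 by near: s.
  rewrite -(subrKA (y_ k (clamp 0 T t))) (le_trans (ler_normD _ _))//.
  rewrite -[X in _ + `|X|](subrKA (y_ k (clamp 0 T s))).
  have := ler_normD (y_ k (clamp 0 T t) - y_ k (clamp 0 T s))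
    (y_ k (clamp 0 T s) - z (clamp 0 T s)).
  rewrite (distrC _ (z (clamp 0 T s))).
  move: h1 h2 h3; lra.
pose zc t := z (clamp 0 T t).
have zc_at t : `|t| <= T -> {for t, continuous zc} by move=> _; exact: zc_cont.
have zcE t : `|t| <= T -> zc t = z t by move=> tT; rewrite -[LHS]/(z (clamp 0 T t)) cl0.
(* [z] is a fixed point: [step zc] is close to [step (y_ k)], which is [y_ k.+1], and this is close
   to [z]. *)
have step_z t : `|t| <= T -> step zc t = z t.
  move=> tT; apply/subr0_eq/eqP; rewrite -normr_le0; apply/ler_addgt0Pr => e e0; have e20 : 0 < e / 2 by rewrite divr_gt0.
  rewrite add0r; have [k _ /(_ k (leqnn k)) /= hk] := pow0 _ e20.
  have h1 : `|step zc t - step (y_ k) t| <= (e / 2) / 2.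
    apply: (contraction zc (y_ k) _ _ zc_at (y_cont k)) => //; first by rewrite ltW// divr_gt0.
    by move=> s sT; rewrite zcE// (le_trans (z_dist _ _ sT)).
  have h2 := z_dist k.+1 t tT.
  rewrite -(subrKA (y_ k.+1 t)) (le_trans (ler_normD _ _))//.
  rewrite (distrC (y_ k.+1 t)).
  have : 2 * D / 2 ^+ k.+1 = (2 * D / 2 ^+ k) / 2.
    by rewrite exprSr invfM mulrA.
  move: h1 h2 hk; rewrite [step (y_ k) t]/(y_ k.+1 t); lra.
(* [zc] is frozen outside [|t| <= T]. [step zc] agrees with it inside and has two-sided derivatives
   at the endpoints as well. *)
exists (step zc); split; first exact: step0.
move=> t tT; rewrite step_z//; have := step_derive _ zc_at t tT.
by rewrite zcE.
Unshelve. all: by end_near. Qed.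

End picard.

(** * Differentiability criteria and uniform continuity *)

Section differentials.
Context {R : realType}.

Lemma differentiable_approx (U V : normedModType R) (f : U -> V) (x : U) :
  differentiable f x -> forall e : R, 0 < e ->
  \forall h \near (0 : U), `|f (h + x) - f x - 'd f x h| <= e * `|h|.
Proof.
move=> /diff_locally /eqaddoP df e e0; apply: filterS (df e e0) => h.
by rewrite -[X in `|X| <= _]/(f (h + x) - (f x + 'd f x h)) opprD addrA.
Qed.

Lemma is_derive_comp1 (U V : normedModType R) (g : R -> U) (f : U -> V)
    (t : R) (dg : U) : is_derive t 1 g dg -> differentiable f (g t) ->
  is_derive t 1 (f \o g) ('D_dg f (g t)).
Proof.
move=> [dg1 dg2] df.
have dg' : differentiable g t by apply/derivable1_diffP.
have dfg : differentiable (f \o g) t by exact: differentiable_comp.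
apply: DeriveDef; first exact/derivable1_diffP.
by rewrite deriveE// diff_comp//= (deriveE _ df) -dg2 deriveE.
Qed.

(** Compactness in its covering form, with the radius as small parameter, gives one [d] for all [x]
    in [K], while [y] may lie outside [K]. *)
Lemma uniform_continuity (X Y : normedModType R) (K : set X) (f : X -> Y) :
  compact K -> (forall x, K x -> {for x, continuous f}) ->
  forall e : R, 0 < e -> exists2 d : R, 0 < d &
    forall x y, K x -> `|x - y| <= d -> `|f x - f y| <= e.
Proof.
move=> /compact_near_coveringP cK cf e e0.
have := cK R (0 : R)^'+ (fun d x => forall y, `|x - y| <= d -> `|f x - f y| <= e) _.
move=> /(_ _) [].
- move=> x Kx; have e20 : 0 < e / 2 by rewrite divr_gt0.
  have /cvgrPdist_le /(_ _ e20) := cf x Kx.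
  move=> /nbhs_ballP[d /= d0 hd]; have d20 : 0 < d / 2 by rewrite divr_gt0.
  exists (ball x (d / 2), [set s | 0 < s < d / 2]); first split => /=.
  + exact: (nbhsx_ballx x (d / 2) d20).
  + exists (d / 2) => // s /=; rewrite sub0r normrN => sd s0; rewrite s0 /=; exact: le_lt_trans (ler_norm s) sd.
  move=> [x' s] /= [+ /andP[s0 sd]] y; rewrite -ball_normE /= => xx' x'y.
  have hx' := hd x'; have hy := hd y; move: hx' hy; rewrite -!ball_normE /=.
  move=> hx' hy.
  have xy : `|x - y| < d.
    rewrite -(subrKA x') (le_lt_trans (ler_normD _ _))//.
    by rewrite (splitr d) ltrD// (le_lt_trans x'y).
  rewrite -(subrKA (f x)) (le_trans (ler_normD _ _))// (splitr e) lerD//.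
    by rewrite distrC hx'// (lt_trans xx')//; lra.
  exact: hy.
- move=> r /= r0 hr; exists (r / 2); first by rewrite divr_gt0.
  move=> x y Kx; apply: hr => //=; rewrite ?divr_gt0//.
  by rewrite sub0r normrN gtr0_norm ?divr_gt0//; lra.
Qed.

Lemma lipschitz_continuous (U V : normedModType R) (f : U -> V) (L : R) :
  (forall y z, `|f y - f z| <= L * `|y - z|) -> continuous f.
Proof.
move=> fL y; apply/cvgrPdist_le => e e0; near=> z.
have L1 : 0 < `|L| + 1 by rewrite ltr_wpDl.
apply: le_trans (fL _ _) _; apply: le_trans (_ : (`|L| + 1) * `|y - z| <= _).
  by rewrite ler_wpM2r// (le_trans (ler_norm L))// lerDl.
rewrite mulrC -ler_pdivlMr//.
near: z; have /cvgrPdist_le : z @[z --> y] --> y by [].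
by apply; rewrite divr_gt0.
Unshelve. all: by end_near. Qed.

Lemma near_dist_le (V : normedModType R) (x : V) (e : R) : 0 < e ->
  \forall y \near x, `|x - y| <= e.
Proof. by have /cvgrPdist_le : z @[z --> x] --> x by []; apply. Qed.

Lemma continuous_atP (U V : normedModType R) (f : U -> V) (x : U) :
  (forall e : R, 0 < e -> \forall y \near x, `|f x - f y| <= e) <->
  {for x, continuous f}.
Proof. by split=> [h|/cvgrPdist_le//]; apply/cvgrPdist_le. Qed.

Lemma near_norm_le (V : normedModType R) (e : R) : 0 < e ->
  \forall y \near (0 : V), `|y| <= e.
Proof.
by move=> /(near_dist_le (0 : V)); apply: filterS => y; rewrite sub0r normrN.
Qed.

Lemma differentiable_of_linear_approx (U V : normedModType R) (f : U -> V)
    (x : U) (l : {linear U -> V}) : continuous l ->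
  (forall e : R, 0 < e -> exists2 d : R, 0 < d &
    forall h, `|h| <= d -> `|f (h + x) - f x - l h| <= e * `|h|) ->
  differentiable f x /\ 'd f x = l :> (U -> V).
Proof.
move=> cl H.
have e : f \o shift x = cst (f x) + l +o_ (0 : U) id.
  apply/eqaddoP => r r0; have [d d0 hd] := H r r0.
  apply: filterS (near_norm_le U d0) => h /hd.
  by rewrite -[X in _ -> `|X| <= _]/(f (h + x) - (f x + l h)) (opprD (f x)) addrA.
have dE := diff_unique cl e; split=> //.
by apply/diff_locallyP; rewrite dE; split.
Qed.

Lemma differentiable_of_approx n m (f : 'rV[R]_n -> 'rV[R]_m) (x : 'rV[R]_n)
    (J : 'M[R]_(n, m)) :
  (forall e : R, 0 < e -> exists2 d : R, 0 < d &
    forall h, `|h| <= d -> `|f (h + x) - f x - h *m J| <= e * `|h|) ->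
  differentiable f x /\ jacobian f x = J.
Proof.
move=> H.
have cJ : continuous (mulmxr J : 'rV[R]_n -> 'rV[R]_m).
  move=> y; apply: (@continuous_mulmx _ _ _ _ _ id (cst J));
    [exact: cvg_id|exact: cst_continuous].
have [df dE] := differentiable_of_linear_approx cJ H.
split=> //; apply/row_matrixP => i.
by rewrite !rowE /jacobian mul_rV_lin1 dE.
Qed.

Lemma near_dist_lt (V : normedModType R) (x0 x : V) (T : R) : `|x - x0| < T ->
  \forall y \near x, `|y - x0| < T.
Proof.
move=> xT; have xT' : 0 < T - `|x - x0| by rewrite subr_gt0.
have : \forall y \near x, `|x - y| < T - `|x - x0|.
  by have /cvgrPdist_lt : z @[z --> x] --> x by []; apply.
apply: filterS => y xy; rewrite -(subrKA x) (le_lt_trans (ler_normD _ _))//.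
by rewrite distrC -ltrBrDr.
Qed.

Lemma near_add0 (V : normedModType R) (x : V) (P : V -> Prop) :
  (\forall y \near x, P y) -> \forall h \near (0 : V), P (h + x).
Proof.
rewrite (near_shift 0 x P); apply: filterS => z /=.
by rewrite subr0.
Qed.

Lemma is_derive_mulmx (V : normedModType R) m n p (A : V -> 'M[R]_(m, n))
    (B : V -> 'M[R]_(n, p)) dA dB (t v : V) :
  is_derive t v A (dA) -> is_derive t v B (dB) ->
  is_derive t v (fun x => A x *m B x) (dA *m B t + A t *m dB).
Proof.
move=> /is_derive_mxP hA /is_derive_mxP hB; apply/is_derive_mxP => i j.
have -> : (fun x => (A x *m B x) i j) =
    \sum_k ((fun x => A x i k) * (fun x => B x k j)).
  by apply/funext => x; rewrite mxE fct_sumE.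
have h k : is_derive t v ((fun x => A x i k) * (fun x => B x k j))
    (A t i k * dB k j + B t k j * dA i k).
  exact: is_deriveM.
apply: is_derive_eq; rewrite !mxE -big_split; apply: eq_bigr => k _ /=.
by rewrite addrC [B t k j * _]mulrC.
Qed.

End differentials.

Section flow.
Context {R : realType}.

Definition C1_at n m (f : 'rV[R]_n -> 'rV[R]_m) (x : 'rV[R]_n) : Prop :=
  differentiable f x /\ {for x, continuous (jacobian f)}.

(** The mean value inequality is applied on the segment to [f] minus a linear map. [J0] is free:
    [J0 = 0] yields a Lipschitz bound, and [J0 = jacobian f y] a first-order expansion. *)
Lemma segment_approx n m (f : 'rV[R]_n -> 'rV[R]_m) (y z : 'rV[R]_n)
    (J0 : 'M[R]_(n, m)) (C : R) :
  (forall s : R, 0 <= s <= 1 -> differentiable f (y + s *: (z - y)) /\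
     `|jacobian f (y + s *: (z - y)) - J0| <= C) ->
  `|f z - f y - (z - y) *m J0| <= n%:R * C * `|z - y|.
Proof.
move=> H; pose g (s : R) := y + s *: (z - y).
have dg (s : R) : is_derive s 1 g (z - y).
  have : is_derive s 1 (cst y + (fun s : R => s *: (z - y))) (0 + (z - y)).
    apply: is_deriveD; apply: DeriveDef; first exact/derivable1_diffP.
    by rewrite deriveE// diff_val scale1r.
  by rewrite add0r.
have dfg (s : R) : 0 <= s <= 1 ->
    is_derive s 1 (f \o g) ((z - y) *m jacobian f (g s)).
  move=> /H [df _]; rewrite -deriveEjacobian//.
  exact: is_derive_comp1.
have dl (s : R) : is_derive s 1 (fun s : R => s *: ((z - y) *m J0)) ((z - y) *m J0).
  apply: DeriveDef; first exact/derivable1_diffP.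
  by rewrite deriveE// diff_val scale1r.
have := @mean_value_mx R 1 m (f \o g - (fun s : R => s *: ((z - y) *m J0)))
  (fun s => (z - y) *m jacobian f (g s) - (z - y) *m J0) 0 1
  (n%:R * C * `|z - y|) ler01.
rewrite subr0 mulr1 /= => h.
have e0 : (f \o g - (fun s : R => s *: ((z - y) *m J0))) 0 = f y.
  by rewrite -[LHS]/(f (g 0) - 0 *: _) /g !scale0r addr0 subr0.
have e1 : (f \o g - (fun s : R => s *: ((z - y) *m J0))) 1 =
    f z - (z - y) *m J0.
  by rewrite -[LHS]/(f (g 1) - 1 *: _) /g !scale1r [y + _]addrC subrK.
move: h; rewrite e0 e1 addrAC; apply.
- move=> t t01; have h1 := dfg _ t01; have h2 := dl t; exact: is_deriveB.
- move=> t t01; rewrite -mulmxBr (le_trans (mulmx_norm_le _ _))//.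
  rewrite mulrAC ler_wpM2r// ler_wpM2l//; exact: (H t t01).2.
Qed.

Lemma ball_segment (V : normedModType R) (x0 y z : V) (r s : R) :
  `|y - x0| <= r -> `|z - x0| <= r -> 0 <= s <= 1 ->
  `|y + s *: (z - y) - x0| <= r.
Proof.
move=> yr zr /andP[s0 s1].
have -> : y + s *: (z - y) - x0 = (1 - s) *: (y - x0) + s *: (z - x0).
  have -> : z - x0 = (z - y) + (y - x0) by rewrite subrKA.
  by rewrite addrAC scalerBl scale1r [s *: (_ + (y - x0))]scalerDr [s *: (z - y) + _]addrC addrA subrK.
rewrite (le_trans (ler_normD _ _))// !normrZ (ger0_norm s0) ger0_norm ?subr_ge0//.
have : (1 - s) * `|y - x0| <= (1 - s) * r by rewrite ler_wpM2l// subr_ge0.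
have : s * `|z - x0| <= s * r by rewrite ler_wpM2l.
lra.
Qed.

End flow.

(** * Local flow of a C^1 field, with its space derivative *)

Section local_flow.
Context {R : realType} {n : nat}.
Variables (b : 'rV[R]_n -> 'rV[R]_n) (x0 : 'rV[R]_n) (r : R).
Hypotheses (r0 : 0 < r) (hb : forall x, `|x - x0| <= r -> C1_at b x).

Let K : set 'rV[R]_n := [set x | `|x - x0| <= r].

Let compactK : compact K.
Proof.
apply: bounded_closed_compact.
  exists (`|x0| + r); split; first exact: num_real.
  move=> M hM x /= Kx; rewrite (le_trans _ (ltW hM))//.
  by rewrite -[x](subrK x0) addrC (le_trans (ler_normD _ _))// lerD2l.
rewrite (_ : K = closed_ball_ Num.norm x0 r); first exact: closed_closed_ball_.
by apply/funext => x; rewrite /K /closed_ball_ /= distrC.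
Qed.

Let K_bounded (V : normedModType R) (f : 'rV[R]_n -> V) :
  (forall x, K x -> {for x, continuous f}) ->
  exists2 C : R, 0 <= C & forall x, K x -> `|f x| <= C.
Proof.
move=> cf.
have K0 : K !=set0 by exists x0; rewrite /K /= subrr normr0 ltW.
have [|c Kc cmax] := @compact_EVT_max _ R (fun x => `|f x|) K K0 compactK.
  apply: continuous_in_subspaceT => x; rewrite inE => Kx.
  by apply: (@continuous_comp _ _ _ f (fun v : V => `|v|)); [exact: cf|exact: norm_continuous].
by exists `|f c| => // x Kx; apply: cmax; rewrite inE.
Qed.

Let b_cont x : K x -> {for x, continuous b}.
Proof. by move=> /hb [/differentiable_continuous]. Qed.

Let jac_cont x : K x -> {for x, continuous (jacobian b)}.
Proof. by move=> /hb []. Qed.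

Let b_lipschitz M : (forall x, K x -> `|jacobian b x| <= M) ->
  forall y z, K y -> K z -> `|b y - b z| <= n%:R * M * `|y - z|.
Proof.
move=> hM y z Ky Kz; have := @segment_approx R n n b z y 0 M.
rewrite mulmx0 subr0; apply => s s01; rewrite subr0.
have Ks : K (z + s *: (y - z)) by exact: ball_segment.
by split; [have [] := hb Ks|exact: hM].
Qed.

(** Differentiability that is uniform on the ball, from the uniform continuity of the Jacobian.
    [n%:R + 1] absorbs the factor of [segment_approx] and is nonzero even for [n = 0]. *)
Let b_approx (e : R) : 0 < e -> exists2 d : R, 0 < d &
  forall y z, K y -> K z -> `|z - y| <= d ->
    `|b z - b y - (z - y) *m jacobian b y| <= e * `|z - y|.
Proof.
move=> e0; have n10 : 0 < n%:R + 1 :> R by rewrite ltr_wpDl.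
have [d d0 hd] := uniform_continuity compactK jac_cont (divr_gt0 e0 n10).
exists d => // y z Ky Kz zy.
apply: le_trans (_ : n%:R * (e / (n%:R + 1)) * `|z - y| <= _).
  apply: segment_approx => s s01.
  have Ks : K (y + s *: (z - y)) by exact: ball_segment.
  split; first by have [] := hb Ks.
  apply: hd => //; rewrite addrAC subrr add0r normrZ.
  case/andP: s01 => s0 s1; rewrite ger0_norm// (le_trans _ zy)// ler_piMl//.
by rewrite ler_wpM2r// mulrA ler_pdivrMr// mulrDr mulr1 mulrC lerDl ltW.
Qed.

(** [phi] is the Picard solution for the clamped field and [J] that of the variational equation,
    where [jacobian b] acts on the right because vectors are rows. Gronwall then bounds the
    difference of two trajectories, that of two solutions [J], and the remainder
    [phi t (h + x) - phi t x - h *m J t x], which identifies [J] with the space derivative. *)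
Lemma local_C1_flow : exists (phi : R -> 'rV[R]_n -> 'rV[R]_n)
    (J : R -> 'rV[R]_n -> 'M[R]_n) (T C : R), 0 < T /\
  forall x, `|x - x0| < T ->
  [/\ phi 0 x = x, J 0 x = 1%:M &
    forall t, `|t| < T ->
    [/\ `|phi t x - x0| <= r, `|phi t x - x| <= C * `|t|,
        is_derive t 1 (phi ^~ x) (b (phi t x)),
        is_derive t 1 (J ^~ x) (J t x *m jacobian b (phi t x)) &
    [/\ `|J t x - 1%:M| <= C * `|t|,
        differentiable (phi t) x,
        jacobian (phi t) x = J t x & {for x, continuous (J t)}]]].
Proof.
have [M0 M00 hM0] := K_bounded b_cont.
have [M1 M10 hM1] := K_bounded jac_cont.
pose L := n%:R * M1 + 1; have L0 : 0 < L by rewrite ltr_wpDl// mulr_ge0.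
(* One [T] bounds time and the distance of the starting point to [x0]. The first term gives
   [L * T <= 1 / 2]; the others keep trajectories within [r / 2 + r / 2] of [x0], where clamping
   changes nothing. *)
pose T := Num.min (1 / 2 / L) (Num.min (r / 2 / (M0 + 1)) (r / 2)).
have M010 : 0 < M0 + 1 by rewrite ltr_wpDl.
have T0 : 0 < T by rewrite !lt_min !divr_gt0.
have TL : L * T <= 1 / 2.
  by rewrite mulrC -ler_pdivlMr// ge_min lexx.
have TM : M0 * T <= r / 2.
  have : T <= r / 2 / (M0 + 1) by rewrite !ge_min lexx orbT.
  rewrite ler_pdivlMr// => h; apply: le_trans h.
  by rewrite mulrC ler_wpM2l ?(ltW T0)// lerDl.
have Tr : T <= r / 2 by rewrite !ge_min lexx !orbT.
have r0' := ltW r0.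
pose bc y := b (clamp_mx x0 r y).
have Kc y : K (clamp_mx x0 r y) by exact: clamp_mx_dist.
have bc_lip y z : `|bc y - bc z| <= L * `|y - z|.
  apply: le_trans (b_lipschitz hM1 (Kc _) (Kc _)) _.
  apply: ler_pM => //; rewrite ?mulr_ge0 ?lerDl//.
  exact: clamp_mx_lipschitz.
have bc_cont : continuous bc.
  exact: lipschitz_continuous bc_lip.
have /choice[Phi hPhi] : forall x, exists y : R -> 'rV[R]_n, y 0 = x /\
    forall t, `|t| <= T -> is_derive (t : R) 1 y (bc (y t)).
  move=> x; apply: (@picard R 1 n (fun _ => bc) L T) => //; first exact: ltW.
  by move=> y cy t; apply: (@continuous_comp _ _ _ y bc); [exact: cy|exact: bc_cont].
have Phi0 x : Phi x 0 = x by have [] := hPhi x.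
have Phi_dist x t : `|t| <= T -> `|Phi x t - x| <= M0 * `|t|.
  move=> tT; rewrite -[X in _ - X](Phi0 x).
  apply: (@mean_value_mx_sym _ _ _ _ (fun t => bc (Phi x t)) T) => //.
    by move=> s sT; have [_] := hPhi x; exact.
  by move=> s _; exact: hM0.
have PhiK x t : `|x - x0| < T -> `|t| <= T -> K (Phi x t).
  move=> xT tT; rewrite /K /= -(subrKA x) (le_trans (ler_normD _ _))//.
  have := Phi_dist x t tT; have : M0 * `|t| <= M0 * T by rewrite ler_wpM2l.
  move: (ltW xT); lra.
have dPhi x t : `|x - x0| < T -> `|t| <= T ->
    is_derive (t : R) 1 (Phi x) (b (Phi x t)).
  move=> xT tT; have [_ /(_ t tT)] := hPhi x.
  by rewrite /bc clamp_mx_id//; exact: PhiK.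
have Phi_lip x y t : `|x - x0| < T -> `|y - x0| < T -> `|t| <= T ->
    `|Phi x t - Phi y t| <= 2 * `|x - y|.
  move=> xT yT tT.
  have := @short_time_gronwall R 1 n (fun t => Phi x t - Phi y t)
    (fun t => b (Phi x t) - b (Phi y t)) L T 0 (ltW L0) (ltW T0) TL (lexx _).
  rewrite mulr0 addr0 !Phi0; apply => // s sT.
    have h1 := dPhi x s xT sT; have h2 := dPhi y s yT sT; exact: is_deriveB.
  rewrite addr0; apply: le_trans (b_lipschitz hM1 (PhiK _ _ _ _) (PhiK _ _ _ _)) _ => //.
  by rewrite ler_wpM2r// lerDl.
(* Clamped in time and in space, the coefficient is continuous and bounded for all [t], as [picard]
   requires. *)
pose A x t := jacobian b (clamp_mx x0 r (Phi x (clamp 0 T t))).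
have AE x t : `|x - x0| < T -> `|t| <= T -> A x t = jacobian b (Phi x t).
  move=> xT tT; have ct : clamp 0 T t = t by rewrite clamp_id ?subr0.
  by rewrite /A ct (clamp_mx_id r0' (PhiK x t xT tT)).
have A_cont x : continuous (A x).
  move=> t; apply: (@continuous_comp _ _ _
    (fun t => clamp_mx x0 r (Phi x (clamp 0 T t))) (jacobian b)); last first.
    exact: jac_cont.
  apply: (@continuous_comp _ _ _ (fun t => Phi x (clamp 0 T t)) (clamp_mx x0 r)).
    apply: (@continuous_comp _ _ _ (clamp 0 T) (Phi x)); first exact: clamp_continuous.
    have [_ /(_ (clamp 0 T t))] := hPhi x.
    by move=> h; apply: (is_derive1_continuous (h _));
      rewrite -[X in `|X|]subr0 clamp_dist// ltW.
  have: forall y z, `|clamp_mx x0 r y - clamp_mx x0 r z| <= 1 * `|y - z|.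
    by move=> y z; rewrite mul1r; exact: clamp_mx_lipschitz.
  by move=> /lipschitz_continuous; apply.
have AM x t : `|A x t| <= M1 by apply: hM1.
have mulA_le m (P : 'M[R]_(m, n)) x t : `|P *m A x t| <= L * `|P|.
  rewrite (le_trans (mulmx_norm_le _ _))// mulrAC ler_wpM2r//.
  by rewrite (le_trans (ler_wpM2l _ (AM x t)))// lerDl.
have /choice[J hJ] : forall x, exists y : R -> 'M[R]_n, y 0 = 1%:M /\
    forall t, `|t| <= T -> is_derive (t : R) 1 y (y t *m A x t).
  move=> x; apply: (@picard R n n (fun t P => P *m A x t) L T) => //; first exact: ltW.
  - by move=> y cy t; apply: continuous_mulmx; [exact: cy|exact: A_cont].
  - by move=> t P Q; rewrite -mulmxBl.
have J0 x : J x 0 = 1%:M by have [] := hJ x.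
have J_bound x t : `|t| <= T -> `|J x t| <= 2 * `|1%:M : 'M[R]_n|.
  move=> tT.
  have := @short_time_gronwall R n n (J x) (fun t => J x t *m A x t)
    L T 0 (ltW L0) (ltW T0) TL (lexx _).
  rewrite mulr0 addr0 J0; apply => // s sT; last by rewrite addr0.
  by have [_] := hJ x; apply.
pose C := M0 + L * (2 * `|1%:M : 'M[R]_n|).
have J_dist x t : `|t| <= T -> `|J x t - 1%:M| <= C * `|t|.
  move=> tT; rewrite -(J0 x).
  apply: (@mean_value_mx_sym _ _ _ _ (fun t => J x t *m A x t) T) => //.
    by move=> s sT; have [_] := hJ x; exact.
  move=> s sT; apply: le_trans (mulA_le _ _ _ _) _.
  by rewrite (le_trans (ler_wpM2l (ltW L0) (J_bound x s sT)))// lerDr.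
pose N : R := 2 * `|1%:M : 'M[R]_n|.
have N0 : 0 <= N by rewrite mulr_ge0.
have J_cont x t : `|x - x0| < T -> `|t| <= T -> {for x, continuous (J ^~ t)}.
  move=> xT tT; apply/continuous_atP => e e0.
  have D0 : 0 < 2 * (T * (n%:R * N)) + 1.
    by rewrite ltr_wpDl// !mulr_ge0// ltW.
  (* Gronwall multiplies the forcing term [n%:R * N * eta] by [2 * T]; the [+ 1] keeps the
     denominator positive when that factor vanishes. *)
  pose eta := e / (2 * (T * (n%:R * N)) + 1).
  have eta0 : 0 < eta by rewrite divr_gt0.
  have [d d0 hd] := uniform_continuity compactK jac_cont eta0.
  near=> y.
  have yT : `|y - x0| < T by near: y; exact: (near_dist_lt xT).
  have xyd : 2 * `|x - y| <= d.
    rewrite mulrC -ler_pdivlMr//; near: y.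
    by apply: (@near_dist_le _ _ x (d / 2)); rewrite divr_gt0.
  have := @short_time_gronwall R n n (fun t => J x t - J y t)
    (fun t => J x t *m A x t - J y t *m A y t) L T (n%:R * N * eta)
    (ltW L0) (ltW T0) TL.
  rewrite !J0 subrr normr0 add0r => /(_ _ _ _ t tT) h.
  apply: le_trans (h _ _ _) _.
  - by apply: mulr_ge0 (ltW eta0); rewrite mulr_ge0.
  - move=> s sT; have [_ /(_ s sT) h1] := hJ x; have [_ /(_ s sT) h2] := hJ y.
    exact: is_deriveB.
  - move=> s sT.
    have -> : J x s *m A x s - J y s *m A y s =
        (J x s - J y s) *m A y s + J x s *m (A x s - A y s).
      by rewrite mulmxBl mulmxBr [RHS]addrC subrKA.
    rewrite (le_trans (ler_normD _ _))// lerD//.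
    rewrite (le_trans (mulmx_norm_le _ _))//.
    apply: ler_pM; [by rewrite mulr_ge0|by []|by rewrite ler_wpM2l// J_bound|].
    rewrite !AE//; apply: hd; first exact: PhiK.
    by rewrite (le_trans (Phi_lip _ _ _ _ _ _)).
  - have -> : 2 * (T * (n%:R * N * eta)) = 2 * (T * (n%:R * N)) * eta by rewrite !mulrA.
    have <- : (2 * (T * (n%:R * N)) + 1) * eta = e by rewrite mulrC divfK// lt0r_neq0.
    by apply: ler_wpM2r (ltW eta0) _ _ _; rewrite lerDl.
have dPhix x t : `|x - x0| < T -> `|t| <= T ->
    differentiable (Phi ^~ t) x /\ jacobian (Phi ^~ t) x = J x t.
  move=> xT tT; apply: differentiable_of_approx => e e0.
  have T1 : 0 < 4 * T by rewrite mulr_gt0.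
  (* The forcing term will be [e / (4 * T) * (2 * |h|)], which the Gronwall factor [2 * T] turns
     into [e * |h|]. *)
  have [d d0 hd] := b_approx (divr_gt0 e0 T1).
  have xT' : 0 < T - `|x - x0| by rewrite subr_gt0.
  exists (Num.min (d / 2) ((T - `|x - x0|) / 2)).
    by rewrite lt_min !divr_gt0.
  move=> h; rewrite le_min => /andP[h1 h2].
  have hxT : `|h + x - x0| < T.
    rewrite -addrA (le_lt_trans (ler_normD _ _))//; move: h2 xT'; lra.
  have {h1}h2 : 2 * `|h| <= d by move: h1; lra.
  have := @short_time_gronwall R 1 n (fun t => Phi (h + x) t - Phi x t - h *m J x t)
    (fun t => b (Phi (h + x) t) - b (Phi x t) - h *m (J x t *m A x t)) L T
    (e / (4 * T) * (2 * `|h|)) (ltW L0) (ltW T0) TL.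
  rewrite !Phi0 J0 mulmx1 addrK subrr normr0 add0r => /(_ _ _ _ t tT) H.
  apply: le_trans (H _ _ _) _.
  - by rewrite mulr_ge0 ?(ltW (divr_gt0 e0 T1))// mulr_ge0.
  - move=> s sT; have h1 := dPhi _ s hxT sT; have h1' := dPhi _ s xT sT.
    have hJs : is_derive (s : R) 1 (fun s => h *m J x s) (h *m (J x s *m A x s)).
      have [_ /(_ s sT) dJ] := hJ x.
      have dh : is_derive (s : R) 1 (cst h) (0 : 'rV[R]_n) by exact: is_derive_cst.
      by have := is_derive_mulmx dh dJ; rewrite mul0mx add0r.
    by apply: is_deriveB.
  - move=> s sT.
    (* The remainder solves the same linear equation, forced by the error of the first-order
       expansion of [b] between the two trajectories. *)
    have -> : b (Phi (h + x) s) - b (Phi x s) - h *m (J x s *m A x s) =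
      (Phi (h + x) s - Phi x s - h *m J x s) *m A x s +
      (b (Phi (h + x) s) - b (Phi x s) - (Phi (h + x) s - Phi x s) *m A x s).
      by rewrite [in RHS]mulmxBl mulmxA [RHS]addrC subrKA.
    have hh : `|Phi (h + x) s - Phi x s| <= 2 * `|h|.
      by have := Phi_lip (h + x) x s hxT xT sT; rewrite addrK.
    apply: (le_trans (ler_normD _ _)); apply: lerD; first exact: mulA_le.
    rewrite AE//; apply: le_trans (hd _ _ _ _ _) _.
    + exact: PhiK.
    + exact: PhiK.
    + exact: le_trans hh h2.
    + by rewrite ler_wpM2l ?(ltW (divr_gt0 e0 T1)).
  - rewrite le_eqVlt; apply/orP; left; apply/eqP.
    field; exact: lt0r_neq0.
exists (fun t x => Phi x t), (fun t x => J x t), T, C; split=> // x xT.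
split=> // t /ltW tT; split.
- exact: PhiK.
- rewrite (le_trans (Phi_dist x t tT))// ler_wpM2r// lerDl !mulr_ge0// ltW//.
- exact: dPhi.
- by have [_ /(_ t tT)] := hJ x; rewrite AE.
- by have [? ?] := dPhix x t xT tT; split=> //; [exact: J_dist|exact: J_cont].
Unshelve. all: by end_near. Qed.
End local_flow.

(** * C^k calculus *)

Section differentiable_ext.
Context {R : realType}.

Lemma near_eq_differentiable (U V : normedModType R) (f g : U -> V) (x : U) :
  (\near x, f x = g x) -> differentiable f x -> differentiable g x.
Proof.
move=> fg df.
suff : forall e : R, 0 < e -> exists2 d : R, 0 < d &
    forall h, `|h| <= d -> `|g (h + x) - g x - 'd f x h| <= e * `|h|.
  by move=> /(differentiable_of_linear_approx (diff_continuous df))[].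
move=> e e0.
have fgx : f x = g x by exact: nbhs_singleton fg.
have H : \forall h \near (0 : U), `|g (h + x) - g x - 'd f x h| <= e * `|h|.
  have h1 := differentiable_approx df e0.
  have h2 := near_add0 (P := fun y => f y = g y) fg.
  by apply: filterS2 h1 h2 => h; rewrite fgx => ? <-.
have /nbhs_ballP[d /= d0 hd] := H.
exists (d / 2); first by rewrite divr_gt0.
move=> h hh; apply: hd; rewrite -ball_normE /= sub0r normrN (le_lt_trans hh)//.
lra.
Qed.

Lemma deriveDv (U V : normedModType R) (f : U -> V) (x u v : U) :
  differentiable f x -> 'D_(u + v) f x = 'D_u f x + 'D_v f x.
Proof. by move=> df; rewrite !deriveE// linearD. Qed.

Lemma deriveZv (U V : normedModType R) (f : U -> V) (x u : U) (a : R) :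
  differentiable f x -> 'D_(a *: u) f x = a *: 'D_u f x.
Proof. by move=> df; rewrite !deriveE// linearZ. Qed.

Lemma derive_sumv (U V : normedModType R) (f : U -> V) (x : U) (I : Type)
    (r : seq I) (P : pred I) (u : I -> U) : differentiable f x ->
  'D_(\sum_(i <- r | P i) u i) f x = \sum_(i <- r | P i) 'D_(u i) f x.
Proof.
move=> df; rewrite deriveE// linear_sum; apply: eq_bigr => i _.
by rewrite deriveE.
Qed.

Lemma derive_row n (V : normedModType R) (f : 'rV[R]_n -> V) (x v : 'rV[R]_n) :
  differentiable f x -> 'D_v f x = \sum_i v 0 i *: 'D_(delta_mx 0 i) f x.
Proof.
move=> df; rewrite {1}[v]row_sum_delta derive_sumv//.
by apply: eq_bigr => i _; rewrite deriveZv.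
Qed.

Lemma derive_comp (U V W : normedModType R) (g : U -> V) (f : V -> W) (x v : U) :
  differentiable g x -> differentiable f (g x) ->
  'D_v (f \o g) x = 'D_('D_v g x) f (g x).
Proof.
move=> dg df; rewrite (deriveE _ (differentiable_comp dg df)) diff_comp//=.
by rewrite (deriveE _ df) (deriveE _ dg).
Qed.

End differentiable_ext.

Section C_on_calculus.
Context {R : realType}.

Lemma C_on_sub (U V : normedModType R) k (f : U -> V) (A B : set U) :
  A `<=` B -> C_on k f B -> C_on k f A.
Proof.
elim: k f => [|k IH] f AB /=; first by move=> h x /AB /h.
by move=> [h1 h2]; split=> [x /AB /h1//|v]; exact: IH.
Qed.

Lemma C_onS (U V : normedModType R) k (f : U -> V) (A : set U) :
  C_on k.+1 f A -> C_on k f A.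
Proof.
elim: k f => [|k IH] f; first by move=> [h _] x /h /differentiable_continuous.
by move=> [h1 h2]; split=> // v; exact: IH.
Qed.

Lemma C_on_le (U V : normedModType R) j k (f : U -> V) (A : set U) :
  (j <= k)%N -> C_on k f A -> C_on j f A.
Proof.
move=> /subnKC <-; elim: (k - j)%N => [|i IH]; first by rewrite addn0.
by rewrite addnS => /C_onS.
Qed.

Lemma C_on_continuous (U V : normedModType R) k (f : U -> V) (A : set U) :
  C_on k f A -> forall x, A x -> {for x, continuous f}.
Proof. by move=> /(C_on_le (leq0n k)). Qed.

Lemma C_on_ext (U V : normedModType R) k (f g : U -> V) (A : set U) :
  open A -> (forall x, A x -> f x = g x) -> C_on k f A -> C_on k g A.
Proof.
elim: k f g => [|k IH] f g oA fg.
  move=> cf x Ax; have h := cf x Ax.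
  apply/continuous_atP => e e0; have /continuous_atP /(_ e e0) := h.
  rewrite -fg//; have := open_nbhs_nbhs (conj oA Ax); apply: filterS2 => y Ay.
  by rewrite -(fg y Ay).
have near x : A x -> \near x, f x = g x.
  by move=> Ax; have := open_nbhs_nbhs (conj oA Ax); apply: filterS => y /fg.
move=> [h1 h2]; split=> [x Ax|v].
  exact: near_eq_differentiable (near x Ax) (h1 x Ax).
apply: (IH ('D_v f)) (h2 v) => // x Ax; apply: near_eq_derive; exact: near.
Qed.

Lemma C_on_cst (U V : normedModType R) k (c : V) (A : set U) :
  C_on k (fun _ : U => c) A.
Proof.
elim: k c => [|k IH] c; first by move=> x _; exact: cst_continuous.
split=> [x _|v]; first exact: differentiable_cst.
have e : 'D_v (fun _ : U => c) = (fun _ : U => 0 : V).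
  by apply/funext => x; exact: derive_cst.
by change (C_on k ('D_v (fun _ : U => c)) A); rewrite e; exact: IH.
Qed.

Lemma C_on_add (U V : normedModType R) k (f g : U -> V) (A : set U) : open A ->
  C_on k f A -> C_on k g A -> C_on k (fun x => f x + g x) A.
Proof.
move=> oA; elim: k f g => [|k IH] f g.
  by move=> cf cg x Ax; apply: continuousD; [exact: cf|exact: cg].
move=> [f1 f2] [g1 g2]; split=> [x Ax|v].
  by apply: differentiableD; [exact: f1|exact: g1].
apply: (C_on_ext _ _ (IH _ _ (f2 v) (g2 v))) => // x Ax.
by rewrite [RHS]deriveD//; apply: diff_derivable; [exact: f1|exact: g1].
Qed.

Lemma C_on_sum (U V : normedModType R) k (A : set U) (I : Type)
    (r : seq I) (P : pred I) (f : I -> U -> V) : open A ->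
  (forall i, P i -> C_on k (f i) A) ->
  C_on k (fun x => \sum_(i <- r | P i) f i x) A.
Proof.
move=> oA h; elim: r => [|i r IH].
  apply: (C_on_ext oA _ (@C_on_cst U V k 0 A)) => x _; by rewrite big_nil.
have [Pi|nPi] := boolP (P i).
  apply: (C_on_ext oA _ (C_on_add oA (h i Pi) IH)) => x _.
  by rewrite big_cons Pi.
by apply: (C_on_ext oA _ IH) => x _; rewrite big_cons (negbTE nPi).
Qed.

Lemma C_on_mul (U : normedModType R) k (c f : U -> R) (A : set U) :
  open A -> C_on k c A -> C_on k f A -> C_on k (fun x => c x * f x) A.
Proof.
move=> oA; elim: k c f => [|k IH] c f.
  by move=> cc cf x Ax; apply: continuousM; [exact: cc|exact: cf].
move=> hc hf; have [c1 c2] := hc; have [f1 f2] := hf; split=> [x Ax|v].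
  by apply: differentiableM; [exact: c1|exact: f1].
apply: (C_on_ext oA _ (C_on_add oA (IH _ _ (C_onS hc) (f2 v))
   (IH _ _ (C_onS hf) (c2 v)))) => x Ax.
by rewrite [RHS]deriveM//; apply: diff_derivable; [exact: c1|exact: f1].
Qed.

Lemma C_on_coord (U : normedModType R) m n k (f : U -> 'M[R]_(m, n)) (A : set U)
    i j : open A -> C_on k f A -> C_on k (fun x => f x i j) A.
Proof.
move=> oA.
elim: k f => [|k IH] f.
  by move=> h x /h /continuous_mxP; apply.
move=> [h1 h2]; split=> [x Ax|v].
  apply: (@differentiable_comp _ _ _ _ f (fun M : 'M[R]_(m, n) => M i j)).
    exact: h1.
  exact: differentiable_coord.
change (C_on k (fun x => 'D_v (fun x => f x i j) x) A).
apply: (C_on_ext oA _ (IH _ (h2 v))) => x Ax.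
by rewrite derive_mx ?mxE//; apply: diff_derivable; exact: h1.
Qed.

(** Induction on [k]: in coordinates the chain rule writes ['D_v (f \o g)] as a sum of products of
    functions of one class less. *)
Lemma C_on_comp (U : normedModType R) n k (g : U -> 'rV[R]_n)
    (f : 'rV[R]_n -> R) (A : set U) (B : set 'rV[R]_n) :
  open A -> open B -> (forall x, A x -> B (g x)) ->
  C_on k g A -> C_on k f B -> C_on k (f \o g) A.
Proof.
move=> oA oB AB; elim: k f g AB => [|k IH] f g AB.
  move=> hg hf x Ax; apply: continuous_comp; first exact: hg.
  by apply: hf; exact: AB.
move=> hg hf; have [g1 g2] := hg; have [f1 f2] := hf; split=> [x Ax|v].
  by apply: differentiable_comp; [exact: g1|apply: f1; exact: AB].
apply: (C_on_ext (f := fun x => \sum_i 'D_v g x 0 i * 'D_(delta_mx 0 i) f (g x))) => //.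
  move=> x Ax; rewrite [RHS](derive_comp v (g1 x Ax) (f1 _ (AB x Ax))).
  by rewrite [RHS](derive_row _ (f1 _ (AB x Ax))).
apply: C_on_sum => // i _; apply: C_on_mul => //.
  exact: (C_on_coord 0 i oA (g2 v)).
exact: (IH ('D_(delta_mx 0 i) f) g AB (C_onS hg) (f2 _)).
Qed.

(** An affine inner map has the constant derivative [l v], so no basis is involved, unlike in
    [C_on_comp]. This covers product spaces, where it serves to freeze one variable. *)
Lemma C_on_affine (U U' V : normedModType R) k (l : {linear U -> U'}) (c : U')
    (f : U' -> V) (A : set U') : continuous l -> open A ->
  C_on k f A -> C_on k (fun x => f (c + l x)) [set x | A (c + l x)].
Proof.
move=> cl oA.
have dl x : differentiable (fun x => c + l x) x.
  by apply: differentiableD; [exact: differentiable_cst|exact: linear_differentiable].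
have Dl x v : 'D_v (fun x => c + l x) x = l v.
  have dlx : differentiable l x by apply: linear_differentiable; exact: cl.
  have := deriveD (diff_derivable (v := v) (differentiable_cst c x)) (diff_derivable (v := v) dlx).
  by rewrite derive_cst add0r (deriveE _ dlx) diff_lin.
elim: k f => [|k IH] f.
  move=> h x Ax; apply: (@continuous_comp _ _ _ (fun x => c + l x) f).
    exact: differentiable_continuous.
  exact: h.
move=> [h1 h2]; split=> [x Ax|v].
  by apply: (@differentiable_comp _ _ _ _ (fun x => c + l x) f) => //; exact: h1.
apply: (C_on_ext _ _ (IH _ (h2 (l v)))) => [|x Ax].
  apply: (open_comp (f := fun x => c + l x)) => // x _.
  exact: differentiable_continuous.
by rewrite [RHS](derive_comp (g := fun x => c + l x)) ?Dl//; exact: h1.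
Qed.

End C_on_calculus.

(** * Interchange of a time derivative with a space derivative *)

Section schwarz.
Context {R : realType}.

Lemma mean_value_sym (f df : R -> R) (T C : R) :
  (forall t : R, `|t| <= T -> is_derive t 1 f (df t)) ->
  (forall t, `|t| <= T -> `|df t| <= C) ->
  forall t, `|t| <= T -> `|f t - f 0| <= C * `|t|.
Proof.
move=> hf hC t tT.
have := @mean_value_mx_sym R 1 1 (fun t => const_mx (f t)) (fun t => const_mx (df t)) T C.
move=> /(_ _ _ t tT) h.
have := le_coef_mx_norm (const_mx (f t) - const_mx (f 0) : 'M[R]_1) 0 0.
rewrite !mxE => /le_trans; apply; apply: h => s sT.
  apply/is_derive_mxP => i j.
  rewrite (_ : (fun x => _) = f) ?mxE; first exact: hf.
  by apply/funext => x; rewrite mxE.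
apply/mx_norm_leP => [|i j]; first by rewrite (le_trans _ (hC s sT)).
by rewrite mxE hC.
Qed.

Lemma derive_translate (U V : normedModType R) (f : U -> V) (a x v : U) :
  'D_v (fun y => f (y + a)) x = 'D_v f (x + a).
Proof.
rewrite /derive (_ : (fun h => h^-1 *: (((fun y => f (y + a)) \o shift x) (h *: v)
  - f (x + a))) = fun h => h^-1 *: ((f \o shift (x + a)) (h *: v) - f (x + a)))//.
by apply/funext => h /=; rewrite addrA.
Qed.

Lemma derivable_translate (U V : normedModType R) (f : U -> V) (a x v : U) :
  derivable f (x + a) v -> derivable (fun y => f (y + a)) x v.
Proof.
rewrite /derivable (_ : (fun h => h^-1 *: (((fun y => f (y + a)) \o shift x) (h *: v)
  - f (x + a))) = fun h => h^-1 *: ((f \o shift (x + a)) (h *: v) - f (x + a)))//.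
by apply/funext => h /=; rewrite addrA.
Qed.

Lemma is_derive_line (U V : normedModType R) (f : U -> V) (x v : U) (s : R) :
  derivable f (x + s *: v) v ->
  is_derive s 1 (fun s => f (x + s *: v)) ('D_v f (x + s *: v)).
Proof.
move=> df.
have e : (fun h : R => h^-1 *: (((fun s => f (x + s *: v)) \o shift s) (h *: 1)
    - f (x + s *: v))) =
  (fun h => h^-1 *: ((f \o shift (x + s *: v)) (h *: v) - f (x + s *: v))).
  apply/funext => h /=; rewrite [h *: 1]mulr1 scalerDl.
  by rewrite addrCA.
by apply: DeriveDef; rewrite /derivable /derive e.
Qed.

Lemma is_derive0_approx (V : normedModType R) (w : R -> V) (l : V) :
  (forall e : R, 0 < e -> exists2 r : R, 0 < r & forall t, `|t| <= r ->
     `|w t - w 0 - t *: l| <= e * `|t|) -> is_derive (0 : R) 1 w l.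
Proof.
move=> H.
have cw : h^-1 *: ((w \o shift (0 : R)) (h *: 1) - w 0) @[h --> (0 : R)^'] --> l.
  apply/cvgrPdist_le => e e0; have [r r0 hr] := H e e0; near=> t.
  have t0 : t != 0 by near: t; exact: nbhs_dnbhs_neq.
  have tr : `|t| <= r by near: t; exact: dnbhs0_le.
  rewrite distrC /= addr0 [t *: 1]mulr1.
  have -> : t^-1 *: (w t - w 0) - l = t^-1 *: (w t - w 0 - t *: l).
    by rewrite [in RHS]scalerBr scalerA mulVf// scale1r.
  rewrite normrZ -(ler_pM2l (x := `|t|)) ?normr_gt0//.
  by rewrite mulrA -normrM mulfV// normr1 mul1r mulrC hr.
apply: DeriveDef; first by apply/cvg_ex; exists l.
exact: cvg_lim.
Unshelve. all: by end_near. Qed.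

(** The second difference of [u], in time and along [v], is estimated by two mean value
    inequalities, the inner one using that ['D_v (K t)] stays close to [l]. The time derivative of
    ['D_v (u t)] is thus produced rather than assumed. This serves for the symmetry of second
    derivatives and for the evolution of a gradient along a flow. *)
Lemma schwarz (U : normedModType R) (u K : R -> U -> R) (x v : U) (d l : R) :
  0 < d ->
  (forall (t : R) y, `|t| <= d -> `|y - x| <= d -> is_derive t 1 (u ^~ y) (K t y)) ->
  (forall (t : R) y, `|t| <= d -> `|y - x| <= d -> derivable (K t) y v) ->
  (forall t : R, `|t| <= d -> derivable (u t) x v) ->
  (forall e : R, 0 < e -> exists2 r : R, 0 < r & forall t y, `|t| <= r ->
     `|y - x| <= r -> `|'D_v (K t) y - l| <= e) ->
  is_derive (0 : R) 1 (fun t => 'D_v (u t) x) l.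
Proof.
move=> d0 hu hK hd hl.
suff key e : 0 < e -> exists2 r : R, 0 < r & forall t, `|t| <= r ->
    `|'D_v (u t) x - 'D_v (u 0) x - t * l| <= e * `|t|.
  apply: is_derive0_approx => e e0; have [r r0 hr] := key e e0.
  by exists r.
move=> e0; have [r r0 hr] := hl e e0.
exists (Num.min d r); first by rewrite lt_min d0.
move=> t; rewrite le_min => /andP[td tr].
have v0 : 0 < `|v| + 1 by rewrite ltr_wpDl.
(* For [|s| <= m] the displacement [s *: v] has norm at most [d] and [r]; the [+ 1] covers
   [v = 0]. *)
pose m := Num.min d r / (`|v| + 1).
have m0 : 0 < m by rewrite divr_gt0// lt_min d0.
have near_x s : `|s| <= m -> `|x + s *: v - x| <= d /\ `|x + s *: v - x| <= r.
  move=> sm; rewrite addrAC subrr add0r normrZ; apply/andP; rewrite -le_min.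
  move: sm; rewrite /m ler_pdivlMr// => h; apply: le_trans h.
  by rewrite ler_wpM2l// lerDl.
have dx0 : `|x - x| <= d by rewrite subrr normr0 ltW.
have quot s : `|s| <= m ->
    `|u t (x + s *: v) - u t x - (u 0 (x + s *: v) - u 0 x) - t * (s * l)| <=
      e * `|s| * `|t|.
  move=> sm; have [sd sr] := near_x s sm.
  have := @mean_value_sym
    (fun t => u t (x + s *: v) - u t x - t * (s * l))
    (fun t => K t (x + s *: v) - K t x - s * l) (Num.min d r) (e * `|s|).
  move=> /(_ _ _ t); rewrite mul0r subr0 le_min td tr => /(_ _ _ isT) h.
  rewrite addrAC; apply: h => q; rewrite le_min => /andP[qd qr].
    have h1 := hu q _ qd sd; have h2 := hu q _ qd dx0.
    have h3 : is_derive q 1 (fun t : R => t * (s * l)) (s * l).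
      apply: DeriveDef; first exact/derivable1_diffP.
      by rewrite deriveE// diff_val scale1r.
    by apply: is_deriveB.
  have := @mean_value_sym (fun s => K q (x + s *: v) - s * l)
    (fun s => 'D_v (K q) (x + s *: v) - l) m e.
  move=> /(_ _ _ s sm); rewrite scale0r addr0 mul0r subr0 addrAC; apply => p pm;
    have [pd pr] := near_x p pm.
    have h1 := is_derive_line (hK q _ qd pd).
    have h3 : is_derive p 1 (fun t : R => t * l) l.
      apply: DeriveDef; first exact/derivable1_diffP.
      by rewrite deriveE// diff_val scale1r.
    by apply: is_deriveB.
  exact: hr.
have dut := hd t td; have du0 : derivable (u 0) x v by apply: hd; rewrite normr0 ltW.
have dw : derivable (u t - u 0) x v by exact: derivableB.
have -> : 'D_v (u t) x - 'D_v (u 0) x = 'D_v (u t - u 0) x by rewrite (deriveB dut du0).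
have cw : (fun h : R => `|h^-1 *: (((u t - u 0) \o shift x) (h *: v) - (u t - u 0) x) - t * l|)
    @ (0 : R)^' --> `|'D_v (u t - u 0) x - t * l|.
  by apply: cvg_norm; apply: cvgB; [exact: dw|exact: cvg_cst].
(* The second difference divided by [s] becomes, as [s] tends to 0, the difference of the
   directional derivatives. *)
apply: (cvgr_to_le cw); near=> s.
have s0 : s != 0 by near: s; exact: nbhs_dnbhs_neq.
have sm : `|s| <= m by near: s; exact: dnbhs0_le.
have := quot s sm; rewrite -(ler_pM2l (x := `|s|^-1)) ?invr_gt0 ?normr_gt0//.
rewrite -normfV -normrM => q1.
have -> : e * `|t| = `|s^-1| * (e * `|s| * `|t|).
  by rewrite normfV mulrA [_^-1 * _]mulrCA mulVf ?normr_eq0// mulr1.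
apply: le_trans q1; rewrite le_eqVlt; apply/orP; left; apply/eqP; congr `|_|.
transitivity (s^-1 * (u t (x + s *: v) - u 0 (x + s *: v) - (u t x - u 0 x)) - t * l).
  by rewrite /= [s *: v + x]addrC.
by field.
Unshelve. all: by end_near. Qed.

(** [schwarz] applied to the translates [u t y = h (y + t *: w)], whose time derivative is ['D_w h]
    at the translated point. *)
Lemma derive_sym (U : normedModType R) (h : U -> R) (A : set U) (x v w : U) :
  open A -> A x -> C_on 2 h A -> 'D_w ('D_v h) x = 'D_v ('D_w h) x.
Proof.
move=> oA Ax hh; have [h1 h2] := hh; have [hv1 hv2] := h2 v; have [hw1 hw2] := h2 w.
have /nbhs_ballP[r /= r0 rA] := open_nbhs_nbhs (conj oA Ax).
have w0 : 0 < `|w| + 1 by rewrite ltr_wpDl.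
have dist c t y : 0 < c -> `|t| <= c / 3 / (`|w| + 1) ->
   `|y - x| <= c / 3 / (`|w| + 1) -> `|y + t *: w - x| < c.
  move=> c0; rewrite !ler_pdivlMr// => ht hy.
  have b1 : `|t| * `|w| <= `|t| * (`|w| + 1) by rewrite ler_wpM2l// lerDl.
  have b2 : `|y - x| <= `|y - x| * (`|w| + 1) by rewrite ler_peMr// lerDr.
  rewrite addrAC (le_lt_trans (ler_normD _ _))// normrZ.
  move: ht hy b1 b2; lra.
pose d := r / 3 / (`|w| + 1).
have d0 : 0 < d by rewrite !divr_gt0.
have inA t y : `|t| <= d -> `|y - x| <= d -> A (y + t *: w).
  by move=> td yd; apply: rA; rewrite -ball_normE /= distrC; exact: dist.
have := @schwarz U (fun t y => h (y + t *: w)) (fun t y => 'D_w h (y + t *: w))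
  x v d ('D_v ('D_w h) x) d0.
case.
- move=> t y td yd; apply: is_derive_line; apply: diff_derivable; apply: h1.
  exact: inA.
- move=> t y td yd; apply: (@derivable_translate _ _ ('D_w h)).
  by apply: diff_derivable; apply: hw1; exact: inA.
- move=> t td; apply: (@derivable_translate _ _ h).
  by apply: diff_derivable; apply: h1; apply: inA; rewrite // subrr normr0 ltW.
- move=> e e0; have /continuous_atP /(_ e e0) /nbhs_ballP[c /= c0 hc] := hw2 v x Ax.
  exists (c / 3 / (`|w| + 1)); first by rewrite !divr_gt0.
  move=> t y tc yc.
  rewrite (@derive_translate _ _ ('D_w h)) distrC; apply: hc.
  by rewrite -ball_normE /= distrC; exact: dist.
have -> : (fun t : R => 'D_v (fun y => h (y + t *: w)) x) =
    (fun t : R => 'D_v h (x + t *: w)).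
  by apply/funext => t; exact: (@derive_translate _ _ h).
move=> _ <-.
have hl : derivable ('D_v h) (x + (0 : R) *: w) w.
  by rewrite scale0r addr0; apply: diff_derivable; exact: hv1.
by have [_ ->] := is_derive_line hl; rewrite scale0r addr0.
Qed.

End schwarz.

(** * Determinants and polynomials along a curve *)

Section products_and_determinants.
Context {R : realType}.

Lemma is_derive_prod (V : normedModType R) n (f : 'I_n -> V -> R)
    (df : 'I_n -> R) (t v : V) : (forall i, is_derive t v (f i) (df i)) ->
  is_derive t v (fun x => \prod_i f i x)
    (\sum_i df i * \prod_(j | j != i) f j t).
Proof.
elim: n f df => [|n IH] f df hf.
  rewrite big_ord0 (_ : (fun x => _) = cst 1); first exact: is_derive_cst.
  by apply/funext => x; rewrite big_ord0.
have h0 := hf ord0.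
have h1 := IH (fun i => f (lift ord0 i)) _ (fun i => hf (lift ord0 i)).
rewrite (_ : (fun x => _) = f ord0 * (fun x => \prod_i f (lift ord0 i) x)); last first.
  by apply/funext => x; rewrite big_ord_recl.
apply: is_derive_eq; rewrite big_ord_recl.
have -> : \prod_(j < n.+1 | j != ord0) f j t = \prod_i f (lift ord0 i) t.
  by rewrite big_mkcond big_ord_recl /= mul1r.
rewrite addrC; congr (_ + _); first exact: mulrC.
rewrite /GRing.scale /= mulr_sumr; apply: eq_bigr => i _.
rewrite [in RHS]big_mkcond big_ord_recl /= mulrCA; congr (_ * (_ * _)).
by rewrite big_mkcond.
Qed.

Lemma is_derive_bigsum (V W : normedModType R) (I : finType) (f : I -> V -> W)
    (df : I -> W) (t v : V) : (forall i, is_derive t v (f i) (df i)) ->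
  is_derive t v (fun x => \sum_i f i x) (\sum_i df i).
Proof.
move=> hf; elim: (index_enum I) => [|i r IH].
  rewrite big_nil (_ : (fun x => _) = cst 0); first exact: is_derive_cst.
  by apply/funext => x; rewrite big_nil.
rewrite big_cons (_ : (fun x => _) = f i + (fun x => \sum_(j <- r) f j x)).
  exact: is_deriveD.
by apply/funext => x; rewrite big_cons.
Qed.

(** Jacobi's formula at the identity, from the Leibniz expansion: a permutation other than 1 moves
    at least two indices, so every term of the derivative of its product keeps an off-diagonal
    factor, which vanishes at [t]. *)
Lemma is_derive_det1 n (A : R -> 'M[R]_n) (dA : 'M[R]_n) (t : R) :
  A t = 1%:M -> is_derive t 1 A dA ->
  is_derive t 1 (fun s => \det (A s)) (\tr dA).
Proof.
move=> A1 /is_derive_mxP hA.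
have h (s : 'S_n) := is_derive_prod (fun i => hA i (s i)).
have := is_derive_bigsum (fun s : 'S_n => is_deriveZ ((-1) ^+ s) (h s)).
rewrite (_ : (fun x => _) = fun x => \det (A x)); last exact: funext.
move=> hd; apply: is_derive_eq; rewrite (bigD1 1%g) //= [X in _ + X]big1 ?addr0.
  rewrite odd_perm1 expr0 scale1r; apply: eq_bigr => i _; rewrite perm1.
  rewrite big1 ?mulr1// => j _; by rewrite perm1 A1 mxE eqxx.
move=> s s1; rewrite big1 ?scaler0// => i _.
(* If the moved index that was found is [i] itself, its image is another moved index. *)
have [j ji sj] : exists2 j, j != i & s j != j.
  have /existsP[j sj] : [exists j, s j != j].
    apply: contraR s1; rewrite negb_exists => /forallP sE; apply/eqP/permP => j.
    by rewrite perm1; apply/eqP; have := sE j; rewrite negbK.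
  have [ji|] := eqVneq j i; last by exists j.
  exists (s j); first by rewrite -ji.
  by apply: contra sj => /eqP/perm_inj ->.
by rewrite (bigD1 j)//= A1 mxE eq_sym (negbTE sj) mul0r mulr0.
Qed.

(** Left multiplication by the constant matrix [invmx (A t)] reduces to the identity. *)
Lemma is_derive_det n (A : R -> 'M[R]_n) (dA : 'M[R]_n) (t : R) :
  A t \in unitmx -> is_derive t 1 A dA ->
  is_derive t 1 (fun s => \det (A s)) (\det (A t) * \tr (invmx (A t) *m dA)).
Proof.
move=> uA hA.
have hc : is_derive t 1 (cst (invmx (A t))) (0 : 'M[R]_n) by exact: is_derive_cst.
have h1 := is_derive_mulmx hc hA; rewrite mul0mx add0r in h1.
have h2 := is_derive_det1 (mulVmx uA) h1.
have h3 := is_deriveZ (\det (A t)) h2.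
rewrite (_ : (fun s => \det (A s)) = \det (A t) *: (fun s => \det (invmx (A t) *m A s)))//.
apply/funext => s; rewrite -[RHS]/(\det (A t) * \det (invmx (A t) *m A s)).
by rewrite det_mulmx det_inv mulrA mulfV ?mul1r// -unitfE -unitmxE.
Qed.

End products_and_determinants.

Section polynomial_chain_rule.
Context {R : realType} {n : nat}.
Implicit Types (p q : mpoly n R) (v : R -> 'I_n -> R).

(** The derivation of the polynomial ring that sends the [i]-th variable to [Q i]. *)
Definition mpoly_derivation (Q : 'I_n -> mpoly n R) p : mpoly n R :=
  \sum_i mderiv i p * Q i.

Lemma is_derive_meval v (Q : 'I_n -> mpoly n R) (t : R) p :
  (forall i, is_derive t 1 (fun s => v s i) (meval (v t) (Q i))) ->
  is_derive t 1 (fun s => meval (v s) p) (meval (v t) (mpoly_derivation Q p)).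
Proof.
move=> hv.
pose D := mpoly_derivation Q.
have DD q r : D (q + r) = D q + D r.
  by rewrite /D /mpoly_derivation -big_split; apply: eq_bigr => i _ /=;
    rewrite mderivD mulrDl.
have DM q r : D (q * r) = D q * r + q * D r.
  rewrite /D /mpoly_derivation mulr_suml mulr_sumr -big_split; apply: eq_bigr => i _ /=.
  by rewrite mderivM mulrDl mulrAC -!mulrA.
have DC c : D (mpolyC n c) = 0.
  by rewrite /D /mpoly_derivation big1// => i _; rewrite mderivC mul0r.
pose P q := is_derive t 1 (fun s => meval (v s) q) (meval (v t) (D q)).
have PD q r : P q -> P r -> P (q + r).
  move=> hq hr; rewrite /P DD mevalD (_ : (fun s => _) =
    (fun s => meval (v s) q) + (fun s => meval (v s) r)); first exact: is_deriveD.
  by apply/funext => s; rewrite mevalD.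
have PM q r : P q -> P r -> P (q * r).
  move=> hq hr; rewrite /P DM mevalD !mevalM (_ : (fun s => _) =
    (fun s => meval (v s) q) * (fun s => meval (v s) r)).
    apply: (is_derive_eq (is_deriveM hq hr)); rewrite addrC; congr (_ + _).
    exact: mulrC.
  by apply/funext => s; rewrite mevalM.
have PC c : P (mpolyC n c).
  rewrite /P DC meval0 (_ : (fun s => _) = cst c); first exact: is_derive_cst.
  by apply/funext => s; rewrite mevalC.
have PX i : P (mpolyX R (mnm1 i)).
  rewrite /P (_ : D _ = Q i).
    rewrite (_ : (fun s => _) = fun s => v s i)//.
    by apply/funext => s; rewrite mevalXU.
  rewrite /D /mpoly_derivation (bigD1 i)//= big1 ?addr0 => [|j ji].
    rewrite mderivX mnm1E eqxx scale1r.
    have -> : mnm_sub (mnm1 i) (mnm1 i) = mnm0 by apply/mnmP => j; rewrite mnmE subnn mnm0E.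
    by rewrite mpolyX0 mul1r.
  by rewrite mderivX mnm1E eq_sym (negbTE ji) scale0r mul0r.
have P1 : P 1 by exact: (PC 1).
have PXn i k : P (mpolyX R (mnm1 i) ^+ k).
  by elim: k => [|k IH]; rewrite ?expr0// exprS; exact: PM.
have PXm m : P (mpolyX R m).
  by rewrite mpolyXE_id; elim/big_ind : _ => // i _; exact: PXn.
change (P p); elim/mpolyind: p => [|c m p _ _ IH]; first by rewrite -mpolyC0.
by apply: PD => //; rewrite -mul_mpolyC; exact: PM.
Qed.

Lemma mpoly_derivation_homog (Q : 'I_n -> mpoly n R) d p :
  (forall i, Q i \is ishomog1 2 mdeg) -> p \is ishomog1 d mdeg ->
  mpoly_derivation Q p \is ishomog1 d.+1 mdeg.
Proof.
move=> hQ /dhomogP hp; apply: rpred_sum => i _.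
have hm m : m \in msupp (mderiv i p) -> (mdeg m).+1 = d.
  rewrite mcoeff_msupp mcoeff_deriv => nz.
  have : mnm_add m (mnm1 i) \in msupp p.
    by rewrite mcoeff_msupp; apply: contraNneq nz => ->; rewrite mul0rn.
  by move=> /hp; rewrite -[X in X = _]/(mdeg (mnm_add m (mnm1 i))) mdegD mdeg1 addn1.
(* For [d = 0], [hm] leaves no monomial in the partial derivative, which is therefore 0 and
   homogeneous of any degree. *)
case: d hp hm => [|d] hp hm.
  have -> : mderiv i p = 0.
    apply/mpolyP => m; rewrite mcoeff0; apply/eqP; rewrite -[_ == _]negbK -mcoeff_msupp.
    by apply/negP => /hm.
  by rewrite mul0r dhomog0.
rewrite -addn2; apply: dhomogM => //; apply/dhomogP => m /hm [].
by [].
Qed.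

(** In characteristic 0 a zero partial derivative means that no monomial of [p] contains the
    variable: otherwise its nonzero coefficient times a positive exponent would be 0. *)
Lemma meval_mderiv0 (l : 'I_n) p (x y : 'I_n -> R) : mderiv l p = 0 ->
  (forall i, i != l -> x i = y i) -> meval x p = meval y p.
Proof.
move=> pl xy; rewrite !mevalE; apply: eq_big_seq => m mp; congr (_ * _).
have ml : m l = 0%N.
  apply/eqP; apply: contraLR mp => ml; rewrite mcoeff_msupp negbK.
  have := congr1 (mcoeff (mnm_sub m (mnm1 l))) pl.
  rewrite mcoeff0 mcoeff_deriv.
  have -> : mnm_add (mnm_sub m (mnm1 l)) (mnm1 l) = m.
    apply/mnmP => i; rewrite mnmDE mnmBE mnm1E; have [<-|_] := eqVneq l i.
      by rewrite subnK// lt0n.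
    by rewrite subn0 addn0.
  by move/eqP; rewrite mulrn_eq0.
apply: eq_bigr => i _; have [->|il] := eqVneq i l; first by rewrite ml !expr0.
by rewrite xy.
Qed.

Lemma mderiv_mpoly_derivation (Q : 'I_n -> mpoly n R) (l : 'I_n) p :
  (forall i, mderiv l (Q i) = 0) -> mderiv l p = 0 ->
  mderiv l (mpoly_derivation Q p) = 0.
Proof.
move=> hQ hp; rewrite /mpoly_derivation (big_morph _ (@mderivD _ _ l) (@mderiv0 _ _ l)) big1// => i _.
by rewrite mderivM hQ mulr0 addr0 mderiv_comm hp mderiv0 mul0r.
Qed.

End polynomial_chain_rule.

(** * Flow derivatives *)

Section gradient.
Context {R : realType} {n : nat}.
Implicit Types (h : 'rV[R]_n -> R) (A : set 'rV[R]_n).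

Definition gradient h (x : 'rV[R]_n) : 'cV[R]_n := \col_i 'D_(delta_mx 0 i) h x.

Lemma derive_gradient h x v : differentiable h x ->
  'D_v h x = (v *m gradient h x) 0 0.
Proof.
move=> dh; rewrite derive_row// mxE; apply: eq_bigr => i _.
by rewrite mxE.
Qed.

Lemma gradient_continuous h A x : C_on 1 h A -> A x ->
  {for x, continuous (gradient h)}.
Proof.
move=> [_ h2] Ax; apply/continuous_mxP => i j.
rewrite (_ : (fun x => _) = 'D_(delta_mx 0 i) h); first exact: h2.
by apply/funext => y; rewrite mxE.
Qed.

(** Since [a 0 = 0], the difference quotient of the product is that of [a] times [c s], and
    continuity of [c] suffices. *)
Lemma is_derive_mulr_small (a c : R -> R) (da : R) :
  a 0 = 0 -> is_derive (0 : R) 1 a da -> {for (0 : R), continuous c} ->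
  is_derive (0 : R) 1 (fun t => a t * c t) (da * c 0).
Proof.
move=> a0 [da1 da2] cc.
have cv : s^-1 *: (((fun t => a t * c t) \o shift (0 : R)) (s *: 1) - a 0 * c 0)
    @[s --> (0 : R)^'] --> da * c 0.
  have -> : (fun s : R => s^-1 *: (((fun t => a t * c t) \o shift (0 : R)) (s *: 1)
      - a 0 * c 0)) =
    (fun s : R => s^-1 *: ((a \o shift (0 : R)) (s *: 1) - a 0)) \* c.
    apply/funext => s /=; rewrite addr0 [s *: 1]mulr1 a0.
    by rewrite -[LHS]/(s^-1 * (a s * c s - 0 * c 0)) -[RHS]/(s^-1 * (a s - 0) * c s); ring.
  apply: cvgM; first by rewrite -da2; exact: da1.
  exact: cvg_trans (cvg_app c (@nbhs_dnbhs _ (0 : R))) cc.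
apply: DeriveDef; first by apply/cvg_ex; exists (da * c 0).
exact: cvg_lim.
Qed.

Lemma is_derive_mul_small m p (A : R -> 'M[R]_(m, n)) (e : R -> 'M[R]_(n, p)) dA :
  A 0 = 0 -> is_derive (0 : R) 1 A dA -> {for (0 : R), continuous e} ->
  is_derive (0 : R) 1 (fun t => A t *m e t) (dA *m e 0).
Proof.
move=> A0 /is_derive_mxP hA /continuous_mxP ce; apply/is_derive_mxP => i j.
have h k : is_derive (0 : R) 1 (fun t => A t i k * e t k j) (dA i k * e 0 k j).
  by apply: is_derive_mulr_small (hA i k) (ce k j); rewrite A0 mxE.
have := is_derive_bigsum h.
rewrite (_ : (fun x => _) = fun x => (A x *m e x) i j); first by rewrite mxE.
by apply/funext => t; rewrite mxE.
Qed.

(** [e] is [J e - (J - 1) e], and [is_derive_mul_small] differentiates the last product. So a curve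
    known only to be continuous turns out differentiable. *)
Lemma is_derive_mulmx_left p (J : R -> 'M[R]_n) (e : R -> 'M[R]_(n, p)) dJ dw :
  J 0 = 1%:M -> is_derive (0 : R) 1 J dJ -> {for (0 : R), continuous e} ->
  is_derive (0 : R) 1 (fun t => J t *m e t) dw ->
  is_derive (0 : R) 1 e (dw - dJ *m e 0).
Proof.
move=> J0 hJ ce hw.
have hA : is_derive (0 : R) 1 (fun t => J t - 1%:M) dJ.
  have hc : is_derive (0 : R) 1 (cst 1%:M : R -> 'M[R]_n) 0 by exact: is_derive_cst.
  by have := is_deriveB hJ hc; rewrite subr0.
have A0 : J 0 - 1%:M = 0 by rewrite J0 subrr.
have h1 := is_derive_mul_small A0 hA ce.
have := is_deriveB hw h1.
rewrite (_ : (fun t => J t *m e t) - (fun t => (J t - 1%:M) *m e t) = e)//.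
apply/funext => t; rewrite -[LHS]/(J t *m e t - (J t - 1%:M) *m e t).
by rewrite mulmxBl mul1mx opprB addrC subrK.
Qed.

End gradient.

Section flow_derivatives.
Context {R : realType} {n : nat}.
Implicit Types (b : 'rV[R]_n -> 'rV[R]_n) (A : set 'rV[R]_n) (x : 'rV[R]_n).

(** The output of [local_C1_flow]: [J t] is the space derivative of [phi t], [T] bounds time and the
    distance to [x0] alike, and the constant [C] yields joint continuity at [(0, x0)]. *)
Definition is_C1_flow b A x0 (phi : R -> 'rV[R]_n -> 'rV[R]_n)
    (J : R -> 'rV[R]_n -> 'M[R]_n) (T C : R) : Prop :=
  0 < T /\ forall x, `|x - x0| < T ->
  [/\ phi 0 x = x, J 0 x = 1%:M &
    forall t, `|t| < T ->
    [/\ A (phi t x), `|phi t x - x| <= C * `|t|,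
        is_derive t 1 (phi ^~ x) (b (phi t x)),
        is_derive t 1 (J ^~ x) (J t x *m jacobian b (phi t x)) &
    [/\ `|J t x - 1%:M| <= C * `|t|,
        differentiable (phi t) x,
        jacobian (phi t) x = J t x & {for x, continuous (J t)}]]].

Lemma near_eq_continuous (U V : normedModType R) (f g : U -> V) (y : U) :
  (\near y, f y = g y) -> {for y, continuous f} -> {for y, continuous g}.
Proof.
move=> fg cf; apply/continuous_atP => e e0.
move/continuous_atP : cf => /(_ e e0); rewrite (nbhs_singleton fg).
by apply: filterS2 fg => z ->.
Qed.

Lemma jacobianE m (f : 'rV[R]_n -> 'rV[R]_m) x i j : differentiable f x ->
  jacobian f x i j = 'D_(delta_mx 0 i) f x 0 j.
Proof. by move=> df; rewrite deriveEjacobian// -rowE [RHS]mxE. Qed.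

Lemma C_on_C1_at m (f : 'rV[R]_n -> 'rV[R]_m) A x : open A -> C_on 1 f A ->
  A x -> C1_at f x.
Proof.
move=> oA hf Ax; have [h1 h2] := hf; split; first exact: h1.
apply/continuous_mxP => i j.
have c1 : {for x, continuous (fun y => 'D_(delta_mx 0 i) f y 0 j)}.
  by have /continuous_mxP := h2 (delta_mx 0 i) x Ax; apply.
apply: near_eq_continuous c1; have := open_nbhs_nbhs (conj oA Ax).
by apply: filterS => y Ay; rewrite jacobianE//; exact: h1.
Qed.

Lemma joint_continuous (V W : normedModType R) (f : R -> V -> W) (x0 : V)
    (r L : R) : 0 < r ->
  (forall t y, `|t| < r -> `|y - x0| < r ->
    `|f t y - f 0 x0| <= L * (`|t| + `|y - x0|)) ->
  {for (0 : R, x0), continuous (fun p : R * V => f p.1 p.2)}.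
Proof.
move=> r0 H; apply/continuous_atP => e e0.
have L1 : 0 < 2 * (`|L| + 1) by rewrite mulr_gt0// ltr_wpDl.
pose d := Num.min (r / 2) (e / (2 * (`|L| + 1))).
have d0 : 0 < d by rewrite lt_min !divr_gt0.
have [dr de] : d <= r / 2 /\ d <= e / (2 * (`|L| + 1)) by rewrite !ge_min !lexx orbT.
apply/nbhs_ballP; exists d => // -[t y] [/=]; rewrite -!ball_normE /=.
rewrite sub0r normrN distrC => /ltW td /ltW yd.
rewrite distrC (le_trans (H t y _ _))//; try by move: r0 td yd dr; lra.
apply: le_trans (_ : (`|L| + 1) * (d + d) <= _).
  apply: le_trans (ler_norm _) _; rewrite normrM ler_pM ?lerDl//.
  by rewrite ger0_norm ?addr_ge0// lerD.
by move: de; rewrite ler_pdivlMr//; lra.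
Qed.

Lemma joint_continuousP (V : normedModType R) (G : R * V -> R) (x0 : V) (e : R) :
  {for (0 : R, x0), continuous G} -> 0 < e -> exists2 r : R, 0 < r &
    forall t y, `|t| <= r -> `|y - x0| <= r -> `|G (t, y) - G (0, x0)| <= e.
Proof.
move=> /continuous_atP cG /cG /nbhs_ballP[r /= r0 hr].
exists (r / 2); first by rewrite divr_gt0.
move=> t y tr yr; rewrite distrC; apply: hr; split; rewrite -ball_normE /=.
  by rewrite sub0r normrN; move: tr r0; lra.
by rewrite distrC; move: yr r0; lra.
Qed.

Lemma C1_flow_exists b A x0 : open A -> A x0 -> C_on 1 b A ->
  exists phi J T C, is_C1_flow b A x0 phi J T C.
Proof.
move=> oA Ax0 hb.
have /nbhs_ballP[r /= r0 rA] := open_nbhs_nbhs (conj oA Ax0).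
have r20 : 0 < r / 2 by rewrite divr_gt0.
have inA x : `|x - x0| <= r / 2 -> A x.
  by move=> xr; apply: rA; rewrite -ball_normE /= distrC; move: r0 xr; lra.
have hbr x : `|x - x0| <= r / 2 -> C1_at b x.
  by move=> /inA; exact: C_on_C1_at oA hb.
have [phi [J [T [C [T0 H]]]]] := local_C1_flow r20 hbr.
exists phi, J, T, C; split=> // x /H[h1 h2 h3]; split=> // t /h3[g1 g2 g3 g4 g5].
by split=> //; exact: inA.
Qed.

Section given_flow.
Variables (b : 'rV[R]_n -> 'rV[R]_n) (A : set 'rV[R]_n) (x0 : 'rV[R]_n).
Variables (phi : R -> 'rV[R]_n -> 'rV[R]_n) (J : R -> 'rV[R]_n -> 'M[R]_n) (T C : R).
Hypothesis flow : is_C1_flow b A x0 phi J T C.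

Let T0 : 0 < T. Proof. by have [] := flow. Qed.

Let x0T : `|x0 - x0| < T. Proof. by rewrite subrr normr0. Qed.

Let phi_joint : phi 0 x0 = x0 /\
  {for (0 : R, x0), continuous (fun p : R * 'rV[R]_n => phi p.1 p.2)}.
Proof.
have [_ H] := flow; have [p0 _ _] := H x0 x0T; split=> //.
apply: (joint_continuous (L := `|C| + 1) T0) => t y tT yT.
have [_ _ /(_ t tT)[_ h _ _ _]] := H y yT.
rewrite p0 -(subrKA y) (le_trans (ler_normD _ _))//.
rewrite mulrDr lerD//; last by rewrite ler_peMl// lerDr.
by rewrite (le_trans h)// ler_wpM2r// (le_trans (ler_norm C))// lerDl.
Qed.

Let J_joint : J 0 x0 = 1%:M /\
  {for (0 : R, x0), continuous (fun p : R * 'rV[R]_n => J p.1 p.2)}.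
Proof.
have [_ H] := flow; have [_ J0 _] := H x0 x0T; split=> //.
apply: (joint_continuous (L := `|C|) T0) => t y tT yT.
have [_ _ /(_ t tT)[_ _ _ _ [h _ _ _]]] := H y yT.
rewrite J0 (le_trans h)// mulrDr (le_trans (ler_wpM2r _ (ler_norm C)))//.
by rewrite lerDl mulr_ge0.
Qed.

Lemma flow_in (x : 'rV[R]_n) (t : R) : `|x - x0| < T -> `|t| < T -> A (phi t x).
Proof. by case: flow => _ H /H[_ _ h] /h []. Qed.

Lemma flow_derive (a : 'rV[R]_n -> R) (x : 'rV[R]_n) (t : R) :
  `|x - x0| < T -> `|t| < T -> differentiable a (phi t x) ->
  is_derive t 1 (fun s => a (phi s x)) ('D_(b (phi t x)) a (phi t x)).
Proof.
move=> xT tT da; have [_ /(_ x xT)[_ _ /(_ t tT)[_ _ dphi _ _]]] := flow.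
exact: (is_derive_comp1 dphi da).
Qed.

(** The gradient of [a] is only continuous and cannot be differentiated along [b] directly. But
    [a \o phi t] has the time derivative [k \o phi t] with [k] of class $C^1$, so [schwarz]
    differentiates its space gradient [J *m gradient a], and [is_derive_mulmx_left] strips off
    [J]. *)
Lemma flow_gradient (a k : 'rV[R]_n -> R) : C_on 1 a A -> C_on 1 k A ->
  (forall x, A x -> 'D_(b x) a x = k x) ->
  is_derive (0 : R) 1 (fun t => gradient a (phi t x0))
    (gradient k x0 - jacobian b x0 *m gradient a x0).
Proof.
move=> ha hk hak; have [_ H] := flow.
have [px0 cphi] := phi_joint; have [Jx0 cJ] := J_joint.
have Ax0 : A x0 by rewrite -px0; apply: flow_in; rewrite // normr0.
have Dphi (f : 'rV[R]_n -> R) t x v : C_on 1 f A -> `|x - x0| < T -> `|t| < T ->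
    derivable (fun y => f (phi t y)) x v /\
    'D_v (fun y => f (phi t y)) x = (v *m J t x *m gradient f (phi t x)) 0 0.
  move=> hf xT tT; have [_ _ /(_ t tT)[Ap _ _ _ [_ dp jp _]]] := H x xT.
  have df : differentiable f (phi t x) by have [+ _] := hf; apply.
  split; first exact: (diff_derivable (differentiable_comp dp df)).
  rewrite (derive_comp v dp df) deriveEjacobian// jp.
  exact: derive_gradient.
have dw i : is_derive (0 : R) 1
    (fun t => 'D_(delta_mx 0 i) (fun y => a (phi t y)) x0)
    ('D_(delta_mx 0 i) k x0).
  have d0 : 0 < T / 2 by rewrite divr_gt0.
  have lt2 (c : R) : `|c| <= T / 2 -> `|c| < T.
    by move=> cT; rewrite (le_lt_trans cT)//; move: T0; lra.
  have lt2' y : `|y - x0| <= T / 2 -> `|y - x0| < T.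
    by move=> cT; rewrite (le_lt_trans cT)//; move: T0; lra.
  apply: (@schwarz R _ (fun t y => a (phi t y)) (fun t y => k (phi t y)) x0
    (delta_mx 0 i) (T / 2) ('D_(delta_mx 0 i) k x0) d0).
  - move=> t y /lt2 tT /lt2' yT.
    rewrite -hak; last exact: flow_in.
    by apply: flow_derive => //; have [+ _] := ha; apply; exact: flow_in.
  - by move=> t y /lt2 tT /lt2' yT; have [] := Dphi k t y (delta_mx 0 i) hk yT tT.
  - by move=> t /lt2 tT; have [] := Dphi a t x0 (delta_mx 0 i) ha x0T tT.
  move=> e e0.
  (* The space derivative of [k \o phi t], as a product of jointly continuous factors: this gives
     the closeness to [l] that [schwarz] asks for. *)
  pose G (p : R * 'rV[R]_n) :=
    ((delta_mx 0 i : 'rV[R]_n) *m J p.1 p.2 *m gradient k (phi p.1 p.2)) 0 0.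
  have cG : {for (0 : R, x0), continuous G}.
    have : {for (0 : R, x0), continuous (fun p : R * 'rV[R]_n =>
        (delta_mx 0 i : 'rV[R]_n) *m J p.1 p.2 *m gradient k (phi p.1 p.2))}.
      apply: continuous_mulmx.
        by apply: continuous_mulmx => //; exact: cst_continuous.
      apply: (@continuous_comp _ _ _ (fun p : R * 'rV[R]_n => phi p.1 p.2) (gradient k)) => //=.
      by rewrite px0; exact: gradient_continuous hk Ax0.
    by move=> /continuous_mxP; apply.
  have G0 : G (0, x0) = 'D_(delta_mx 0 i) k x0.
    rewrite /G /= px0 Jx0 mulmx1 derive_gradient//.
    by have [+ _] := hk; apply.
  have [r r0 hr] := joint_continuousP cG e0.
  exists (Num.min r (T / 2)); first by rewrite lt_min r0.
  move=> t y; rewrite !le_min => /andP[tr /lt2 tT] /andP[yr /lt2' yT].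
  have [_ ->] := Dphi k t y (delta_mx 0 i) hk yT tT.
  by rewrite -G0; exact: hr.
have [_ _ /(_ 0 _)] := H x0 x0T; rewrite normr0 => /(_ T0)[_ _ dphi dJ _].
have ce : {for (0 : R), continuous (fun t => gradient a (phi t x0))}.
  apply: (@continuous_comp _ _ _ (fun t => phi t x0) (gradient a)).
    exact: is_derive1_continuous dphi.
  by rewrite px0; exact: gradient_continuous ha Ax0.
have dw' : is_derive (0 : R) 1 (fun t => J t x0 *m gradient a (phi t x0)) (gradient k x0).
  apply/is_derive_mxP => i j; rewrite mxE.
  apply: near_eq_is_derive (dw i).
  have : \forall t \near (0 : R), `|t| < T by apply: nbhs0_lt.
  apply: filterS => t tT; have [_ ->] := Dphi a t x0 (delta_mx 0 i) ha x0T tT.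
  by rewrite -mulmxA -rowE [LHS]mxE (ord1 j).
have := is_derive_mulmx_left Jx0 dJ ce dw'.
by rewrite px0 Jx0 mul1mx.
Qed.

End given_flow.
End flow_derivatives.

Section vector_valued.
Context {R : realType}.

Lemma is_derive_scale (U : normedModType R) m n (k : U -> R)
    (f : U -> 'M[R]_(m, n)) (x v : U) dk df :
  is_derive x v k dk -> is_derive x v f df ->
  is_derive x v (fun y => k y *: f y) (dk *: f x + k x *: df).
Proof.
move=> hk /is_derive_mxP hf; apply/is_derive_mxP => i j.
rewrite (_ : (fun y => _) = k * (fun y => f y i j)); last first.
  by apply/funext => y; rewrite mxE.
apply: (is_derive_eq (is_deriveM hk (hf i j))).
by rewrite !mxE addrC; congr (_ + _); exact: mulrC.
Qed.

Lemma deriveBv (U V : normedModType R) (f : U -> V) (x u v : U) :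
  differentiable f x -> 'D_(u - v) f x = 'D_u f x - 'D_v f x.
Proof. by move=> df; rewrite !deriveE// linearB. Qed.

Lemma C_on_row (U : normedModType R) n k (f : U -> 'rV[R]_n) (A : set U) : open A ->
  (forall j, C_on k (fun x => f x 0 j) A) -> C_on k f A.
Proof.
move=> oA; elim: k f => [|k IH] f hf.
  move=> x Ax; apply/continuous_mxP => i j; rewrite (ord1 i); exact: hf.
have df x : A x -> differentiable f x.
  move=> Ax.
  rewrite (_ : f = \sum_j (fun y => f y 0 j *: (delta_mx 0 j : 'rV[R]_n))).
    apply: differentiable_sum => j; apply: differentiableZl.
    by have [+ _] := hf j; apply.
  by apply/funext => y; rewrite fct_sumE -row_sum_delta.
split=> // v; apply: IH => j; have [_ /(_ v)] := hf j.
apply: C_on_ext => // x Ax; rewrite derive_mx ?mxE//.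
exact/diff_derivable/df.
Qed.

End vector_valued.

Section real_derivatives.
Context {R : realType}.

Lemma is_derive_abs (f : R -> R) (t df : R) : f t != 0 -> is_derive t 1 f df ->
  is_derive t 1 (fun s => `|f s|) (Num.sg (f t) * df).
Proof.
move=> f0 hf.
have cf : {for t, continuous f} := is_derive1_continuous hf.
have h := is_deriveZ (Num.sg (f t)) hf.
apply: near_eq_is_derive h.
have f0' : 0 < `|f t| by rewrite normr_gt0.
have /continuous_atP := cf => /(_ (`|f t| / 2)); rewrite divr_gt0// => /(_ isT).
apply: filterS => s hs; rewrite -[LHS]/(Num.sg (f t) * f s).
move: hs f0'; have [ft|ft|ft0] := ltrgt0P (f t).
- by rewrite gtr0_sg// mul1r ler_norml => /andP[h1 h2] _; rewrite ger0_norm//; lra.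
- by rewrite ltr0_sg// mulN1r ler_norml => /andP[h1 h2] _; rewrite ler0_norm//; lra.
- by rewrite ft0 eqxx in f0.
Qed.

Lemma is_derive_inv (f : R -> R) (t df : R) : f t != 0 -> is_derive t 1 f df ->
  is_derive t 1 (fun s => (f s)^-1) (- (f t) ^- 2 * df).
Proof.
move=> f0 [hf1 hf2]; apply: DeriveDef; first exact: derivableV.
by rewrite deriveV// hf2.
Qed.

End real_derivatives.

(** * The gradient flow in a frame of R^n *)

Section frame.
Context {R : realType} {n : nat}.
Variables (A : set 'rV[R]_n) (b : 'I_n -> 'rV[R]_n -> 'rV[R]_n).
Variables (c : 'I_n -> 'I_n -> 'I_n -> R) (g : 'I_n -> 'I_n -> R) (h : 'rV[R]_n -> R).
Hypothesis oA : open A.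
Hypothesis b_C1 : forall i, C_on 1 (b i) A.
Hypothesis bracket : forall i j x, A x ->
  'D_(b i x) (b j) x - 'D_(b j x) (b i) x = \sum_l c i j l *: b l x.
Hypothesis h_C2 : C_on 2 h A.
Hypothesis g_sym : forall i j, g i j = g j i.

(** For a frame $Y$ read in a chart, this and the next three are $Y_i h$, $Y_i Y_j h$, the
    components $w_j$ of the gradient of $h$ in the frame, and the gradient itself. *)
Definition fderiv i x : R := 'D_(b i x) h x.
Definition fderiv2 i j x : R := 'D_(b i x) (fderiv j) x.
Definition fcoef j x : R := \sum_i g i j * fderiv i x.
Definition ffield x : 'rV[R]_n := \sum_j fcoef j x *: b j x.

Local Notation a := fderiv.
Local Notation H := fderiv2.
Local Notation w := fcoef.
Local Notation z := ffield.

Hypothesis eikonal : forall x, A x -> \sum_i \sum_j g i j * a i x * a j x = 1.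

Let dh x : A x -> differentiable h x. Proof. by have [+ _] := h_C2; apply. Qed.

Let db i x : A x -> differentiable (b i) x. Proof. by have [+ _] := b_C1 i; apply. Qed.

Lemma fderiv_C1 i : C_on 1 (a i) A.
Proof.
apply: (C_on_ext (f := fun x => \sum_k b i x 0 k * 'D_(delta_mx 0 k) h x)) => //.
  by move=> x Ax; rewrite /a derive_row//; exact: dh.
apply: C_on_sum => // k _; apply: C_on_mul => //.
  exact: (C_on_coord 0 k oA (b_C1 i)).
by have [_] := h_C2; apply.
Qed.

Let da i x : A x -> differentiable (a i) x.
Proof. by have [+ _] := fderiv_C1 i; apply. Qed.

(** Product rule for $\sum_k b_{ik} D_k h$; the symmetry of second derivatives then lets [b i x] be
    the outer direction in the second-order term. *)
Lemma fderiv_derive i v x : A x ->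
  'D_v (a i) x = 'D_('D_v (b i) x) h x + 'D_(b i x) ('D_v h) x.
Proof.
move=> Ax.
have dDh u : differentiable ('D_u h) x.
  by have [_ /(_ u)[+ _]] := h_C2; apply.
have h1 k : is_derive x v (fun y => b i y 0 k * 'D_(delta_mx 0 k) h y)
    (b i x 0 k * 'D_v ('D_(delta_mx 0 k) h) x +
     'D_(delta_mx 0 k) h x * 'D_v (b i) x 0 k).
  have db1 : derivable (b i) x v by exact/diff_derivable/db.
  have e1 : is_derive x v (fun y => b i y 0 k) ('D_v (b i) x 0 k).
    by have /is_derive_mxP := derivableP db1; apply.
  have e2 : is_derive x v ('D_(delta_mx 0 k) h) ('D_v ('D_(delta_mx 0 k) h) x).
    exact/derivableP/diff_derivable.
  exact: is_deriveM.
have h2 := is_derive_bigsum h1.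
have h3 : is_derive x v (a i) (\sum_k (b i x 0 k * 'D_v ('D_(delta_mx 0 k) h) x +
     'D_(delta_mx 0 k) h x * 'D_v (b i) x 0 k)).
  apply: near_eq_is_derive h2; have := open_nbhs_nbhs (conj oA Ax).
  by apply: filterS => y Ay; rewrite /a derive_row//; exact: dh.
have [_ ->] := h3; rewrite big_split [RHS]addrC; congr (_ + _).
  rewrite [RHS](derive_row _ (dDh v)); apply: eq_bigr => k _.
  by rewrite (derive_sym (delta_mx 0 k) v oA Ax h_C2).
by rewrite [RHS](derive_row _ (dh Ax)); apply: eq_bigr => k _; rewrite mulrC.
Qed.

(** The second derivatives of [h] along two fixed vectors cancel by symmetry; the derivative along
    the bracket remains. *)
Lemma fderiv2_comm i j x : A x -> H i j x = H j i x + \sum_l c i j l * a l x.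
Proof.
move=> Ax; rewrite /H (fderiv_derive _ _ Ax) (fderiv_derive _ _ Ax).
rewrite (derive_sym (b j x) (b i x) oA Ax h_C2) addrAC; congr (_ + _).
have -> : \sum_l c i j l * a l x =
    'D_('D_(b i x) (b j) x - 'D_(b j x) (b i) x) h x.
  rewrite bracket// (derive_sumv _ _ _ (dh Ax)); apply: eq_bigr => l _.
  by rewrite (deriveZv _ _ (dh Ax)).
by rewrite -(deriveDv _ _ (dh Ax)) addrC subrK.
Qed.

Lemma is_derive_fderiv i v x : A x -> is_derive x v (a i) ('D_v (a i) x).
Proof. by move=> Ax; apply/derivableP/diff_derivable/da. Qed.

Lemma is_derive_fcoef j v x : A x ->
  is_derive x v (w j) (\sum_i g i j * 'D_v (a i) x).
Proof.
move=> Ax; apply: is_derive_bigsum => i.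
exact: (is_deriveZ (g i j) (is_derive_fderiv i v Ax)).
Qed.

Lemma fcoef_C1 j : C_on 1 (w j) A.
Proof.
apply: C_on_sum => // i _; apply: C_on_mul => //; first exact: C_on_cst.
exact: fderiv_C1.
Qed.

Lemma ffield_C1 : C_on 1 z A.
Proof.
apply: C_on_row => // k.
apply: (C_on_ext (f := fun x => \sum_j w j x * b j x 0 k)) => //.
  by move=> x _; rewrite summxE; apply: eq_bigr => j _; rewrite mxE.
apply: C_on_sum => // j _; apply: C_on_mul => //; first exact: fcoef_C1.
exact: (C_on_coord 0 k oA (b_C1 j)).
Qed.

Lemma derive_ffield (V : normedModType R) (f : 'rV[R]_n -> V) x :
  differentiable f x -> 'D_(z x) f x = \sum_j w j x *: 'D_(b j x) f x.
Proof.
by move=> df; rewrite derive_sumv//; apply: eq_bigr => j _; rewrite deriveZv.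
Qed.

Lemma ffield_eikonal x : A x -> 'D_(z x) h x = 1.
Proof.
move=> Ax; rewrite (derive_ffield (dh Ax)) -(eikonal Ax) exchange_big.
apply: eq_bigr => j _; rewrite -[LHS]/(w j x * a j x) /w mulr_suml.
by apply: eq_bigr.
Qed.

(** Derivative of the eikonal equation along [b i]; the symmetry of [g] makes the two halves of the
    product rule equal. *)
Lemma fcoef_fderiv2 i x : A x -> \sum_j w j x * H i j x = 0.
Proof.
move=> Ax.
have h1 j k : is_derive x (b i x) (fun y => g j k * a j y * a k y)
    (g j k * a j x * H i k x + a k x * (g j k * H i j x)).
  have e1 := is_deriveZ (g j k) (is_derive_fderiv j (b i x) Ax).
  exact: (is_deriveM e1 (is_derive_fderiv k (b i x) Ax)).
have h2 := is_derive_bigsum (fun j => is_derive_bigsum (h1 j)).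
have h3 : is_derive x (b i x) (fun y => \sum_j \sum_k g j k * a j y * a k y) 0.
  apply: near_eq_is_derive (is_derive_cst (1 : R) x (b i x)).
  have := open_nbhs_nbhs (conj oA Ax).
  by apply: filterS => y Ay; rewrite eikonal.
have [_ e2] := h2; have [_ e3] := h3.
move: e2; rewrite e3 => e2.
have e4 : \sum_j \sum_k (g j k * a j x * H i k x + a k x * (g j k * H i j x)) =
   2 * \sum_j w j x * H i j x.
  have -> : 2 * (\sum_j w j x * H i j x) = (\sum_j w j x * H i j x) + (\sum_j w j x * H i j x).
    by rewrite mulr_natl mulr2n.
  under eq_bigr do rewrite big_split.
  rewrite big_split; congr (_ + _).
    rewrite exchange_big; apply: eq_bigr => k _ /=; rewrite /w mulr_suml.
    by apply: eq_bigr => j _.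
  apply: eq_bigr => j _ /=; rewrite /w mulr_suml.
  by apply: eq_bigr => k _; rewrite [in RHS]g_sym mulrCA mulrA.
move: e2; rewrite e4 => /esym/eqP; rewrite mulf_eq0 pnatr_eq0 /= => /eqP //.
Qed.

Definition fquad l x : R := \sum_j \sum_k w j x * c j l k * a k x.

(** The derivative along the gradient is $\sum_j w_j Y_j Y_l h$, while [fcoef_fderiv2] kills $\sum_j
    w_j Y_l Y_j h$. The commutators between them are of first order, so no second derivative
    survives and the result is again of class $C^1$. *)
Lemma ffield_fderiv l x : A x -> 'D_(z x) (a l) x = fquad l x.
Proof.
move=> Ax; rewrite (derive_ffield (da l Ax)).
have -> : \sum_j w j x *: 'D_(b j x) (a l) x =
    \sum_j w j x * H l j x + fquad l x.
  rewrite -big_split; apply: eq_bigr => j _ /=.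
  rewrite -[LHS]/(w j x * H j l x) (fderiv2_comm j l Ax) mulrDr mulr_sumr.
  by congr (_ + _); apply: eq_bigr => k _; rewrite mulrA.
by rewrite fcoef_fderiv2// add0r.
Qed.

Lemma fquad_C1 l : C_on 1 (fquad l) A.
Proof.
apply: C_on_sum => // j _; apply: C_on_sum => // k _.
apply: C_on_mul => //; last exact: fderiv_C1.
by apply: C_on_mul => //; [exact: fcoef_C1|exact: C_on_cst].
Qed.

(** The derivative of [fcoef j] along [b i]. *)
Definition fW i j x : R := \sum_k g k j * H i k x.

Lemma fquad_derive i l x : A x -> 'D_(b i x) (fquad l) x =
  \sum_j \sum_k (w j x * c j l k * H i k x + a k x * (fW i j x * c j l k)).
Proof.
move=> Ax.
have h1 j k : is_derive x (b i x) (fun y => w j y * c j l k * a k y)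
    (w j x * c j l k * H i k x + a k x * (fW i j x * c j l k)).
  have e0 := is_deriveZ (c j l k) (is_derive_fcoef j (b i x) Ax).
  have e1 : is_derive x (b i x) (fun y => w j y * c j l k) (fW i j x * c j l k).
    rewrite (_ : (fun y => _) = c j l k *: w j); last first.
      by apply/funext => y; rewrite mulrC.
    by apply: (is_derive_eq e0); rewrite mulrC.
  exact: (is_deriveM e1 (is_derive_fderiv k (b i x) Ax)).
by have [_ ->] := is_derive_bigsum (fun j => is_derive_bigsum (h1 j)).
Qed.

(** Leibniz rule for the bracket of the gradient with a frame field: one sum comes from the
    structure constants, the other from the coefficients of the gradient. *)
Lemma ffield_bracket i x : A x -> 'D_(z x) (b i) x - 'D_(b i x) z x =
  \sum_j w j x *: (\sum_k c j i k *: b k x) - \sum_j fW i j x *: b j x.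
Proof.
move=> Ax; rewrite (derive_ffield (db i Ax)).
have h1 j : is_derive x (b i x) (fun y => w j y *: b j y)
    (fW i j x *: b j x + w j x *: 'D_(b i x) (b j) x).
  apply: is_derive_scale; first exact: is_derive_fcoef.
  exact/derivableP/diff_derivable/db.
have [_ ->] := is_derive_bigsum h1.
rewrite big_split /= opprD addrCA addrC; congr (_ - _).
rewrite -sumrB; apply: eq_bigr => j _.
by rewrite -scalerBr bracket.
Qed.

Section along_flow.
Variables (x0 : 'rV[R]_n) (phi : R -> 'rV[R]_n -> 'rV[R]_n)
  (J : R -> 'rV[R]_n -> 'M[R]_n) (T C : R).
Hypothesis Ax0 : A x0.
Hypothesis flow : is_C1_flow z A x0 phi J T C.

Let T0 : 0 < T. Proof. by have [] := flow. Qed.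

Let x0T : `|x0 - x0| < T. Proof. by rewrite subrr normr0. Qed.

Let OT : `|0 : R| < T. Proof. by rewrite normr0. Qed.

Let phi0 : phi 0 x0 = x0.
Proof. by have [_ /(_ x0 x0T)[]] := flow. Qed.

Let J0 : J 0 x0 = 1%:M.
Proof. by have [_ /(_ x0 x0T)[]] := flow. Qed.

Let dphi : is_derive (0 : R) 1 (phi ^~ x0) (z x0).
Proof. by have [_ /(_ x0 x0T)[_ _ /(_ 0 OT)[_ _ + _ _]]] := flow; rewrite phi0. Qed.

Let dJ : is_derive (0 : R) 1 (J ^~ x0) (jacobian z x0).
Proof.
have [_ /(_ x0 x0T)[_ _ /(_ 0 OT)[_ _ _ + _]]] := flow.
by rewrite phi0 J0 mul1mx.
Qed.

Let dz : differentiable z x0. Proof. by have [+ _] := ffield_C1; apply. Qed.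

Lemma flow_h : is_derive (0 : R) 1 (fun t => h (phi t x0)) 1.
Proof.
have := is_derive_comp1 dphi (f := h); rewrite phi0 (ffield_eikonal Ax0); apply.
exact: dh.
Qed.

Lemma flow_fderiv l : is_derive (0 : R) 1 (fun t => a l (phi t x0)) (fquad l x0).
Proof.
have := is_derive_comp1 dphi (f := a l); rewrite phi0 (ffield_fderiv l Ax0); apply.
exact: da.
Qed.

(** This is $Z Y_i Y_l h = Y_i (Z Y_l h) + [Z, Y_i] Y_l h$, without third derivatives of $h$:
    [fderiv2 i l] is the product of [b i] with the gradient of [fderiv l], which [flow_gradient]
    differentiates along the flow. *)
Lemma flow_fderiv2 i l : is_derive (0 : R) 1 (fun t => H i l (phi t x0))
  (\sum_j \sum_k (w j x0 * c j l k * H i k x0 + a k x0 * (fW i j x0 * c j l k)) +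
   \sum_j w j x0 * (\sum_k c j i k * H k l x0) - \sum_j fW i j x0 * H j l x0).
Proof.
have h1 : is_derive (0 : R) 1 (fun t => b i (phi t x0)) ('D_(z x0) (b i) x0).
  have := is_derive_comp1 dphi (f := b i); rewrite phi0; apply; exact: db.
have h2 := flow_gradient flow (fderiv_C1 l) (fquad_C1 l) (ffield_fderiv l).
have /is_derive_mxP/(_ 0 0) h3 := is_derive_mulmx h1 h2.
have hE : \forall t \near (0 : R),
    (b i (phi t x0) *m gradient (a l) (phi t x0)) 0 0 = H i l (phi t x0).
  have : \forall t \near (0 : R), `|t| < T by apply: nbhs0_lt.
  apply: filterS => t tT; rewrite -derive_gradient//.
  by apply: da; exact: (flow_in flow x0T tT).
apply: (is_derive_eq (near_eq_is_derive hE h3)).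
(* The [jacobian z] term of [flow_gradient] joins the derivative of [b i] to form the bracket of [z]
   with [b i]. *)
rewrite phi0 mulmxBr mulmxA -deriveEjacobian// addrCA -mulmxBl mxE.
rewrite -[X in X + _ = _](derive_gradient (h := fquad l)); last first.
  by have [+ _] := fquad_C1 l; apply.
rewrite -derive_gradient; last exact: da.
rewrite fquad_derive// ffield_bracket// -addrA; congr (_ + _).
rewrite (deriveBv _ _ (da l Ax0)); congr (_ - _).
  rewrite (derive_sumv _ _ _ (da l Ax0)); apply: eq_bigr => j _.
  rewrite (deriveZv _ _ (da l Ax0)) (derive_sumv _ _ _ (da l Ax0)).
  rewrite -[LHS]/(w j x0 * _); congr (_ * _); apply: eq_bigr => k _.
  exact: (deriveZv _ _ (da l Ax0)).
rewrite (derive_sumv _ _ _ (da l Ax0)); apply: eq_bigr => j _.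
exact: (deriveZv _ _ (da l Ax0)).
Qed.

Definition frame_mx x : 'M[R]_n := \matrix_i b i x.

(** The divergence of the gradient for the density equal to 1 on the frame: $\sum_i Y_i w_i$ plus
    the $w_j$ times the divergences of the $Y_j$, which are $-\sum_i c_{jii}$. *)
Definition fdiv x : R := \sum_i (fW i i x - \sum_j w j x * c j i i).

(** The inverse of [|\det (frame_mx x)|] is the coordinate expression of the density equal to 1 on
    the frame, and the quotient is its pullback by the flow. By Jacobi's formula the logarithmic
    derivative is the trace of [jacobian z] minus that of [invmx B *m dB]. *)
Lemma flow_det : frame_mx x0 \in unitmx ->
  is_derive (0 : R) 1
    (fun t => `|\det (J t x0)| / `|\det (frame_mx (phi t x0))|)
    (fdiv x0 / `|\det (frame_mx x0)|).
Proof.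
move=> uB; pose B x := frame_mx x; pose dB : 'M[R]_n := \matrix_i 'D_(z x0) (b i) x0.
have hB : is_derive (0 : R) 1 (fun t => B (phi t x0)) dB.
  apply/is_derive_mxP => i k.
  have h1 : is_derive (0 : R) 1 (fun t => b i (phi t x0)) ('D_(z x0) (b i) x0).
    have := is_derive_comp1 dphi (f := b i); rewrite phi0; apply; exact: db.
  have /is_derive_mxP/(_ 0 k) := h1; rewrite mxE.
  by rewrite (_ : (fun x => b i (phi x x0) 0 k) = fun x => B (phi x x0) i k)//;
    apply/funext => t; rewrite mxE.
have hdJ := is_derive_det1 J0 dJ.
have uB0 : B (phi 0 x0) \in unitmx by rewrite phi0.
have hdB := is_derive_det uB0 hB.
have dB0 : \det (B x0) != 0 by move: uB; rewrite unitmxE unitfE.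
have dJ1 : \det (J 0 x0) != 0 by rewrite J0 det1 oner_neq0.
have dB0' : \det (B (phi 0 x0)) != 0 by rewrite phi0.
have hJ' := is_derive_abs (f := fun t => \det (J t x0)) dJ1 hdJ.
have hB' := is_derive_abs (f := fun t => \det (B (phi t x0))) dB0' hdB.
have nB0 : `|\det (B (phi 0 x0))| != 0 by rewrite normr_eq0.
have hV := is_derive_inv (f := fun t => `|\det (B (phi t x0))|) nB0 hB'.
have hM := is_deriveM hJ' hV.
apply: (is_derive_eq hM).
rewrite J0 det1 phi0 normr1 sgr1 mul1r.
have key : \tr (jacobian z x0) - \tr (invmx (B x0) *m dB) = fdiv x0.
  pose K : 'M[R]_n := \matrix_(i, k) (\sum_j w j x0 * c j i k - fW i k x0).
  (* Row [i] is [ffield_bracket]: [K] is the matrix, in the frame, of the brackets of the gradient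
     with the [b i]. Conjugation by [B x0] preserves its trace. *)
  have e : B x0 *m jacobian z x0 = dB - K *m B x0.
    apply/row_matrixP => i; rewrite row_mul rowK -deriveEjacobian//.
    rewrite linearB /= row_mul rowK; apply/eqP; rewrite eq_sym subr_eq addrC -subr_eq.
    rewrite ffield_bracket//; apply/eqP; rewrite mulmx_sum_row.
    under [RHS]eq_bigr do rewrite rowK !mxE scalerBl.
    rewrite [RHS]big_split /= sumrN; congr (_ - _).
    under [LHS]eq_bigr do rewrite scaler_sumr.
    rewrite exchange_big; apply: eq_bigr => k _ /=; rewrite scaler_suml.
    by apply: eq_bigr => j _; rewrite scalerA.
  have -> : jacobian z x0 = invmx (B x0) *m (dB - K *m B x0).
    by rewrite -e mulKmx.
  rewrite mulmxBr linearB /= addrAC subrr sub0r mxtrace_mulC -mulmxA mulmxV//.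
  rewrite mulmx1 /mxtrace -sumrN /fdiv; apply: eq_bigr => i _.
  by rewrite mxE opprB.
rewrite -key -/(B x0) [in LHS]mulrA.
have sgE : Num.sg (\det (B x0)) * \det (B x0) = `|\det (B x0)| by rewrite normrEsg.
rewrite /GRing.scale /= mul1r.
move: sgE; set s := Num.sg _; set d := \det (B x0); set v := `|d|.
move=> sgE.
have v0 : v != 0 by rewrite normr_eq0.
transitivity (- (v ^- 2) * ((s * d) * \tr (invmx (B x0) *m dB)) + v^-1 * \tr (jacobian z x0)).
  by ring.
rewrite sgE; field; exact: v0.
Qed.

End along_flow.
End frame.

(** * Charts *)

Local Opaque jacobian derive.

Section charts.
Context {R : realType} {n : nat} {M : smooth_manifold R n}.
Implicit Types (p q r s : M).

Definition chart_image p : set 'rV[R]_n := chart_at p @` cdom (chart_at p).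

Lemma chart_image_open p : open (chart_image p).
Proof. exact: cimg_open. Qed.

Lemma mem_chart_image p q : cdom (chart_at p) q -> chart_image p (chart_at p q).
Proof. by move=> pq; exists q. Qed.

Lemma ccoord_image p : chart_image p (ccoord p).
Proof. exact/mem_chart_image/mem_chart_at. Qed.

Lemma point_atK p x : chart_image p x ->
  cdom (chart_at p) (point_at p x) /\ chart_at p (point_at p x) = x.
Proof. by move=> [q pq <-]; rewrite /point_at cmapK. Qed.

Lemma chart_atK p q : cdom (chart_at p) q -> point_at p (chart_at p q) = q.
Proof. exact: cmapK. Qed.

Lemma ccoordK p : point_at p (ccoord p) = p.
Proof. exact/chart_atK/mem_chart_at. Qed.

Lemma point_at_continuous p x : chart_image p x -> {for x, continuous (point_at p)}.
Proof. by move=> [q pq <-]; exact: cinv_continuous. Qed.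

Lemma near_cdom p q : cdom (chart_at p) q -> \forall r \near q, cdom (chart_at p) r.
Proof. by move=> pq; apply: open_nbhs_nbhs; split=> //; exact: cdom_open. Qed.

Lemma near_point_at p q (P : set M) : cdom (chart_at p) q ->
  (\forall r \near q, P r) -> \forall x \near chart_at p q, P (point_at p x).
Proof.
move=> pq Pq; have c := point_at_continuous (mem_chart_image pq).
by apply: c; rewrite chart_atK.
Qed.

Lemma near_chart_image p q : cdom (chart_at p) q ->
  \forall x \near chart_at p q, chart_image p x.
Proof.
by move=> pq; apply: open_nbhs_nbhs; split; [exact: chart_image_open|exists q].
Qed.

Lemma C_near_differentiable (U V : normedModType R) k (f : U -> V) x :
  C_near k.+1 f x -> \forall y \near x, differentiable f y.
Proof.
move=> [A [oA Ax [h1 _]]]; have := open_nbhs_nbhs (conj oA Ax).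
by apply: filterS => y; exact: h1.
Qed.

Lemma chart_trans_differentiable p q r : cdom (chart_at p) r -> cdom (chart_at q) r ->
  differentiable (chart_trans p q) (chart_at p r).
Proof.
move=> pr qr; have := chart_smooth pr qr 1.
by move=> /C_near_differentiable /nbhs_singleton.
Qed.

Lemma jacobian_comp m1 m2 m3 (f : 'rV[R]_m1 -> 'rV[R]_m2) (g : 'rV[R]_m2 -> 'rV[R]_m3) x :
  differentiable f x -> differentiable g (f x) ->
  jacobian (g \o f) x = jacobian f x *m jacobian g (f x).
Proof.
move=> df dg; apply/row_matrixP => i; rewrite row_mul !rowE.
rewrite -(deriveEjacobian _ (differentiable_comp df dg)) -(deriveEjacobian _ df).
by rewrite -(deriveEjacobian _ dg) (derive_comp _ df dg).
Qed.

Lemma near_eq_jacobian m1 m2 (f g : 'rV[R]_m1 -> 'rV[R]_m2) x :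
  (\near x, f x = g x) -> differentiable f x -> jacobian f x = jacobian g x.
Proof.
move=> fg df; have dg := near_eq_differentiable fg df.
have e (v : 'rV[R]_m1) : v *m jacobian f x = v *m jacobian g x.
  have e1 := deriveEjacobian v df.
  have e2 := deriveEjacobian v dg.
  have e3 : 'D_v f x = 'D_v g x by exact: near_eq_derive.
  exact: (etrans (esym e1) (etrans e3 e2)).
apply/row_matrixP => i.
rewrite [LHS]rowE [RHS]rowE; exact: e.
Qed.

Lemma chart_trans_cocycle p q s r : cdom (chart_at p) r -> cdom (chart_at q) r ->
  cdom (chart_at s) r ->
  jacobian (chart_trans p q) (chart_at p r) *m jacobian (chart_trans q s) (chart_at q r)
  = jacobian (chart_trans p s) (chart_at p r).
Proof.
move=> pr qr sr.
have d1 := chart_trans_differentiable pr qr.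
have d2 := chart_trans_differentiable qr sr.
have e : chart_trans p q (chart_at p r) = chart_at q r by rewrite /chart_trans /= chart_atK.
have d2' : differentiable (chart_trans q s) (chart_trans p q (chart_at p r)) by rewrite e.
have j := jacobian_comp d1 d2'; rewrite e in j.
apply: (etrans (esym j)); apply: near_eq_jacobian; last exact: differentiable_comp.
apply: filterS (near_point_at pr (near_cdom qr)) => x qx.
by rewrite /chart_trans /= chart_atK.
Qed.

Lemma chart_trans_id p r : cdom (chart_at p) r ->
  jacobian (chart_trans p p) (chart_at p r) = 1%:M.
Proof.
move=> pr; have d1 := chart_trans_differentiable pr pr.
have e : jacobian (chart_trans p p) (chart_at p r) = jacobian (id : 'rV[R]_n -> _) (chart_at p r).
  apply: near_eq_jacobian => //.
  apply: filterS (near_chart_image pr) => x px.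
  by rewrite /chart_trans /= (point_atK px).2.
rewrite e; apply/row_matrixP => i.
have did : differentiable (id : 'rV[R]_n -> _) (chart_at p r) by [].
by rewrite !rowE -(deriveEjacobian _ did) derive_id mulmx1.
Qed.

Lemma chart_transK p q r : cdom (chart_at p) r -> cdom (chart_at q) r ->
  jacobian (chart_trans p q) (chart_at p r) *m jacobian (chart_trans q p) (chart_at q r) = 1%:M.
Proof. by move=> pr qr; rewrite chart_trans_cocycle// chart_trans_id. Qed.

Lemma rep_chart_trans (W : Type) (f : M -> W) p q : cdom (chart_at p) q ->
  \forall x \near ccoord q, (f \o point_at q) x = ((f \o point_at p) \o chart_trans q p) x.
Proof.
move=> pq; apply: filterS (near_point_at (mem_chart_at q) (near_cdom pq)) => x px.
by rewrite /chart_trans /= chart_atK.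
Qed.

Lemma vder_chart (f : M -> R) p q (v : 'rV[R]_n) : cdom (chart_at p) q ->
  differentiable (f \o point_at p) (chart_at p q) ->
  vder f q v = 'D_(v *m jacobian (chart_trans q p) (ccoord q)) (f \o point_at p) (chart_at p q).
Proof.
move=> pq df; rewrite /vder (near_eq_derive v (rep_chart_trans f pq)).
have d1 := chart_trans_differentiable (mem_chart_at q) pq.
have e : chart_trans q p (ccoord q) = chart_at p q by rewrite /chart_trans /= ccoordK.
have df' : differentiable (f \o point_at p) (chart_trans q p (ccoord q)) by rewrite e.
by rewrite (derive_comp _ d1 df') e (deriveEjacobian _ d1).
Qed.

Lemma vapp_chart (X : vfield M) (f : M -> R) p q : cdom (chart_at p) q ->
  differentiable (f \o point_at p) (chart_at p q) ->
  vapp X f q = 'D_(vcoord p X q) (f \o point_at p) (chart_at p q).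
Proof. exact: vder_chart. Qed.

Lemma near_eq_vapp (X : vfield M) (f g : M -> R) q :
  (\forall r \near q, f r = g r) -> vapp X f q = vapp X g q.
Proof.
move=> fg; apply: near_eq_derive.
by apply: (near_point_at (P := fun r => f r = g r) (mem_chart_at q)).
Qed.

Lemma vapp_lin (I : finType) (X : vfield M) (Y : I -> vfield M) (k : I -> R)
    (f : M -> R) q : X q = \sum_i k i *: Y i q ->
  differentiable (f \o point_at q) (ccoord q) ->
  vapp X f q = \sum_i k i * vapp (Y i) f q.
Proof.
move=> XE df; rewrite /vapp /vder XE derive_sumv//; apply: eq_bigr => i _.
by rewrite deriveZv.
Qed.

End charts.

Section product_injections.
Context {R : realType} {U V : normedModType R}.

(** Named and made linear for [C_on_affine]: freezing a variable is composing with a translate of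
    [inject1] or [inject2]. *)
Definition inject1 (u : U) : U * V := (u, 0).
Definition inject2 (v : V) : U * V := (0, v).

Fact inject1_linear : linear inject1.
Proof. by move=> a u v; congr pair; rewrite /= scaler0 addr0. Qed.

Fact inject2_linear : linear inject2.
Proof. by move=> a u v; congr pair; rewrite /= scaler0 addr0. Qed.

HB.instance Definition _ := GRing.isLinear.Build R U (U * V)%type *:%R inject1 inject1_linear.
HB.instance Definition _ := GRing.isLinear.Build R V (U * V)%type *:%R inject2 inject2_linear.

Lemma inject1_continuous : continuous inject1.
Proof. by move=> u; apply: cvg_pair; [exact: cvg_id|exact: cvg_cst]. Qed.

Lemma inject2_continuous : continuous inject2.
Proof. by move=> u; apply: cvg_pair; [exact: cvg_cst|exact: cvg_id]. Qed.

Lemma C_on_slice1 (W : normedModType R) k (f : U * V -> W) A (v : V) : open A ->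
  C_on k f A -> C_on k (fun u => f (u, v)) [set u | A (u, v)].
Proof.
move=> oA /(C_on_affine (l := inject1) (0, v) inject1_continuous oA).
have e u : (0, v) + inject1 u = (u, v) by congr pair; rewrite /= ?add0r ?addr0.
rewrite (_ : (fun x => f _) = fun u => f (u, v)); last by apply/funext => u; rewrite e.
by rewrite (_ : [set x | A _] = [set u | A (u, v)])//; apply/funext => u /=; rewrite e.
Qed.

Lemma C_on_slice2 (W : normedModType R) k (f : U * V -> W) A (u : U) : open A ->
  C_on k f A -> C_on k (fun v => f (u, v)) [set v | A (u, v)].
Proof.
move=> oA /(C_on_affine (l := inject2) (u, 0) inject2_continuous oA).
have e v : (u, 0) + inject2 v = (u, v) by congr pair; rewrite /= ?add0r ?addr0.
rewrite (_ : (fun x => f _) = fun v => f (u, v)); last by apply/funext => v; rewrite e.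
by rewrite (_ : [set x | A _] = [set v | A (u, v)])//; apply/funext => v /=; rewrite e.
Qed.

Lemma derive_slice2 (W : normedModType R) (f : U * V -> W) (u : U) (v w : V) :
  differentiable f (u, v) -> 'D_w (fun v => f (u, v)) v = 'D_(0, w) f (u, v).
Proof.
move=> df; pose l v' := (u, 0) + inject2 v'.
have e v' : l v' = (u, v') by congr pair; rewrite /= ?add0r ?addr0.
have dl : differentiable l v.
  apply: differentiableD; first exact: differentiable_cst.
  apply: linear_differentiable; exact: inject2_continuous.
have Dl : 'D_w l v = (0, w).
  have dl2 : differentiable inject2 v by apply: linear_differentiable; exact: inject2_continuous.
  have := deriveD (diff_derivable (v := w) (differentiable_cst (u, 0 : V) v)) (diff_derivable (v := w) dl2).
  rewrite derive_cst add0r (deriveE _ dl2) diff_lin //; exact: inject2_continuous.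
rewrite (_ : (fun v => f (u, v)) = f \o l); last by apply/funext => v'; rewrite /= e.
by rewrite (derive_comp _ dl) ?e// Dl.
Qed.

Lemma open_slice1 A (v : V) : open A -> open [set u : U | A (u, v)].
Proof.
move=> oA; apply: (open_comp (f := fun u => (u, v))) => // u _.
by apply: cvg_pair; [exact: cvg_id|exact: cvg_cst].
Qed.

Lemma open_slice2 A (u : U) : open A -> open [set v : V | A (u, v)].
Proof.
move=> oA; apply: (open_comp (f := fun v => (u, v))) => // v _.
by apply: cvg_pair; [exact: cvg_cst|exact: cvg_id].
Qed.

End product_injections.

Lemma near_openP (T : topologicalType) (x : T) (P : T -> Prop) :
  (\forall y \near x, P y) -> exists N : set T, [/\ open N, N x & forall y, N y -> P y].
Proof.
move=> h; exists (interior [set y | P y]); split; [exact: open_interior|exact: h|].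
by move=> y /nbhs_singleton.
Qed.

Lemma open_preimage_on (U V : topologicalType) (f : U -> V) (A : set U) (B : set V) :
  open A -> open B -> (forall x, A x -> {for x, continuous f}) ->
  open [set x | A x /\ B (f x)].
Proof.
move=> oA oB cf; rewrite openE => x [Ax Bfx].
apply: filterI; first exact: open_nbhs_nbhs (conj oA Ax).
exact: (cf x Ax _ (open_nbhs_nbhs (conj oB Bfx))).
Qed.

Section C_near_calculus.
Context {R : realType}.

Lemma C_near_ext (U V : normedModType R) k (f g : U -> V) x :
  (\forall y \near x, f y = g y) -> C_near k f x -> C_near k g x.
Proof.
move=> /near_openP[N [oN Nx NP]] [A [oA Ax hA]].
have oNA : open (N `&` A) by exact: openI.
exists (N `&` A); split=> //; apply: (C_on_ext oNA (f := f)).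
  by move=> y [/NP].
by apply: C_on_sub hA => y [].
Qed.

Lemma C_near_comp (U : normedModType R) n k (g : U -> 'rV[R]_n) (f : 'rV[R]_n -> R) x :
  C_near k g x -> C_near k f (g x) -> C_near k (f \o g) x.
Proof.
move=> [A [oA Ax hA]] [B [oB Bx hB]].
have oC := open_preimage_on oA oB (C_on_continuous hA).
exists [set y | A y /\ B (g y)]; split=> //.
apply: (C_on_comp oC oB _ _ hB) => [y []//|].
by apply: C_on_sub hA => y [].
Qed.

Lemma near_C_near (U V : normedModType R) k (f : U -> V) x :
  C_near k f x -> \forall y \near x, C_near k f y.
Proof.
move=> [A [oA Ax hA]]; have := open_nbhs_nbhs (conj oA Ax).
by apply: filterS => y Ay; exists A.
Qed.

End C_near_calculus.

(** * Left-invariant frames *)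

Section lie_groups.
Context {R : realType} {n : nat} (G : lie_group R n).
Implicit Types (p q r a : G).

Local Notation "x · y" := (@lgmul R n G x y) (at level 40, left associativity).
Local Notation e := (lgone G).

(** The group record has left axioms only. An idempotent is trivial, [x · lginv x] is idempotent,
    and right inverses give the right unit. *)
Lemma lgmulr1 a : a · e = a.
Proof.
have idem x : x · x = x -> x = e.
  by move=> xx; rewrite -(lgmulV x) -{3}xx lgmulA lgmulV lgmul1.
have Vr x : x · lginv x = e.
  by apply: idem; rewrite -lgmulA [lginv x · _]lgmulA lgmulV lgmul1.
by rewrite -(lgmulV a) lgmulA Vr lgmul1.
Qed.

Lemma lgmul_continuous_left a : continuous (@lgmul R n G a).
Proof.
move=> q; apply: (@continuous_comp _ _ _ (fun r => (a, r)) (fun ab => lgmul ab.1 ab.2)).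
  by apply: cvg_pair; [exact: cvg_cst|exact: cvg_id].
exact: lgmul_continuous.
Qed.

Lemma near_lgmul a q (P : G -> Prop) : (\forall r \near a · q, P r) ->
  \forall r \near q, P (a · r).
Proof. by move=> h; apply: (lgmul_continuous_left h). Qed.

Lemma lgmul_left_smooth a q k :
  C_near k (chart_at (a · q) \o @lgmul R n G a \o point_at q) (ccoord q).
Proof.
have [A [oA Aq hA]] := lgmul_smooth a q k.
exists [set y | A (ccoord a, y)]; split=> //; first exact: open_slice2.
have := C_on_slice2 (ccoord a) oA hA.
rewrite (_ : (fun v => _) = chart_at (a · q) \o @lgmul R n G a \o point_at q)//.
by apply/funext => y /=; rewrite ccoordK.
Qed.

Lemma rep_lgmul (W : Type) (f : G -> W) a q : \forall y \near ccoord q,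
  (f \o @lgmul R n G a \o point_at q) y =
  ((f \o point_at (a · q)) \o (chart_at (a · q) \o @lgmul R n G a \o point_at q)) y.
Proof.
have := near_point_at (mem_chart_at q) (near_lgmul (near_cdom (mem_chart_at (a · q)))).
by apply: filterS => y ay /=; rewrite chart_atK.
Qed.

Lemma lgmul_rep_ccoord a q :
  (chart_at (a · q) \o @lgmul R n G a \o point_at q) (ccoord q) = ccoord (a · q).
Proof. by rewrite /= ccoordK. Qed.

Lemma lgmul_rep_differentiable a q :
  differentiable (chart_at (a · q) \o @lgmul R n G a \o point_at q) (ccoord q).
Proof. by have /C_near_differentiable/nbhs_singleton := lgmul_left_smooth a q 1. Qed.

Lemma vapp_lgmul (Y : vfield G) (f : G -> R) a q : left_invariant_vfield Y ->
  differentiable (f \o point_at (a · q)) (ccoord (a · q)) ->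
  vapp Y (f \o @lgmul R n G a) q = vapp Y f (a · q).
Proof.
move=> hY df; rewrite /vapp /vder (near_eq_derive _ (rep_lgmul f a q)).
have dL := lgmul_rep_differentiable a q.
have df' : differentiable (f \o point_at (a · q))
  ((chart_at (a · q) \o @lgmul R n G a \o point_at q) (ccoord q)).
  by rewrite lgmul_rep_ccoord.
rewrite (derive_comp _ dL df') lgmul_rep_ccoord (deriveEjacobian _ dL).
by rewrite hY.
Qed.

Lemma Cfun_lgmul (f : G -> R) a q k : Cfun k f (a · q) -> Cfun k (f \o @lgmul R n G a) q.
Proof.
move=> hf; have near1 := rep_lgmul f a q.
apply: C_near_ext (_ : C_near k ((f \o point_at (a · q)) \o
  (chart_at (a · q) \o @lgmul R n G a \o point_at q)) (ccoord q)).
  by apply: filterS near1 => y ->.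
apply: C_near_comp; first exact: lgmul_left_smooth.
by rewrite lgmul_rep_ccoord.
Qed.

(** A left translation multiplies the determinant of the frame by its Jacobian and divides the
    density by it. *)
Lemma frame_density (Y : 'I_n -> vfield G) (mu : G -> R) :
  (forall i, left_invariant_vfield (Y i)) -> left_invariant_density mu ->
  forall a, mu a * `|\det (\matrix_i Y i a)| = mu e * `|\det (\matrix_i Y i e)|.
Proof.
move=> hY hmu a; rewrite -(hmu a e) /density_pullback lgmulr1.
have -> : \matrix_i Y i a = (\matrix_i Y i e) *m tangent_mx (@lgmul R n G a) e.
  apply/row_matrixP => i; rewrite [RHS]row_mul [LHS]rowK rowK.
  by rewrite -hY lgmulr1.
by rewrite det_mulmx normrM mulrA mulrAC.
Qed.

Lemma vcoord_lgmul (Y : vfield G) p q a : left_invariant_vfield Y ->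
  cdom (chart_at p) (q · a) ->
  vcoord p Y (q · a) = Y a *m jacobian (chart_at p \o @lgmul R n G q \o point_at a) (ccoord a).
Proof.
move=> hY pqa; rewrite /vcoord hY -mulmxA; congr (_ *m _).
have d1 := lgmul_rep_differentiable q a.
have d2 : differentiable (chart_trans (q · a) p)
    ((chart_at (q · a) \o @lgmul R n G q \o point_at a) (ccoord a)).
  by rewrite lgmul_rep_ccoord; exact: chart_trans_differentiable (mem_chart_at _) pqa.
have j := jacobian_comp d1 d2; rewrite lgmul_rep_ccoord in j.
apply: (etrans (esym j)); apply: near_eq_jacobian; last exact: differentiable_comp.
by apply: filterS (rep_lgmul (chart_at p) q a) => y ->.
Qed.

(** At [q] the field is the derivative of the product [q · a] in [a], at the identity and in the
    direction [Y e]. As a partial derivative of a $C^2$ map of both variables, it is of class $C^1$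
    in [q]. *)
Lemma left_invariant_vcoord (Y : vfield G) p : left_invariant_vfield Y ->
  exists A : set 'rV[R]_n, [/\ open A, A (ccoord p), A `<=` chart_image p &
    C_on 1 (vcoord p Y \o point_at p) A].
Proof.
move=> hY; have := lgmul_smooth p e 2; rewrite lgmulr1 => -[A [oA Ap hA]].
have [h1 h2] := hA.
pose m (xy : 'rV[R]_n * 'rV[R]_n) : 'rV[R]_n :=
  chart_at p (lgmul (point_at p xy.1) (point_at e xy.2)).
pose A1 := [set x | A (x, ccoord e)] `&` chart_image p.
have oA1 : open A1.
  by apply: openI; [exact: open_slice1|exact: chart_image_open].
exists A1; split=> //.
- by split=> //; exact: ccoord_image.
- by move=> x [].
have hDm : C_on 1 ('D_(0, Y e) m) A by exact: h2.
have := C_on_slice1 (ccoord e) oA hDm.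
move=> /(C_on_sub (A := A1)) hm.
apply: (C_on_ext (f := fun x => 'D_(0, Y e) m (x, ccoord e))) => //; last first.
  by apply: hm => x [].
move=> x [Ax /point_atK[px xp]] /=.
have [dm _] := C_on_slice2 x oA hA; have {}dm := dm _ Ax.
rewrite -[LHS](derive_slice2 (Y e) (h1 _ Ax)) (deriveEjacobian _ dm).
have := @vcoord_lgmul Y p (point_at p x) e hY; rewrite lgmulr1 => -> //.
Qed.

End lie_groups.

Lemma open_forall (T : topologicalType) (I : finType) (B : I -> set T) :
  (forall i, open (B i)) -> open [set x | forall i, B i x].
Proof.
move=> oB; rewrite openE => x Bx; apply: filter_forall => i.
exact: open_nbhs_nbhs (conj (oB i) (Bx i)).
Qed.

Section left_invariant_frames.
Context {R : realType} {n : nat} (G : lie_group R n).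
Variable Y : 'I_n -> vfield G.
Hypothesis Y_left : forall i, left_invariant_vfield (Y i).
Implicit Types (p q r a : G).

Local Notation "x · y" := (@lgmul R n G x y) (at level 40, left associativity).
Local Notation e := (lgone G).

Definition chart_frame p i : 'rV[R]_n -> 'rV[R]_n := vcoord p (Y i) \o point_at p.

Lemma chart_frame_C1 p : exists A : set 'rV[R]_n,
  [/\ open A, A (ccoord p), A `<=` chart_image p & forall i, C_on 1 (chart_frame p i) A].
Proof.
have /choice[B hB] := fun i => left_invariant_vcoord p (Y_left i).
exists (chart_image p `&` [set x | forall i, B i x]); split.
- apply: openI; first exact: chart_image_open.
  by apply: open_forall => i; have [] := hB i.
- by split; [exact: ccoord_image|move=> i; have [] := hB i].
- by move=> x [].
- move=> i; have [_ _ _ hC] := hB i; apply: C_on_sub hC => x [_]; exact.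
Qed.

Lemma vapp_fderiv p (f : G -> R) i x : chart_image p x ->
  differentiable (f \o point_at p) x ->
  vapp (Y i) f (point_at p x) = fderiv (chart_frame p) (f \o point_at p) i x.
Proof.
move=> /point_atK[px xp] df.
have df' : differentiable (f \o point_at p) (chart_at p (point_at p x)) by rewrite xp.
by rewrite (vapp_chart _ px df') xp.
Qed.

Section in_chart.
Variables (p : G) (A : set 'rV[R]_n) (f : G -> R).
Hypotheses (oA : open A) (Ap : A `<=` chart_image p).
Hypothesis frameA : forall i, C_on 1 (chart_frame p i) A.
Hypothesis fA : C_on 2 (f \o point_at p) A.

Lemma vapp_fderiv_on i x : A x ->
  vapp (Y i) f (point_at p x) = fderiv (chart_frame p) (f \o point_at p) i x.
Proof. by move=> Ax; apply: vapp_fderiv; [exact: Ap|have [+ _] := fA; exact]. Qed.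

Lemma vapp_rep_C1 i : C_on 1 (vapp (Y i) f \o point_at p) A.
Proof.
apply: (C_on_ext (f := fderiv (chart_frame p) (f \o point_at p) i)) => //.
  by move=> x Ax; rewrite /= vapp_fderiv_on.
exact: fderiv_C1.
Qed.

Lemma vapp_fderiv2_on i j x : A x -> vapp (Y i) (vapp (Y j) f) (point_at p x) =
  fderiv2 (chart_frame p) (f \o point_at p) i j x.
Proof.
move=> Ax; rewrite vapp_fderiv; [|exact: Ap|by have [+ _] := vapp_rep_C1 j; exact].
rewrite /fderiv2 {1}/fderiv; apply: near_eq_derive.
have := open_nbhs_nbhs (conj oA Ax); apply: filterS => y Ay.
exact: vapp_fderiv_on.
Qed.

End in_chart.

Lemma Cfun_vapp (f : G -> R) q i : Cfun 2 f q -> Cfun 1 (vapp (Y i) f) q.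
Proof.
move=> [B [oB Bq fB]]; have [A [oA Aq Aim hA]] := chart_frame_C1 q.
exists (A `&` B); split=> //; first exact: openI.
apply: vapp_rep_C1; [exact: openI|by move=> x [/Aim]| |].
  by move=> j; apply: C_on_sub (hA j) => x [].
by apply: C_on_sub fB => x [].
Qed.

Lemma Cfun_differentiable k (f : G -> R) q : Cfun k.+1 f q ->
  differentiable (f \o point_at q) (ccoord q).
Proof. by move=> /C_near_differentiable/nbhs_singleton. Qed.

(** [Cfun] refers to the preferred chart of the point, which may jump from one point to the next;
    smooth transition maps compare the charts. *)
Lemma near_Cfun k (f : G -> R) q : Cfun k f q -> \forall r \near q, Cfun k f r.
Proof.
move=> hf; have qq := mem_chart_at q.
have n1 : \forall r \near q, C_near k (f \o point_at q) (chart_at q r).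
  exact: (cmap_continuous qq (near_C_near hf)).
apply: filterS2 n1 (near_cdom qq) => r hr qr.
have n2 := rep_chart_trans f qr.
apply: C_near_ext (_ : C_near k ((f \o point_at q) \o chart_trans r q) (ccoord r)).
  by apply: filterS n2 => y ->.
apply: C_near_comp; first exact: chart_smooth (mem_chart_at r) qr k.
by rewrite /chart_trans /= ccoordK.
Qed.

Lemma vapp2_lgmul (f : G -> R) q i j : Cfun 2 f q ->
  vapp (Y i) (vapp (Y j) (f \o @lgmul R n G q)) e = vapp (Y i) (vapp (Y j) f) q.
Proof.
move=> hf; have hf' : Cfun 2 f (q · e) by rewrite lgmulr1.
have E1 := vapp_lgmul (Y_left i) (Cfun_differentiable (Cfun_vapp j hf')).
rewrite lgmulr1 in E1; apply: etrans E1.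
apply: near_eq_vapp; have := near_lgmul (near_Cfun hf').
apply: filterS => r hr; apply: (vapp_lgmul (Y_left j)).
exact: Cfun_differentiable hr.
Qed.

Definition frame_bracket p i j : 'rV[R]_n :=
  'D_(chart_frame p i (ccoord p)) (chart_frame p j) (ccoord p)
  - 'D_(chart_frame p j (ccoord p)) (chart_frame p i) (ccoord p).

Lemma vapp_commutator (f : G -> R) p i j : Cfun 2 f p ->
  vapp (Y i) (vapp (Y j) f) p - vapp (Y j) (vapp (Y i) f) p =
  vder f p (frame_bracket p i j).
Proof.
move=> [B [oB Bq fB]]; have [A [oA Aq Aim hA]] := chart_frame_C1 p.
have oAB : open (A `&` B) by exact: openI.
have ABim : A `&` B `<=` chart_image p by move=> x [/Aim].
have hAB l : C_on 1 (chart_frame p l) (A `&` B) by apply: C_on_sub (hA l) => x [].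
have fAB : C_on 2 (f \o point_at p) (A `&` B) by apply: C_on_sub fB => x [].
have ABp : (A `&` B) (ccoord p) by [].
pose b := chart_frame p; pose x0 := ccoord p; pose h := f \o point_at p.
have V2 k l : vapp (Y k) (vapp (Y l) f) p =
    'D_('D_(b k x0) (b l) x0) h x0 + 'D_(b l x0) ('D_(b k x0) h) x0.
  have e1 := vapp_fderiv2_on oAB ABim hAB fAB k l ABp; rewrite ccoordK in e1.
  apply: (etrans e1); exact: (fderiv_derive oAB hAB fAB l (b k x0) ABp).
have sym := derive_sym (b j x0) (b i x0) oAB ABp fAB.
have [df _] := fAB; have {}df : differentiable h x0 := df _ ABp.
have V3 : vapp (Y i) (vapp (Y j) f) p =
    'D_('D_(b i x0) (b j) x0) h x0 + 'D_(b i x0) ('D_(b j x0) h) x0.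
  exact: (etrans (V2 i j) (congr1 _ (esym sym))).
rewrite V3 (V2 j i).
have -> : vder f p (frame_bracket p i j) =
    'D_('D_(b i x0) (b j) x0) h x0 - 'D_('D_(b j x0) (b i) x0) h x0.
  exact: (deriveBv _ _ df).
have cancel (u v w : R) : u + w - (v + w) = u - v by ring.
exact: cancel.
Qed.

(** The constants are read off at the identity and transported by replacing [f] with its left
    translate. Stating the relation on $C^2$ functions avoids comparing brackets computed in
    different charts. *)
Lemma structure_constants : global_frame Y ->
  exists c : 'I_n -> 'I_n -> 'I_n -> R, forall f q, Cfun 2 f q -> forall i j,
  vapp (Y i) (vapp (Y j) f) q - vapp (Y j) (vapp (Y i) f) q =
  \sum_l c i j l * vapp (Y l) f q.
Proof.
move=> Yfr; pose E := \matrix_i Y i e.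
exists (fun i j l => (frame_bracket e i j *m invmx E) 0 l) => f q hf i j.
have vE : frame_bracket e i j = \sum_l (frame_bracket e i j *m invmx E) 0 l *: Y l e.
  rewrite -[LHS](mulmxKV (Yfr e)) mulmx_sum_row.
  by apply: eq_bigr => l _; rewrite rowK.
have hfe : Cfun 2 f (q · e) by rewrite lgmulr1.
have hf' : Cfun 2 (f \o @lgmul R n G q) e by exact: Cfun_lgmul.
have com := vapp_commutator i j hf'.
apply: etrans (etrans com _).
  exact: (congr2 (fun u v : R => u - v) (esym (vapp2_lgmul i j hf)) (esym (vapp2_lgmul j i hf))).
have dh := Cfun_differentiable hf'.
rewrite /vder {1}vE (derive_sumv _ _ _ dh); apply: eq_bigr => l _.
rewrite (deriveZv _ _ dh); congr (_ * _).
have E1 := vapp_lgmul (Y_left l) (Cfun_differentiable hfe).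
by rewrite lgmulr1 in E1; exact: (etrans _ E1).
Qed.

(** Testing the commutator relation on the coordinate functions of the chart turns it back into a
    relation between vector fields. *)
Lemma chart_frame_bracket (c : 'I_n -> 'I_n -> 'I_n -> R) p A :
  (forall f q, Cfun 2 f q -> forall i j,
    vapp (Y i) (vapp (Y j) f) q - vapp (Y j) (vapp (Y i) f) q =
    \sum_l c i j l * vapp (Y l) f q) ->
  open A -> A `<=` chart_image p -> (forall i, C_on 1 (chart_frame p i) A) ->
  forall i j x, A x ->
  'D_(chart_frame p i x) (chart_frame p j) x - 'D_(chart_frame p j x) (chart_frame p i) x
  = \sum_l c i j l *: chart_frame p l x.
Proof.
move=> hc oA Aim hA i j x Ax; have [px xp] := point_atK (Aim x Ax).
apply/rowP => k; pose f (r : G) : R := chart_at p r 0 k.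
pose coord (y : 'rV[R]_n) : R := y 0 k.
have near_coord y : A y -> \forall y' \near y, coord y' = (f \o point_at p) y'.
  move=> Ay; have := open_nbhs_nbhs (conj oA Ay).
  by apply: filterS => y' /Aim/point_atK[_ yp]; rewrite /= /f yp.
have dcoord (y : 'rV[R]_n) : differentiable coord y by exact: differentiable_coord.
have Dcoord (y v : 'rV[R]_n) : 'D_v coord y = v 0 k.
  have /is_derive_mxP/(_ 0 k) := is_derive_id y v.
  by case.
have vappf l y : A y -> vapp (Y l) f (point_at p y) = chart_frame p l y 0 k.
  move=> Ay; rewrite vapp_fderiv; [|exact: Aim|]; last first.
    exact: near_eq_differentiable (near_coord y Ay) (dcoord y).
  by rewrite -(Dcoord y) /fderiv; apply/esym/near_eq_derive/near_coord.
have db l : differentiable (chart_frame p l) x by have [+ _] := hA l; exact.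
have near_b l : \forall y \near x,
    (fun y => chart_frame p l y 0 k) y = (vapp (Y l) f \o point_at p) y.
  have := open_nbhs_nbhs (conj oA Ax).
  by apply: filterS => y Ay; rewrite /= vappf.
have vapp2f l l' : vapp (Y l) (vapp (Y l') f) (point_at p x) =
    'D_(chart_frame p l x) (chart_frame p l') x 0 k.
  have db' : differentiable (fun y => chart_frame p l' y 0 k) x.
    by apply: (@differentiable_comp _ _ _ _ (chart_frame p l')
      (fun v : 'rV[R]_n => v 0 k)); [exact: db|exact: differentiable_coord].
  rewrite vapp_fderiv; [|exact: Aim|exact: near_eq_differentiable (near_b l') db'].
  apply: etrans (esym (near_eq_derive _ (near_b l'))) _.
  have /is_derive_mxP/(_ 0 k) := derivableP (diff_derivable (v := chart_frame p l x) (db l')).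
  by case.
have hf : Cfun 2 f (point_at p x).
  have [B [oB Bq hB]] := chart_smooth (mem_chart_at (point_at p x)) px 2.
  by exists B; split=> //; exact: (C_on_coord 0 k oB hB).
have := hc f _ hf i j; rewrite !vapp2f => E1.
rewrite summxE mxE [X in _ + X]mxE; apply: (etrans E1); apply: eq_bigr => l _.
by rewrite mxE vappf.
Qed.

End left_invariant_frames.

(** * The divergence polynomials *)

Section divergence_polynomials.
Context {R : realType} {n : nat}.
Variables (c : 'I_n -> 'I_n -> 'I_n -> R) (g : 'I_n -> 'I_n -> R) (m : nat).

Local Notation N := (n + n * n + 1)%N.

(** The layout of [jet_vars], with arbitrary values in place of the derivatives of a function. *)
Definition jetv (a : 'I_n -> R) (H : 'I_n -> 'I_n -> R) (z : R) : 'I_N -> R :=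
  (row_mx (row_mx (\row_(i < n) a i) (mxvec (\matrix_(i < n, j < n) H i j)))
     (z%:M : 'rV[R]_1)) 0.

Definition var1 (i : 'I_n) : mpoly N R := mpolyX R (mnm1 (lshift 1 (lshift (n * n) i))).
Definition var2 (i j : 'I_n) : mpoly N R :=
  mpolyX R (mnm1 (lshift 1 (rshift n (mxvec_index i j)))).
Definition varl : mpoly N R := mpolyX R (mnm1 (rshift (n + n * n) ord0)).

(** This polynomial and the next three mirror [fcoef], [fW], [fquad] and the right-hand side of
    [flow_fderiv2]. *)
Definition coef_mpoly j : mpoly N R := \sum_i g i j *: var1 i.
Definition dcoef_mpoly i j : mpoly N R := \sum_k g k j *: var2 i k.

Definition quad_mpoly l : mpoly N R :=
  \sum_j \sum_k coef_mpoly j * (c j l k *: var1 k).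

Definition dvar2_mpoly i l : mpoly N R :=
  \sum_j \sum_k (coef_mpoly j * (c j l k *: var2 i k) + var1 k * (c j l k *: dcoef_mpoly i j))
  + \sum_j coef_mpoly j * (\sum_k c j i k *: var2 k l)
  - \sum_j dcoef_mpoly i j * var2 j l.

(* For m = 1 the coefficient vanishes because 0^-1 = 0. *)
Definition dvarl_mpoly : mpoly N R := - ((m.-1)%:R^-1 *: (varl * varl)).

Definition dvar_mpoly : 'I_N -> mpoly N R :=
  (row_mx (row_mx (\row_(i < n) quad_mpoly i) (mxvec (\matrix_(i < n, j < n) dvar2_mpoly i j)))
     (\row_(i < 1) dvarl_mpoly)) 0.

(** Dividing the density by $f^{m-1}$ adds $-(m-1)/f$ to the divergence, as $f$ grows at unit speed
    along its gradient. For [m = 1] that value is 0, and the factor [(m != 1%N)%:R] removes the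
    variable itself. *)
Definition div_mpoly : mpoly N R :=
  \sum_i (dcoef_mpoly i i - \sum_j c j i i *: coef_mpoly j) - (m != 1%N)%:R *: varl.

Fixpoint iter_div_mpoly k : mpoly N R :=
  if k is k'.+1 then div_mpoly * iter_div_mpoly k' + mpoly_derivation dvar_mpoly (iter_div_mpoly k')
  else 1.

Lemma jet_index_ind (P : 'I_N -> Prop) :
  (forall i, P (lshift 1 (lshift (n * n) i))) ->
  (forall i j, P (lshift 1 (rshift n (mxvec_index i j)))) ->
  P (rshift (n + n * n) ord0) -> forall i, P i.
Proof.
move=> h1 h2 h3 i; case: (split_ordP i) => j ->; last by rewrite (ord1 j).
case: (split_ordP j) => k ->; first exact: h1.
by case/mxvec_indexP: k => a b; exact: h2.
Qed.

Lemma dvar_mpoly1 i : dvar_mpoly (lshift 1 (lshift (n * n) i)) = quad_mpoly i.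
Proof. by rewrite /dvar_mpoly row_mxEl row_mxEl mxE. Qed.

Lemma dvar_mpoly2 i j : dvar_mpoly (lshift 1 (rshift n (mxvec_index i j))) = dvar2_mpoly i j.
Proof. by rewrite /dvar_mpoly row_mxEl row_mxEr mxvecE mxE. Qed.

Lemma dvar_mpolyl : dvar_mpoly (rshift (n + n * n) ord0) = dvarl_mpoly.
Proof. by rewrite /dvar_mpoly row_mxEr mxE. Qed.

Lemma jetv1 a H z i : jetv a H z (lshift 1 (lshift (n * n) i)) = a i.
Proof. by rewrite /jetv row_mxEl row_mxEl mxE. Qed.

Lemma jetv2 a H z i j : jetv a H z (lshift 1 (rshift n (mxvec_index i j))) = H i j.
Proof. by rewrite /jetv row_mxEl row_mxEr mxvecE mxE. Qed.

Lemma jetvl a H z : jetv a H z (rshift (n + n * n) ord0) = z.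
Proof. by rewrite /jetv row_mxEr mxE eqxx. Qed.

Section evaluation.
Variables (a : 'I_n -> R) (H : 'I_n -> 'I_n -> R) (z : R).
Local Notation ev := (meval (jetv a H z)).

Let w j := \sum_i g i j * a i.
Let W i j := \sum_k g k j * H i k.

Let evsum (I : Type) (r : seq I) (Q : pred I) (F : I -> mpoly N R) :
  ev (\sum_(i <- r | Q i) F i) = \sum_(i <- r | Q i) ev (F i).
Proof. exact: (big_morph _ (@mevalD _ _ _) (@meval0 _ _ _)). Qed.

Lemma meval_var1 i : ev (var1 i) = a i.
Proof. by rewrite /var1 mevalXU jetv1. Qed.

Lemma meval_var2 i j : ev (var2 i j) = H i j.
Proof. by rewrite /var2 mevalXU jetv2. Qed.

Lemma meval_varl : ev varl = z.
Proof. by rewrite /varl mevalXU jetvl. Qed.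

Lemma meval_coef j : ev (coef_mpoly j) = w j.
Proof. by rewrite /coef_mpoly evsum; apply: eq_bigr => i _; rewrite mevalZ meval_var1. Qed.

Lemma meval_dcoef i j : ev (dcoef_mpoly i j) = W i j.
Proof. by rewrite /dcoef_mpoly evsum; apply: eq_bigr => k _; rewrite mevalZ meval_var2. Qed.

Lemma meval_quad l : ev (quad_mpoly l) = \sum_j \sum_k w j * c j l k * a k.
Proof.
rewrite /quad_mpoly evsum; apply: eq_bigr => j _; rewrite evsum; apply: eq_bigr => k _.
by rewrite mevalM mevalZ meval_coef meval_var1 mulrA.
Qed.

Lemma meval_dvar2 i l : ev (dvar2_mpoly i l) =
  \sum_j \sum_k (w j * c j l k * H i k + a k * (W i j * c j l k)) +
  \sum_j w j * (\sum_k c j i k * H k l) - \sum_j W i j * H j l.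
Proof.
rewrite /dvar2_mpoly mevalB mevalD !evsum; congr (_ + _ - _).
- apply: eq_bigr => j _; rewrite evsum; apply: eq_bigr => k _.
  rewrite mevalD !mevalM !mevalZ meval_coef meval_var1 meval_var2 meval_dcoef.
  by congr (_ + _); [rewrite mulrA|rewrite [c j l k * _]mulrC].
- apply: eq_bigr => j _; rewrite mevalM meval_coef evsum; congr (_ * _).
  by apply: eq_bigr => k _; rewrite mevalZ meval_var2.
- by apply: eq_bigr => j _; rewrite mevalM meval_dcoef meval_var2.
Qed.

Lemma meval_dvarl : ev dvarl_mpoly = - ((m.-1)%:R^-1 * (z * z)).
Proof. by rewrite /dvarl_mpoly mevalN mevalZ mevalM meval_varl. Qed.

Lemma meval_div : ev div_mpoly =
  \sum_i (W i i - \sum_j w j * c j i i) - (m != 1%N)%:R * z.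
Proof.
rewrite /div_mpoly mevalB mevalZ meval_varl; congr (_ - _).
rewrite evsum; apply: eq_bigr => i _; rewrite mevalB meval_dcoef evsum; congr (_ - _).
by apply: eq_bigr => j _; rewrite mevalZ meval_coef mulrC.
Qed.

End evaluation.

Section homogeneity.
Local Notation hom d := (ishomog1 d mdeg).

Let hX i : (mpolyX R (mnm1 i) : mpoly N R) \is hom 1.
Proof. by rewrite dhomogX /= mdeg1. Qed.

Let hS d (I : Type) (r : seq I) (Q : pred I) (F : I -> mpoly N R) :
  (forall i, F i \is hom d) -> \sum_(i <- r | Q i) F i \is hom d.
Proof. by move=> hF; apply: rpred_sum => i _. Qed.

Let hM (p q : mpoly N R) : p \is hom 1 -> q \is hom 1 -> p * q \is hom 2.
Proof. exact: dhomogM. Qed.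

Let hcoef j : coef_mpoly j \is hom 1.
Proof. by apply: hS => i; apply: rpredZ; exact: hX. Qed.

Let hdcoef i j : dcoef_mpoly i j \is hom 1.
Proof. by apply: hS => k; apply: rpredZ; exact: hX. Qed.

Lemma dvar_mpoly_homog i : dvar_mpoly i \is hom 2.
Proof.
elim/jet_index_ind: i => [i|i j|].
- rewrite dvar_mpoly1; apply: hS => j; apply: hS => k.
  by apply: hM => //; apply: rpredZ; exact: hX.
- rewrite dvar_mpoly2; apply: rpredB; [apply: rpredD|].
  + apply: hS => k; apply: hS => l; apply: rpredD.
      by apply: hM => //; apply: rpredZ; exact: hX.
    by apply: hM; [exact: hX|apply: rpredZ; exact: hdcoef].
  + by apply: hS => k; apply: hM => //; apply: hS => l; apply: rpredZ; exact: hX.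
  + by apply: hS => k; apply: hM => //; exact: hX.
- by rewrite dvar_mpolyl rpredN; apply: rpredZ; apply: hM; exact: hX.
Qed.

Lemma div_mpoly_homog : div_mpoly \is hom 1.
Proof.
apply: rpredB; last by apply: rpredZ; exact: hX.
by apply: hS => i; apply: rpredB; [exact: hdcoef|apply: hS => j; apply: rpredZ; exact: hcoef].
Qed.

Lemma iter_div_mpoly_homog k : iter_div_mpoly k \is hom k.
Proof.
elim: k => [|k IH] /=; first exact: dhomog1.
apply: rpredD; first exact: (dhomogM div_mpoly_homog IH).
exact: mpoly_derivation_homog dvar_mpoly_homog IH.
Qed.

End homogeneity.

Section last_variable.
Hypothesis m1 : m = 1%N.
Let l : 'I_N := rshift (n + n * n) ord0.
Local Notation free p := (mderiv l p = 0).

Let fD (p q : mpoly N R) : free p -> free q -> free (p + q).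
Proof. by move=> hp hq; rewrite mderivD hp hq addr0. Qed.

Let fZ (x : R) (p : mpoly N R) : free p -> free (x *: p).
Proof. by move=> hp; rewrite mderivZ hp scaler0. Qed.

Let fM (p q : mpoly N R) : free p -> free q -> free (p * q).
Proof. by move=> hp hq; rewrite mderivM hp hq mul0r mulr0 addr0. Qed.

Let fN (p : mpoly N R) : free p -> free (- p).
Proof. by move=> hp; rewrite mderivN hp oppr0. Qed.

Let fS (I : Type) (r : seq I) (Q : pred I) (F : I -> mpoly N R) :
  (forall i, free (F i)) -> free (\sum_(i <- r | Q i) F i).
Proof.
by move=> hF; elim/big_ind : _ => //; exact: mderiv0.
Qed.

Let fX i : i != l -> free (mpolyX R (mnm1 i) : mpoly N R).
Proof. by move=> il; rewrite mderivX mnm1E (negbTE il) scale0r. Qed.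

Let f1 i : free (var1 i).
Proof. by apply: fX; rewrite eq_lrshift. Qed.

Let f2 i j : free (var2 i j).
Proof. by apply: fX; rewrite eq_lrshift. Qed.

Let fcoef' j : free (coef_mpoly j).
Proof. by apply: fS => i; exact: fZ. Qed.

Let fdcoef i j : free (dcoef_mpoly i j).
Proof. by apply: fS => k; exact: fZ. Qed.

Lemma dvar_mpoly_free i : free (dvar_mpoly i).
Proof.
elim/jet_index_ind: i => [i|i j|].
- by rewrite dvar_mpoly1; apply: fS => j; apply: fS => k; apply: fM => //; exact: fZ.
- rewrite dvar_mpoly2; apply: fD; [apply: fD|apply: fN].
  + by apply: fS => k; apply: fS => q; apply: fD; apply: fM => //; exact: fZ.
  + by apply: fS => k; apply: fM => //; apply: fS => q; exact: fZ.
  + by apply: fS => k; exact: fM.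
- by rewrite dvar_mpolyl /dvarl_mpoly m1 invr0 scale0r oppr0 mderiv0.
Qed.

(** Independence of the last variable, as a zero partial derivative, is stable under the recursion:
    for [m = 1] neither [div_mpoly] nor any [dvar_mpoly] contains that variable. *)
Lemma iter_div_mpoly_free k : free (iter_div_mpoly k).
Proof.
elim: k => [|k IH] /=; first by rewrite -(mpolyC1) mderivC.
apply: fD; last exact: mderiv_mpoly_derivation dvar_mpoly_free IH.
apply: fM => //; apply: fD; last by rewrite m1 scale0r oppr0 mderiv0.
by apply: fS => i; apply: fD => //; apply: fN; apply: fS => j; exact: fZ.
Qed.

End last_variable.

End divergence_polynomials.

Section C_near_maps.
Context {R : realType}.

Lemma C_near_row (U : normedModType R) n k (f : U -> 'rV[R]_n) x :
  (forall j, C_near k (fun y => f y 0 j) x) -> C_near k f x.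
Proof.
move=> /choice[A hA]; have oA : open [set y | forall j, A j y].
  by apply: open_forall => j; have [] := hA j.
exists [set y | forall j, A j y]; split=> // [j|]; first by have [] := hA j.
apply: C_on_row => // j; have [_ _ h] := hA j.
by apply: C_on_sub h => y; exact.
Qed.

Lemma C_near_coord (U : normedModType R) m n k (f : U -> 'M[R]_(m, n)) x i j :
  C_near k f x -> C_near k (fun y => f y i j) x.
Proof. by move=> [A [oA Ax hA]]; exists A; split=> //; exact: C_on_coord. Qed.

Lemma C_near_comp_row (U : normedModType R) n m k (g : U -> 'rV[R]_n)
    (f : 'rV[R]_n -> 'rV[R]_m) x :
  C_near k g x -> C_near k f (g x) -> C_near k (f \o g) x.
Proof.
move=> hg hf; apply: C_near_row => j.
exact: (C_near_comp hg (C_near_coord 0 j hf)).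
Qed.

Lemma C1_flow_C_near n (b : 'rV[R]_n -> 'rV[R]_n) A x0 phi J T C x t :
  is_C1_flow b A x0 phi J T C -> `|x - x0| < T -> `|t| < T -> C_near 1 (phi t) x.
Proof.
move=> [T0 H] xT tT.
have oB : open [set y | `|y - x0| < T].
  rewrite openE => y yT; exact: (near_dist_lt yT).
exists [set y | `|y - x0| < T]; split=> //; split=> [y yT|v y yT].
  by have [_ _ /(_ t tT)[_ _ _ _ []]] := H y yT.
have [_ _ /(_ t tT)[_ _ _ _ [_ _ _ cJ]]] := H y yT.
have cvJ : {for y, continuous (fun y => v *m J t y)}.
  by apply: continuous_mulmx => //; exact: cst_continuous.
apply: near_eq_continuous cvJ.
apply: filterS (near_dist_lt yT) => y' y'T.
have [_ _ /(_ t tT)[_ _ _ _ [_ dp jp _]]] := H y' y'T.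
by rewrite (deriveEjacobian _ dp) jp.
Qed.

End C_near_maps.

(** * Lie derivatives along the gradient *)

Section lie_derivative.
Context {R : realType} {n N : nat} (G : lie_group R n).
Variables (X : 'I_N -> vfield G) (Y : 'I_n -> vfield G) (mu : G -> R).
Hypothesis Y_left : forall i, left_invariant_vfield (Y i).
Hypothesis Y_frame : global_frame Y.
Hypothesis mu_left : left_invariant_density mu.
Variables (xi : 'I_N -> 'I_n -> R) (c : 'I_n -> 'I_n -> 'I_n -> R).
Hypothesis XE : forall i p, X i p = \sum_a xi i a *: Y a p.
Hypothesis cE : forall f q, Cfun 2 f q -> forall i j,
  vapp (Y i) (vapp (Y j) f) q - vapp (Y j) (vapp (Y i) f) q =
  \sum_l c i j l * vapp (Y l) f q.

(** The cometric of the structure in the frame [Y]; it plays the part of [g] in the frame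
    computations. *)
Definition gram a b : R := \sum_i xi i a * xi i b.

Lemma gram_sym a b : gram a b = gram b a.
Proof. by apply: eq_bigr => i _; rewrite mulrC. Qed.

Lemma vapp_X (f : G -> R) i p : Cfun 2 f p ->
  vapp (X i) f p = \sum_a xi i a * vapp (Y a) f p.
Proof. by move=> hf; apply: vapp_lin; [exact: XE|exact: Cfun_differentiable hf]. Qed.

Lemma hgrad_frame (f : G -> R) p : Cfun 2 f p ->
  hgrad X f p = \sum_b (\sum_a gram a b * vapp (Y a) f p) *: Y b p.
Proof.
move=> hf; rewrite /hgrad.
under eq_bigr do rewrite (vapp_X _ hf) XE scaler_sumr.
rewrite exchange_big; apply: eq_bigr => b _ /=.
under eq_bigr do rewrite scalerA.
rewrite -scaler_suml; congr (_ *: _).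
under [RHS]eq_bigr do rewrite mulr_suml.
rewrite [RHS]exchange_big; apply: eq_bigr => i _ /=.
by rewrite mulr_suml; apply: eq_bigr => a _; rewrite mulrAC.
Qed.

Lemma hgrad_norm_sqr (f : G -> R) p : Cfun 2 f p ->
  \sum_a \sum_b gram a b * vapp (Y a) f p * vapp (Y b) f p = hgrad_norm X f p ^+ 2.
Proof.
move=> hf; rewrite [RHS]sqr_sqrtr; last by apply: sumr_ge0 => i _; exact: sqr_ge0.
under [RHS]eq_bigr do rewrite (vapp_X _ hf) expr2 mulr_suml.
rewrite [RHS]exchange_big; apply: eq_bigr => a _ /=.
under [RHS]eq_bigr do rewrite mulr_sumr.
rewrite [RHS]exchange_big; apply: eq_bigr => b _ /=.
rewrite /gram !mulr_suml; apply: eq_bigr => i _.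
by rewrite -!mulrA; congr (_ * _); rewrite mulrCA.
Qed.

Section at_point.
Variables (O : set G) (f : G -> R) (p : G).
Hypothesis oO : open O.
Hypothesis fO : forall q, O q -> Cfun 2 f q.
Hypothesis eikO : forall q, O q -> hgrad_norm X f q = 1.
Hypothesis Op : O p.

Let Z := hgrad X f.
Let b := chart_frame Y p.
Let h := f \o point_at p.
Let x0 := ccoord p.

Lemma good_chart : exists A : set 'rV[R]_n,
  [/\ open A, A x0 & forall x, A x -> chart_image p x /\ O (point_at p x)] /\
  (forall i, C_on 1 (b i) A) /\ C_on 2 h A.
Proof.
have [A1 [oA1 A1p A1im hA1]] := chart_frame_C1 Y_left p.
have [A2 [oA2 A2p hA2]] := fO Op.
have oA3 := open_preimage_on (chart_image_open (p := p)) oO (fun x px => point_at_continuous px).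
exists (A1 `&` A2 `&` [set x | chart_image p x /\ O (point_at p x)]); split; [split|split].
- by apply: openI => //; exact: openI.
- by split=> //; split; [exact: ccoord_image|rewrite ccoordK].
- by move=> x [_].
- by move=> i; apply: C_on_sub (hA1 i) => x [[]].
- by apply: C_on_sub hA2 => x [[]].
Qed.

Section in_good_chart.
Variable A : set 'rV[R]_n.
Hypotheses (oA : open A) (Ax0 : A x0).
Hypothesis AO : forall x, A x -> chart_image p x /\ O (point_at p x).
Hypothesis bA : forall i, C_on 1 (b i) A.
Hypothesis hA : C_on 2 h A.

Let Aim : A `<=` chart_image p. Proof. by move=> x /AO[]. Qed.

Let bracketA : forall i j x, A x ->
  'D_(b i x) (b j) x - 'D_(b j x) (b i) x = \sum_l c i j l *: b l x.
Proof. exact: chart_frame_bracket cE oA Aim bA. Qed.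

Let va i x : A x -> vapp (Y i) f (point_at p x) = fderiv b h i x.
Proof. exact: vapp_fderiv_on. Qed.

Let eikA x : A x -> \sum_i \sum_j gram i j * fderiv b h i x * fderiv b h j x = 1.
Proof.
move=> Ax; have [_ Opx] := AO Ax.
rewrite -[RHS](expr1n R 2) -[in RHS](eikO Opx) -(hgrad_norm_sqr (fO Opx)).
by apply: eq_bigr => i _; apply: eq_bigr => j _; rewrite !va.
Qed.

Let z := ffield b gram h.

Lemma vcoord_hgrad x : A x -> vcoord p Z (point_at p x) = z x.
Proof.
move=> Ax; have [_ Opx] := AO Ax.
rewrite /vcoord /Z (hgrad_frame (fO Opx)) mulmx_suml; apply: eq_bigr => j _.
rewrite -scalemxAl; congr (_ *: _); rewrite /fcoef.
by apply: eq_bigr => i _; rewrite va.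
Qed.

Lemma field_C1 : C_on 1 z A.
Proof. exact: ffield_C1. Qed.

Section with_flow.
Variables (phi : R -> 'rV[R]_n -> 'rV[R]_n) (J : R -> 'rV[R]_n -> 'M[R]_n) (T C : R).
Hypothesis flow : is_C1_flow z A x0 phi J T C.

Definition lift_flow (t : R) (q : G) : G := point_at p (phi t (chart_at p q)).

Let W : set G := [set q | cdom (chart_at p) q /\
  ([set x | `|x - x0| < T] `&` A) (chart_at p q)].

Let T0 : 0 < T. Proof. by case: flow. Qed.

Lemma lift_flow_in q t : W q -> `|t| < T ->
  [/\ A (phi t (chart_at p q)), cdom (chart_at p) (lift_flow t q),
      chart_at p (lift_flow t q) = phi t (chart_at p q) & O (lift_flow t q)].
Proof.
move=> [pq [xT Ax]] tT; have Ap := flow_in flow xT tT.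
have [im Or] := AO Ap; have [pr e] := point_atK im.
by split.
Qed.

(** [has_velocity] reads the velocity in the chart of the current point, not in the one at [p]; the
    two transition Jacobians are inverse to each other. *)
Lemma lift_flow_velocity q t : W q -> `|t| < T ->
  has_velocity (lift_flow ^~ q) t (Z (lift_flow t q)).
Proof.
move=> Wq tT; have [Ay pr ey Or] := lift_flow_in Wq tT.
have [pq [xT Ax]] := Wq; have [_ H] := flow.
have [_ _ /(_ t tT)[_ _ dphi _ _]] := H _ xT.
set x := chart_at p q in xT dphi Ay ey Ax *; set r := lift_flow t q in pr ey Or *.
split.
  apply: (@continuous_comp _ _ _ (phi ^~ x) (point_at p)).
    exact: is_derive1_continuous dphi.
  by apply: point_at_continuous; exact: Aim.
have dt : differentiable (chart_trans p r) (phi t x).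
  by rewrite -ey; exact: chart_trans_differentiable pr (mem_chart_at r).
apply: (is_derive_eq (is_derive_comp1 dphi dt)).
have e2 : z (phi t x) = Z r *m jacobian (chart_trans r p) (ccoord r).
  exact: esym (vcoord_hgrad Ay).
have E : jacobian (chart_trans r p) (ccoord r) *m jacobian (chart_trans p r) (phi t x) = 1%:M.
  by rewrite -ey; exact: chart_transK (mem_chart_at r) pr.
apply: (etrans (deriveEjacobian _ dt)).
apply: (etrans (congr1 (fun v => v *m jacobian (chart_trans p r) (phi t x)) e2)).
apply: (etrans (esym (mulmxA _ _ _))).
exact: (etrans (congr1 (mulmx (Z r)) E) (mulmx1 _)).
Qed.

Lemma lift_flow_C1 q t : W q -> `|t| < T -> Cmap 1 (lift_flow t) q.
Proof.
move=> Wq tT; have [Ay pr ey Or] := lift_flow_in Wq tT.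
have [pq [xT Ax]] := Wq.
have cphi := C1_flow_C_near flow xT tT.
have phic : {for chart_at p q, continuous (phi t)}.
  by have [B [_ Bx hB]] := cphi; exact: C_on_continuous hB _ Bx.
split.
  apply: (@continuous_comp _ _ _ (chart_at p) (point_at p \o phi t)).
    exact: cmap_continuous.
  apply: continuous_comp => //; exact: point_at_continuous (Aim Ay).
set r := lift_flow t q in pr ey Or *.
apply: (C_near_comp_row (g := phi t \o chart_trans q p) (f := chart_trans p r)).
  apply: C_near_comp_row; first exact: chart_smooth (mem_chart_at q) pq 1.
  by rewrite /chart_trans /= ccoordK.
have -> : (phi t \o chart_trans q p) (ccoord q) = chart_at p r.
  by rewrite /chart_trans /= ccoordK ey.
exact: chart_smooth pr (mem_chart_at r) 1.
Qed.

Lemma lift_flow_local : local_flow O Z p lift_flow.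
Proof.
exists W, T; split=> //.
- apply: open_preimage_on; first exact: cdom_open.
    apply: openI => //; rewrite openE => y yT; exact: (near_dist_lt yT).
  exact: cmap_continuous.
- split; first exact: mem_chart_at.
  by split=> //=; rewrite subrr normr0.
- move=> q Wq; have := lift_flow_in Wq (t := 0); rewrite normr0 => /(_ T0)[_ _ _].
  have [pq [xT _]] := Wq; have [_ /(_ _ xT)[e _ _]] := flow.
  by rewrite /lift_flow e chart_atK.
split.
  move=> q Wq; have [pq [xT _]] := Wq; have [_ /(_ _ xT)[e _ _]] := flow.
  by rewrite /lift_flow e chart_atK.
move=> q t Wq tT; split; [by have [] := lift_flow_in Wq tT| |].
  exact: lift_flow_velocity.
exact: lift_flow_C1.
Qed.

Let x0T : `|x0 - x0| < T. Proof. by rewrite subrr normr0. Qed.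

Let Wp : W p.
Proof. by split; [exact: mem_chart_at|split; [exact: x0T|exact: Ax0]]. Qed.

Lemma tangent_lift_flow t : `|t| < T -> tangent_mx (lift_flow t) p =
  J t x0 *m jacobian (chart_trans p (lift_flow t p)) (phi t x0).
Proof.
move=> tT; have [Ay pr ey Or] := lift_flow_in Wp tT.
set r := lift_flow t p in pr ey Or *.
have [_ H] := flow; have [_ _ /(_ t tT)[_ _ _ _ [_ dp jp _]]] := H _ x0T.
have dt : differentiable (chart_trans p r) (phi t x0).
  by rewrite -ey; exact: chart_trans_differentiable pr (mem_chart_at r).
rewrite -jp; apply: etrans _ (jacobian_comp dp dt); apply: esym.
apply: near_eq_jacobian; last exact: differentiable_comp.
apply: filterS (near_chart_image (mem_chart_at p)) => y /point_atK[_ py].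
by rewrite /chart_trans /lift_flow /= py.
Qed.

Let kappa : R := mu (lgone G) * `|\det (\matrix_i Y i (lgone G))|.

(** [kappa] is the constant value of [mu] on the frame. The Jacobian from the chart at [p] to the
    chart of the end point cancels against the one hidden in the frame matrix, which leaves the
    quotient of [flow_det]. *)
Lemma density_lift_flow t : `|t| < T ->
  mu (lift_flow t p) * `|\det (tangent_mx (lift_flow t) p)| =
  kappa * (`|\det (J t x0)| / `|\det (frame_mx b (phi t x0))|).
Proof.
move=> tT; have [Ay pr ey Or] := lift_flow_in Wp tT.
(* Pure algebra: [u] and [v] stand for the inverse transition determinants, [d] for the frame
   determinant at the end point. *)
have gen (k w u v d : R) : d != 0 -> u * v = 1 -> k * (w * v) = k * d * (w / (d * u)).
  move=> d0 uv; have u0 : u != 0 by apply: contraPneq uv => ->; rewrite mul0r => /esym/eqP; rewrite oner_eq0.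
  have -> : v = u^-1 by rewrite -[v]mul1r -(mulVf u0) -mulrA uv mulr1.
  by field; rewrite u0 d0.
rewrite (tangent_lift_flow tT) det_mulmx normrM.
set r := lift_flow t p in pr ey Or *.
have kE : kappa = mu r * `|\det (\matrix_i Y i r)| := esym (frame_density Y_left mu_left r).
rewrite kE.
have FE : frame_mx b (phi t x0) = (\matrix_i Y i r) *m jacobian (chart_trans r p) (ccoord r).
  by apply/row_matrixP => i; rewrite [RHS]row_mul [LHS]rowK rowK.
rewrite FE det_mulmx normrM.
have E : jacobian (chart_trans r p) (ccoord r) *m jacobian (chart_trans p r) (phi t x0) = 1%:M.
  by rewrite -ey; exact: chart_transK (mem_chart_at r) pr.
have E1 : `|\det (jacobian (chart_trans r p) (ccoord r))| *
    `|\det (jacobian (chart_trans p r) (phi t x0))| = 1.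
  by rewrite -normrM -det_mulmx E det1 normr1.
have Yr : `|\det (\matrix_i Y i r)| != 0.
  by rewrite normr_eq0; have := Y_frame r; rewrite unitmxE unitfE.
apply: (gen (mu r) _ _ _ _ Yr E1).
Qed.

Section polynomials.
Variable m : nat.
Hypothesis m_f : m = 1%N \/ forall q, O q -> f q != 0.

Let last (y : 'rV[R]_n) : R := m.-1%:R / h y.
Let vars (y : 'rV[R]_n) := jetv (fun i => fderiv b h i y) (fun i j => fderiv2 b h i j y) (last y).
Let Q := dvar_mpoly c gram m.

Lemma jet_varsE y : A y ->
  jet_vars Y f (m.-1%:R / f (point_at p y)) (point_at p y) = vars y.
Proof.
move=> Ay; set q := point_at p y.
have e1 : (fun i => vapp (Y i) f q) = fun i => fderiv b h i y.
  by apply/funext => i; exact: va.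
have e2 : (fun i j => vapp (Y i) (vapp (Y j) f) q) = fun i j => fderiv2 b h i j y.
  by apply/funext => i; apply/funext => j; exact: (vapp_fderiv2_on oA Aim bA hA).
by rewrite /vars -e1 -e2.
Qed.

Let phi0 : phi 0 x0 = x0. Proof. by have [_ /(_ x0 x0T)[]] := flow. Qed.

Let Oh : m = 1%N \/ h x0 != 0.
Proof. by case: m_f => [->|hf]; [left|right; rewrite /h /= ccoordK; exact: hf]. Qed.

Lemma vars_derive i : is_derive (0 : R) 1 (fun t => vars (phi t x0) i)
  (meval (vars (phi 0 x0)) (Q i)).
Proof.
rewrite phi0; elim/(@jet_index_ind n): i => [i|i j|].
- rewrite (_ : (fun t => _) = fun t => fderiv b h i (phi t x0)); last first.
    by apply/funext => t; rewrite /vars jetv1.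
  rewrite /Q dvar_mpoly1 meval_quad.
  exact: (flow_fderiv oA bA bracketA hA gram_sym eikA Ax0 flow i).
- rewrite (_ : (fun t => _) = fun t => fderiv2 b h i j (phi t x0)); last first.
    by apply/funext => t; rewrite /vars jetv2.
  rewrite /Q dvar_mpoly2 meval_dvar2.
  exact: (flow_fderiv2 oA bA bracketA hA gram_sym eikA Ax0 flow i j).
- rewrite (_ : (fun t => _) = fun t => m.-1%:R / h (phi t x0)); last first.
    by apply/funext => t; rewrite /vars jetvl.
  rewrite /Q dvar_mpolyl meval_dvarl /last.
  (* For [m = 1] the last variable is [0 / h], constantly 0 even where [h] vanishes. *)
  case: Oh => [->|h0] /=.
    rewrite invr0 mul0r oppr0 (_ : (fun t => _) = cst 0); first exact: is_derive_cst.
    by apply/funext => t; rewrite mul0r.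
  have h1 := flow_h hA eikA Ax0 flow.
  have h0' : h (phi 0 x0) != 0 by rewrite phi0.
  have h2 := is_derive_inv (f := fun t => h (phi t x0)) h0' h1.
  have h3 := is_deriveZ (m.-1%:R : R) h2.
  apply: (is_derive_eq h3); rewrite phi0 mulr1.
  (* If [m.-1] is 0 both sides vanish, the right one because [0^-1 = 0]. *)
  have [->|m0] := eqVneq (m.-1%:R : R) 0; first by rewrite scale0r invr0 mul0r oppr0.
  by rewrite /GRing.scale /=; field; rewrite h0 m0.
Qed.

Lemma weight_derive : is_derive (0 : R) 1 (fun t => (h (phi t x0) ^+ m.-1)^-1)
  (- (last x0 / h x0 ^+ m.-1)).
Proof.
rewrite /last; case: Oh => [->|h0] /=.
  rewrite !mul0r oppr0 (_ : (fun t => _) = cst 1); first exact: is_derive_cst.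
  by apply/funext => t; rewrite expr0 invr1.
have h1 := flow_h hA eikA Ax0 flow.
have h2 := is_deriveX m.-1 h1.
have powE k : ((fun t => h (phi t x0)) ^+ k : R -> R) = fun t => h (phi t x0) ^+ k.
  by apply/funext => t; rewrite fctE.
rewrite powE in h2.
have h0' : (h (phi 0 x0)) ^+ m.-1 != 0 by rewrite phi0 expf_neq0.
have h3 := is_derive_inv (f := fun t => h (phi t x0) ^+ m.-1) h0' h2.
apply: (is_derive_eq h3); rewrite phi0.
have scale1 (x : R) : x%:A = x by exact: mulr1.
rewrite scale1; case: (m.-1) => [|k]; first by rewrite !mul0r mulr0 oppr0.
have hk : h x0 ^+ k != 0 by rewrite expf_neq0.
rewrite (exprS _ k) [k.+1.-1]/=; move: h0 hk; move: (h x0 ^+ k) => u; move: (h x0) (k.+1%:R : R) => v w v0 u0.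
by field; rewrite u0 v0.
Qed.

(** Along the flow the pulled back density is [kappa] times three factors: the polynomial of the
    jet, the inverse power of [f] and the quotient of determinants. [is_derive_meval],
    [weight_derive] and [flow_det] differentiate them, and the product rule is the recursion of
    [iter_div_mpoly]. *)
Lemma iter_div_step k : is_Lie_density O Z
  (fun q => meval (jet_vars Y f (m.-1%:R / f q) q) (iter_div_mpoly c gram m k) *
            (mu q / f q ^+ m.-1)) p
  (meval (jet_vars Y f (m.-1%:R / f p) p) (iter_div_mpoly c gram m k.+1) *
            (mu p / f p ^+ m.-1)).
Proof.
exists lift_flow; split; first exact: lift_flow_local.
set P := iter_div_mpoly c gram m.
have hF := is_derive_meval (v := fun t => vars (phi t x0)) (P k) vars_derive.
have bE : frame_mx b x0 = \matrix_i Y i p.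
  apply/row_matrixP => i; rewrite !rowK /b /chart_frame /= ccoordK /vcoord.
  by rewrite chart_trans_id ?mulmx1//; exact: mem_chart_at.
have uB : frame_mx b x0 \in unitmx by rewrite bE; exact: Y_frame.
have hd := flow_det oA bA bracketA hA Ax0 flow uB.
have hw := weight_derive.
have hM := is_deriveZ kappa (is_deriveM (is_deriveM hF hw) hd).
have near_T : \forall t \near (0 : R), `|t| < T by apply: nbhs0_lt.
have nearE : \forall t \near (0 : R),
  (kappa *: ((fun t => meval (vars (phi t x0)) (P k)) *
     (fun t => (h (phi t x0) ^+ m.-1)^-1) *
     (fun t => `|\det (J t x0)| / `|\det (frame_mx b (phi t x0))|))) t =
  density_pullback (lift_flow t) (fun q => meval (jet_vars Y f (m.-1%:R / f q) q) (P k) *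
            (mu q / f q ^+ m.-1)) p.
  apply: filterS near_T => t tT; have [Ay _ _ _] := lift_flow_in Wp tT.
  rewrite /density_pullback -/(lift_flow t p).
  have e1 := density_lift_flow tT.
  have e2 := jet_varsE Ay.
  transitivity (meval (vars (phi t x0)) (P k) * (h (phi t x0) ^+ m.-1)^-1 *
     (mu (lift_flow t p) * `|\det (tangent_mx (lift_flow t) p)|)).
    rewrite e1 -[LHS]/(kappa * (meval (vars (phi t x0)) (P k) * (h (phi t x0) ^+ m.-1)^-1 *
      (`|\det (J t x0)| / `|\det (frame_mx b (phi t x0))|))).
    by rewrite mulrCA.
  rewrite -e2 -/(lift_flow t p) -[h (phi t x0)]/(f (lift_flow t p)).
  by ring.
apply: (is_derive_eq (near_eq_is_derive nearE hM)).
have mu_p : mu p = kappa / `|\det (frame_mx b x0)|.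
  have <- : mu p * `|\det (frame_mx b x0)| = kappa by rewrite bE; exact: frame_density Y_left mu_left p.
  by rewrite mulfK// normr_eq0; move: uB; rewrite unitmxE unitfE.
have J0 : `|\det (J 0 x0)| = 1.
  by have [_ /(_ x0 x0T)[_ -> _]] := flow; rewrite det1 normr1.
have hE : h x0 = f p by rewrite /h /= ccoordK.
have := jet_varsE Ax0; rewrite /x0 ccoordK -/x0 => ->.
rewrite phi0 mu_p J0 -hE -/P.
have -> : meval (vars x0) (P k.+1) =
    (fdiv b c gram h x0 - last x0) * meval (vars x0) (P k) + meval (vars x0) (mpoly_derivation Q (P k)).
  rewrite -[P k.+1]/(_ * P k + _) mevalD mevalM meval_div; congr ((_ - _) * _ + _).
  (* The factor [(m != 1%N)%:R] of [div_mpoly] does not change the value: [last] is already 0 when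
     [m = 1]. *)
  by rewrite /last; case: (m) => [|[|m']] /=; rewrite ?mul0r ?mulr0 ?mul1r.
set F0 := (_ * _ : R -> R) 0.
have F0E : F0 = meval (vars x0) (P k) / h x0 ^+ m.-1 by rewrite -[in RHS]phi0.
rewrite F0E; move: (meval _ (mpoly_derivation _ _)) (meval _ (P k)) => u v.
move: (`|\det (frame_mx b x0)|^-1) (h x0 ^+ m.-1) (last x0) (fdiv _ _ _ _ _) => d s l D.
by rewrite /GRing.scale /=; ring.
Qed.

End polynomials.
End with_flow.
End in_good_chart.
End at_point.
End lie_derivative.

(** * Iterated divergences of a solution of the eikonal equation *)

Section iterated_divergences.
Context {R : realType} {n N : nat} (G : lie_group R n).
Variables (X : 'I_N -> vfield G) (Y : 'I_n -> vfield G) (mu : G -> R).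
Hypothesis X_left : forall i, left_invariant_vfield (X i).
Hypothesis Y_left : forall i, left_invariant_vfield (Y i).
Hypothesis Y_frame : global_frame Y.
Hypothesis mu_left : left_invariant_density mu.

(** Both sides are left-invariant, so the coefficients at the identity serve everywhere. *)
Lemma frame_coefficients : exists xi : 'I_N -> 'I_n -> R,
  forall i p, X i p = \sum_a xi i a *: Y a p.
Proof.
pose e := lgone G; pose B : 'M[R]_n := \matrix_a Y a e.
exists (fun i a => (X i e *m invmx B) 0 a) => i p.
have Xe : X i e = \sum_a (X i e *m invmx B) 0 a *: Y a e.
  rewrite -{1}(mulmxKV (Y_frame e) (X i e)) mulmx_sum_row.
  by apply: eq_bigr => a _; rewrite rowK.
rewrite -{1}(lgmulr1 p) X_left {1}Xe mulmx_suml; apply: eq_bigr => a _.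
rewrite -scalemxAl; congr (_ *: _); by rewrite -Y_left lgmulr1.
Qed.

(** The intermediate functions of [is_iter_div] are the evaluations of the polynomials of lower
    order; each Lie derivative is checked at a point in a chart and with a flow of its own. *)
Lemma iter_div_hgrad (xi : 'I_N -> 'I_n -> R) (c : 'I_n -> 'I_n -> 'I_n -> R)
    (O : set G) (f : G -> R) (k m : nat) :
  (forall i p, X i p = \sum_a xi i a *: Y a p) ->
  (forall f q, Cfun 2 f q -> forall i j,
    vapp (Y i) (vapp (Y j) f) q - vapp (Y j) (vapp (Y i) f) q =
    \sum_l c i j l * vapp (Y l) f q) ->
  open O -> (forall p, O p -> Cfun 2 f p) -> (forall p, O p -> hgrad_norm X f p = 1) ->
  m = 1%N \/ (forall p, O p -> f p != 0) ->
  is_iter_div O (hgrad X f) (fun p => mu p / f p ^+ m.-1) k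
    (fun p => meval (jet_vars Y f (m.-1%:R / f p) p) (iter_div_mpoly c (gram xi) m k)).
Proof.
move=> XE cE oO fO eik mf.
exists (fun j p => meval (jet_vars Y f (m.-1%:R / f p) p) (iter_div_mpoly c (gram xi) m j)).
split=> [p _|j p _ Op|//]; first by rewrite /= meval1.
have [A [[oA Ap AO] [bA hA]]] := good_chart Y_left oO fO Op.
have [phi [J [T [C flow]]]] := C1_flow_exists oA Ap (field_C1 xi oA bA hA).
exact: (iter_div_step Y_left Y_frame mu_left XE cE fO eik Op oA Ap AO bA hA flow mf).
Qed.

End iterated_divergences.

(** * The distance from a submanifold *)

Section distance.
Context {R : realType} {n N : nat} {M : smooth_manifold R n} (X : 'I_N -> vfield M).
Implicit Types (S U : set M) (p : M).

Lemma sR_length_ge0 g : (0 <= sR_length X g)%E.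
Proof. by apply: integral_ge0 => t _; rewrite lee_fin sqrtr_ge0. Qed.

Lemma sR_dist_ge0 p q : 0 <= sR_dist X p q.
Proof. by apply/fine_ge0/le_ereal_inf_tmp => _ [g _ <-]; exact: sR_length_ge0. Qed.

Lemma sR_norm0 p : sR_norm X p 0 = 0.
Proof.
apply: ler0_sqrtr; apply: ge_inf.
  by exists 0 => _ [u _ ->]; apply: sumr_ge0 => i _; exact: sqr_ge0.
exists (fun=> 0); first by rewrite big1// => i _; rewrite scale0r.
by rewrite big1// => i _; rewrite expr0n.
Qed.

Lemma horizontal_cst p : horizontal_curve X (fun=> p).
Proof.
split; first split.
- exact: cst_continuous.
- move=> a b q _ _ _ _ e e0; exists 1 => // k x y _ _ _.
  by rewrite big1// => i _; rewrite /= subrr normr0.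
- exists (fun _ _ => 0); split=> [i|].
    split; first exact: measurable_cst.
    by exists 0; apply: aeW => t _; rewrite normr0.
  apply: aeW => t _; rewrite big1; last by move=> i _; rewrite scale0r.
  split; first exact: cst_continuous.
  exact: is_derive_cst.
Qed.

Lemma sR_distxx p : sR_dist X p p = 0.
Proof.
set E := [set sR_length X g | g in [set g | [/\ horizontal_curve X g, g 0 = p & g 1 = p]]].
have E0 : (0 <= ereal_inf E)%E.
  by apply: le_ereal_inf_tmp => _ [g _ <-]; exact: sR_length_ge0.
have E1 : (ereal_inf E <= 0)%E.
  apply: ge_ereal_inf; exists (sR_length X (fun=> p)).
    by exists (fun=> p) => //; split=> //; exact: horizontal_cst.
  rewrite /sR_length integral0_eq// => t _; congr (_%:E).
  rewrite (_ : velocity _ t = 0) ?sR_norm0//.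
  by rewrite /velocity; have [_] := is_derive_cst (chart_at p p) (t : R) 1.
by rewrite /sR_dist -/E (_ : ereal_inf E = 0%E)//; apply/eqP; rewrite eq_le E0 E1.
Qed.

Lemma dist_from_le0 S p : S p -> dist_from X S p <= 0.
Proof.
move=> Sp; apply: ge_inf.
  by exists 0 => _ [q _ <-]; exact: sR_dist_ge0.
by exists p => //; exact: sR_distxx.
Qed.

Lemma sR_hamiltonian_ge0 l : 0 <= sR_hamiltonian X l.
Proof. by rewrite mulr_ge0 ?invr_ge0//; apply: sumr_ge0 => i _; exact: sqr_ge0. Qed.

Lemma pairingD (v w : 'rV[R]_n) (xi : 'cV[R]_n) : pairing (v + w) xi = pairing v xi + pairing w xi.
Proof. by rewrite /pairing mulmxDl mxE. Qed.

Lemma pairingZ (a : R) (v : 'rV[R]_n) (xi : 'cV[R]_n) : pairing (a *: v) xi = a * pairing v xi.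
Proof. by rewrite /pairing -scalemxAl mxE. Qed.

Lemma pairing_sum (I : finType) (v : I -> 'rV[R]_n) (xi : 'cV[R]_n) :
  pairing (\sum_i v i) xi = \sum_i pairing (v i) xi.
Proof. by rewrite /pairing mulmx_suml summxE. Qed.

Lemma pairing_eq0 (xi : 'cV[R]_n) : (forall v : 'rV[R]_n, pairing v xi = 0) -> xi = 0.
Proof.
move=> h; apply/matrixP => i j; rewrite (ord1 j) mxE.
by have := h (delta_mx 0 i); rewrite /pairing -rowE mxE.
Qed.

(** A zero Hamiltonian says that the covector kills the distribution, the conormal condition that it
    kills the tangent space; together these span. *)
Lemma conormal_hamiltonian0 S l : noncharacteristic X S -> conormal S l ->
  sR_hamiltonian X l = 0 -> l.2 = 0.
Proof.
move=> nc [Sl hl] /eqP; rewrite mulf_eq0 invr_eq0 pnatr_eq0 /=.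
rewrite psumr_eq0 => [/allP h0|i _]; last exact: sqr_ge0.
have Xl i : pairing (X i l.1) l.2 = 0.
  by have := h0 i (mem_index_enum i); rewrite sqrf_eq0 => /eqP.
apply: pairing_eq0 => v; have [u [w [tw ->]]] := nc _ Sl v.
rewrite pairingD (hl _ tw) addr0 pairing_sum big1// => i _.
by rewrite pairingZ Xl mulr0.
Qed.

(** At distance 0 the covector [l] would be 0, so that the minimizing geodesic, the exponential of
    [t *: l.2], would be constant: it starts in [S] and ends outside. *)
Lemma dist_from_gt0 S eps U : noncharacteristic X S -> tubular_neighbourhood X S eps U ->
  forall p, (U `\` S) p -> 0 < dist_from X S p.
Proof.
move=> nc tube p [Up nSp]; have [_ EV _ _] := tube_diffeo tube.
move: Up; rewrite -EV => -[l Vl lp]; rewrite -lp in nSp *.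
rewrite (tube_dist tube Vl) lt_neqAle sqrtr_ge0 andbT; apply/eqP => /esym/eqP.
rewrite sqrtr_eq0 pmulr_rle0// => H0.
have {}H0 : sR_hamiltonian X l = 0 by apply/eqP; rewrite eq_le H0 sR_hamiltonian_ge0.
have l0 := conormal_hamiltonian0 nc Vl.1 H0.
have [[_ _ Sg0 _ _] _] := tube_geodesic tube Vl nSp; apply: nSp.
by case: l l0 Sg0 {lp Vl H0} => x xi /= ->; rewrite scale0r.
Qed.

Lemma Cfun_continuous k (f : M -> R) p : Cfun k f p -> {for p, continuous f}.
Proof.
move=> [A [oA Ap hA]].
have c : {for p, continuous ((f \o point_at p) \o chart_at p)}.
  apply: continuous_comp; first exact/cmap_continuous/mem_chart_at.
  exact: C_on_continuous hA _ Ap.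
move=> B /=; rewrite -{1}(ccoordK p) => /c; apply: filterS2 (near_cdom (mem_chart_at p)) => q pq.
by rewrite /= chart_atK.
Qed.

(** Openness comes from the distance, which is positive and continuous at the points of [U \ S] and
    at most 0 on [S]. *)
Lemma tube_complement_open S eps U : noncharacteristic X S ->
  tubular_neighbourhood X S eps U -> open (U `\` S).
Proof.
move=> nc tube; rewrite openE => p USp.
have [oU _ _ _] := tube_diffeo tube.
have c := Cfun_continuous (tube_dist_C2 tube USp).
have d0 := dist_from_gt0 nc tube USp.
have n1 : \forall q \near p, 0 < dist_from X S q.
  exact: (cvgr_gt (dist_from X S p) c).
have n2 := open_nbhs_nbhs (conj oU USp.1).
apply: filterS2 n1 n2 => q q0 Uq; split=> // Sq.
by have := dist_from_le0 Sq; rewrite leNgt q0.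
Qed.

End distance.

(** * Tangent and transverse curves of a hypersurface *)

Section hypersurfaces.
Context {R : realType} {n : nat} {M : smooth_manifold R n}.
Variable S : set M.
Hypothesis S_hyper : embedded_submanifold 2 1 S.

(** The curves are the images of the lines [Psi q + t *: w] in an adapted chart, and [j] is the
    coordinate that vanishes on [S]. With [w 0 j = 0] they give tangent vectors; with [w 0 j != 0]
    they leave [S] at once. *)
Lemma hypersurface_curve q : S q -> exists (j : 'I_n) (J : 'M[R]_n), J \in unitmx /\
  forall w : 'rV[R]_n, exists g : R -> M,
    [/\ g 0 = q, \forall t \near (0 : R), (S (g t) <-> t * w 0 j = 0) & has_velocity g 0 (w *m J)].
Proof.
move=> Sq; have [n0 /(_ q Sq)[W [Psi [Phi [[oW Wq] oPW PhiK hPhi SE]]]]] := S_hyper.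
pose x := Psi q; pose j : 'I_n := Ordinal n0.
have Px : (Psi @` W) x by exists q.
have Phix : Phi x = q by have [] := PhiK q Wq.
have [cPhi dPhi2] := hPhi x Px.
have dPhi : differentiable (chart_at q \o Phi) x.
  by have := nbhs_singleton (C_near_differentiable dPhi2); rewrite Phix.
have dPsi : differentiable (Psi \o point_at q) (ccoord q).
  by have [_ h] := PhiK q Wq; exact: nbhs_singleton (C_near_differentiable h).
exists j, (jacobian (chart_at q \o Phi) x); split.
  have dPhi' : differentiable (chart_at q \o Phi) ((Psi \o point_at q) (ccoord q)).
    by rewrite /= ccoordK.
  have E := jacobian_comp dPsi dPhi'.
  have xE : (Psi \o point_at q) (ccoord q) = x by rewrite /= ccoordK.
  rewrite xE in E.
  have did : differentiable (id : 'rV[R]_n -> 'rV[R]_n) (ccoord q) by [].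
  have idE : jacobian (id : 'rV[R]_n -> 'rV[R]_n) (ccoord q) =
      jacobian ((chart_at q \o Phi) \o (Psi \o point_at q)) (ccoord q).
    apply: near_eq_jacobian => //.
    have n1 := near_chart_image (mem_chart_at q).
    have n2 := near_point_at (mem_chart_at q) (open_nbhs_nbhs (conj oW Wq)).
    apply: filterS2 n1 n2 => y /point_atK[_ yE] /PhiK[].
    by rewrite /= => -> _; rewrite yE.
  have id1 : jacobian (id : 'rV[R]_n -> 'rV[R]_n) (ccoord q) = 1%:M.
    apply/row_matrixP => i.
    by rewrite !rowE -(deriveEjacobian _ did) derive_id mulmx1.
  by have [_ ->] := mulmx1_unit (etrans (esym E) (etrans (esym idE) id1)).
move=> w; pose l (t : R) := x + t *: w.
have l0 : l 0 = x by rewrite /l scale0r addr0.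
have dl : is_derive (0 : R) 1 l w.
  have h1 := is_derive_scale (is_derive_id (0 : R) 1) (is_derive_cst w (0 : R) 1).
  apply: (is_derive_eq (is_deriveD (is_derive_cst x (0 : R) 1) h1)).
  by rewrite add0r scale1r scale0r addr0.
have cl : {for (0 : R), continuous l} := is_derive1_continuous dl.
exists (Phi \o l); split.
- by rewrite /= l0.
- have : \forall t \near (0 : R), (Psi @` W) (l t).
    by apply: cl; rewrite l0; exact: open_nbhs_nbhs.
  apply: filterS => t [r Wr rE]; have [rK _] := PhiK r Wr.
  have lr : (Phi \o l) t = r by rewrite /= -rE.
  rewrite lr (SE r Wr) rE.
  have xj : x 0 j = 0 by have [+ _] := SE q Wq; move=> /(_ Sq j); exact.
  have ltj : l t 0 j = t * w 0 j by rewrite !mxE xj add0r.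
  split=> [/(_ j)|tw i i1]; first by rewrite ltj; exact.
  have -> : i = j by apply/val_inj => /=; move: i1; rewrite ltnS leqn0 => /eqP.
  by rewrite ltj.
- split.
    by apply: continuous_comp; [exact: cl|rewrite l0].
  have dPhi' : differentiable (chart_at q \o Phi) (l 0) by rewrite l0.
  have := is_derive_comp1 dl dPhi'.
  rewrite /= l0 Phix => h; apply: (is_derive_eq h).
  exact: deriveEjacobian.
Qed.

Lemma hypersurface_codense q (P : M -> Prop) : S q -> (\forall r \near q, P r) ->
  exists r, P r /\ ~ S r.
Proof.
move=> /hypersurface_curve[j [J [_ /(_ (delta_mx 0 j))[g [g0 Sg [cg _]]]]]] nP.
have nPg : \forall t \near (0 : R), P (g t) by apply: cg; rewrite g0.
have n2 : \forall t \near (0 : R), P (g t) /\ (S (g t) <-> t * (delta_mx 0 j : 'rV[R]_n) 0 j = 0).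
  by apply: filterS2 nPg Sg => t.
have /nbhs_ballP[e /= e0 he] := n2.
have e2 : ball (0 : R) e (e / 2).
  by rewrite -ball_normE /= sub0r normrN gtr0_norm ?divr_gt0//; lra.
have [Pe Se] := he _ e2; exists (g (e / 2)); split=> // /Se.
by rewrite mxE !eqxx mulr1; lra.
Qed.

(** The vectors [w *m J] with [w 0 j = 0] are tangent, so a vector that is not tangent has a nonzero
    [j]-th coordinate and spans the whole space together with them. *)
Lemma hypersurface_conormal0 l v : conormal S l -> ~ tangent_to S l.1 v ->
  pairing v l.2 = 0 -> l.2 = 0.
Proof.
move=> [Sl hl] nv vl; have [j [J [uJ curve]]] := hypersurface_curve Sl.
have tangent0 (w : 'rV[R]_n) : w 0 j = 0 -> tangent_to S l.1 (w *m J).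
  move=> w0; have [g [g0 Sg vg]] := curve w; exists g; split=> //.
  by apply: filterS Sg => t [_]; apply; rewrite w0 mulr0.
pose wv := v *m invmx J.
have wv0 : wv 0 j != 0.
  by apply/eqP => w0; apply: nv; rewrite -(mulmxKV uJ v); exact: tangent0.
apply: pairing_eq0 => u; pose wu := u *m invmx J; pose a := wu 0 j / wv 0 j.
have : pairing ((wu - a *: wv) *m J) l.2 = 0.
  apply: hl; apply: tangent0.
  have -> : (wu - a *: wv) 0 j = wu 0 j - a * wv 0 j.
    by rewrite [LHS]mxE [X in _ + X]mxE [X in _ - X]mxE.
  by rewrite divfK// subrr.
rewrite mulmxBl -scalemxAl !mulmxKV// -scaleNr pairingD pairingZ vl mulr0 addr0.
exact.
Qed.

End hypersurfaces.

(** * The eikonal equation for the signed distance *)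

Section signed_distance.
Context {R : realType} {n N : nat} (G : lie_group R n).
Variables (X : 'I_N -> vfield G) (Y : 'I_n -> vfield G) (xi : 'I_N -> 'I_n -> R).
Hypothesis Y_left : forall i, left_invariant_vfield (Y i).
Hypothesis XE : forall i p, X i p = \sum_a xi i a *: Y a p.
Variables (S U : set G) (eps : G -> R) (Nu : vfield G) (ds : G -> R).
Hypothesis S_hyper : embedded_submanifold 2 1 S.
Hypothesis nc : noncharacteristic X S.
Hypothesis tube : tubular_neighbourhood X S eps U.
Hypothesis trans : transverse_field S Nu.
Hypothesis signed : signed_distance X S eps U Nu ds.

Local Notation dist := (dist_from X S).

Lemma near_eq_hgrad_norm (f g : G -> R) p : (\forall q \near p, f q = g q) ->
  hgrad_norm X f p = hgrad_norm X g p.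
Proof.
by move=> fg; congr Num.sqrt; apply: eq_bigr => i _; rewrite (near_eq_vapp (X i) fg).
Qed.

Lemma hgrad_normN (f : G -> R) p : Cfun 2 f p -> hgrad_norm X (- f) p = hgrad_norm X f p.
Proof.
move=> hf; congr Num.sqrt; apply: eq_bigr => i _.
have df : derivable (f \o point_at p) (ccoord p) (X i p).
  exact/diff_derivable/(Cfun_differentiable hf).
have -> : vapp (X i) (- f) p = - vapp (X i) f p by exact: deriveN.
by rewrite sqrrN.
Qed.

(** The pairing of [l] with [Nu] cannot vanish, since transversality would force [l] and then the
    distance to be 0. So one of the two sign conditions applies. *)
Lemma signed_dist_norm p : (U `\` S) p -> `|ds p| = dist p.
Proof.
move=> USp; have d0 := dist_from_gt0 nc tube USp; move: (USp) => [Up _].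
have [_ EV _ _] := tube_diffeo tube; move: Up d0; rewrite -EV => -[l Vl <-] d0.
have [Sl hl] := Vl.1; have [_ _ nNu] := trans Sl.
have [Nu0|Nu0|Nu0] := ltrgt0P (pairing (Nu l.1) l.2).
- by rewrite (signed_dist_pos signed Vl Nu0) gtr0_norm.
- by rewrite (signed_dist_neg signed Vl Nu0) normrN gtr0_norm.
have l0 := hypersurface_conormal0 S_hyper Vl.1 nNu Nu0.
move: d0; rewrite (tube_dist tube Vl) /sR_hamiltonian l0 big1 => [|i _].
  by rewrite !mulr0 sqrtr0 ltxx.
by rewrite /pairing mulmx0 mxE expr0n.
Qed.

(** The sign of [ds] is locally constant off [S], so near the point [ds] is the distance or its
    opposite. *)
Lemma signed_eikonal_off p : (U `\` S) p -> hgrad_norm X ds p = 1.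
Proof.
move=> USp; have d0 := dist_from_gt0 nc tube USp.
have c := Cfun_continuous (signed_dist_C2 signed USp.1).
have nUS := open_nbhs_nbhs (conj (tube_complement_open nc tube) USp).
rewrite -(tube_eikonal tube USp).
have [s0|s0|s0] := ltrgt0P (ds p).
- apply: near_eq_hgrad_norm; apply: filterS2 nUS (cvgr_gt (ds p) c _ s0) => q USq q0.
  by rewrite -(signed_dist_norm USq) gtr0_norm.
- rewrite -(hgrad_normN (tube_dist_C2 tube USp)); apply: near_eq_hgrad_norm.
  apply: filterS2 nUS (cvgr_lt (ds p) c _ s0) => q USq q0.
  by rewrite -[RHS]/(- dist q) -(signed_dist_norm USq) ltr0_norm// opprK.
- by have e := signed_dist_norm USp; rewrite s0 normr0 in e; rewrite -e ltxx in d0.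
Qed.

Lemma signed_eikonal p : U p -> hgrad_norm X ds p = 1.
Proof.
move=> Up; have [Sp|nSp] := EM (S p); last exact: signed_eikonal_off.
have [oU _ _ _] := tube_diffeo tube.
have hds := signed_dist_C2 signed Up.
(* The squared norm as a polynomial in the continuous functions [vapp (Y a) ds]; this gives
   continuity at a point of [S], where [tube_eikonal] does not apply. *)
pose e q := \sum_a \sum_b gram xi a b * vapp (Y a) ds q * vapp (Y b) ds q.
have ce : {for p, continuous e}.
  have cY a : {for p, continuous (vapp (Y a) ds)}.
    exact: Cfun_continuous (Cfun_vapp Y_left a hds).
  apply: continuous_bigsum => a _; apply: continuous_bigsum => b _.
  apply: continuousM => //; apply: continuousM => //; exact: cst_continuous.
have e1 : e p = 1.
  apply/eqP/negPn/negP => ne.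
  have n1 : \forall q \near p, e q != 1.
    have e0 : e p - 1 != 0 by rewrite subr_eq0.
    have ce1 : e q - 1 @[q --> p] --> e p - 1 by apply: cvgB; [exact: ce|exact: cvg_cst].
    by apply: filterS (cvgr_neq0 _ ce1 e0) => q; rewrite subr_eq0.
  have n2 := open_nbhs_nbhs (conj oU Up).
  have [q [[eq Uq] nSq]] := hypersurface_codense S_hyper Sp (filterI n1 n2).
  have USq : (U `\` S) q by split.
  move: eq; rewrite /e (hgrad_norm_sqr XE (signed_dist_C2 signed Uq)).
  by rewrite (signed_eikonal_off USq) expr1n eqxx.
have := hgrad_norm_sqr XE hds; rewrite -/(e p) e1 => /esym/eqP.
(* The value -1 is excluded because the norm is a square root. *)
by rewrite sqrf_eq1 => /orP[/eqP//|/eqP h]; have := sqrtr_ge0 (\sum_i vapp (X i) ds p ^+ 2); rewrite -[Num.sqrt _]/(hgrad_norm X ds p) h; lra.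
Qed.

End signed_distance.

Theorem theorem1p13 (R : realType) (n N : nat) (G : lie_group R n)
    (G_connected : connected [set: G])
    (X : 'I_N -> vfield G)
    (X_left : forall i, left_invariant_vfield (X i))
    (X_gen : bracket_generating X)
    (mu : G -> R) (mu_gt0 : forall p, 0 < mu p)
    (mu_left : left_invariant_density mu)
    (Y : 'I_n -> vfield G)
    (Y_left : forall a, left_invariant_vfield (Y a))
    (Y_frame : global_frame Y)
    (k m : nat) (m_ge1 : (1 <= m)%N) :
  exists P : mpoly (n + n * n + 1) R,
    [/\ P \is ishomog1 k mdeg,
        m = 1%N -> forall x y : 'I_(n + n * n + 1) -> R,
          (forall i, i != rshift (n + n * n) ord0 -> x i = y i) ->
          meval x P = meval y P &
        forall S : set G,
          embedded_submanifold 2 m S -> noncharacteristic X S ->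
          forall (eps : G -> R) (U : set G), tubular_neighbourhood X S eps U ->
          is_iter_div (U `\` S) (hgrad X (dist_from X S))
            (fun p => mu p / dist_from X S p ^+ m.-1) k
            (fun p => meval
               (jet_vars Y (dist_from X S) (m.-1%:R / dist_from X S p) p) P)
          /\
          (m = 1%N ->
           forall (Nu : vfield G) (ds : G -> R),
             transverse_field S Nu -> signed_distance X S eps U Nu ds ->
             is_iter_div U (hgrad X ds) mu k
               (fun p => meval (jet_vars Y ds 0 p) P))].
Proof.
have [xi XE] := frame_coefficients X_left Y_left Y_frame.
have [c cE] := structure_constants Y_left Y_frame.
(* The witness is built from [c], [gram xi], [m] and [k] alone, all fixed before [S] is. *)
exists (iter_div_mpoly c (gram xi) m k); split.
- exact: iter_div_mpoly_homog.
- by move=> m1 x y; exact: meval_mderiv0 (iter_div_mpoly_free _ _ m1 k).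
move=> S S_emb nc eps U tube; split.
  apply: (iter_div_hgrad Y_left Y_frame mu_left k XE cE).
  - exact: tube_complement_open nc tube.
  - exact: tube_dist_C2 tube.
  - exact: tube_eikonal tube.
  - by right=> p USp; rewrite gt_eqF// (dist_from_gt0 nc tube USp).
(* For [m = 1] the function may vanish, so the open set can be all of [U]; the weight becomes 1 and
   the last variable 0. *)
move=> m1 Nu ds trans signed; subst m.
have [oU _ _ _] := tube_diffeo tube.
have := iter_div_hgrad Y_left Y_frame mu_left k XE cE oU (signed_dist_C2 signed)
  (signed_eikonal Y_left XE S_emb nc tube trans signed) (or_introl erefl).
rewrite (_ : (fun p => mu p / _) = mu); last by apply/funext => p; rewrite expr0 divr1.
rewrite (_ : (fun p => meval _ _) = fun p => meval (jet_vars Y ds 0 p) (iter_div_mpoly c (gram xi) 1 k)) //.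
by apply/funext => p; rewrite mul0r.
Qed.
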